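(* Let $0<r<1$, $n\ge 2$, and $\mathbb{D}^n_r=\{z\in\mathbb{C}^n:\ |z_i|<r,\ 1\le i\le n\}$. Then for every $z\in\mathbb{D}^n\setminus\overline{\mathbb{D}^n_r}$, $$s^{\mathbb{D}^n}_{\mathbb{D}^n\setminus\overline{\mathbb{D}^n_r}}(z)=\max_{1\le i\le n}\frac{\max\{|z_i|,r\}-r}{1-r|z_i|}.$$
   Context: $\mathbb{D}^n$ is the unit polydisk $\{z\in\mathbb{C}^n: |z_i|<1,\ 1\le i\le n\}$. For a bounded domain $D\subset\mathbb{C}^n$ and $z\in D$, the generalized squeezing function with model $\mathbb{D}^n$ is $$s^{\mathbb{D}^n}_D(z)=\sup\{r>0:\ \{w\in\mathbb{C}^n:\max_i|w_i|<r\}\subset f(D)\ \text{for some injective holomorphic } f:D\to\mathbb{D}^n\text{ with } f(z)=0\}.$$ *)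

(* Defs.v *)
From HB Require Import structures.
From mathcomp Require Import all_boot all_order all_algebra.
From mathcomp Require Import complex.
From mathcomp Require Import all_classical all_reals.
From mathcomp Require Import topology normedtype landau derive.

Set Implicit Arguments.
Unset Strict Implicit.
Unset Printing Implicit Defensive.

Import Order.TTheory GRing.Theory Num.Theory.
Import numFieldNormedType.Exports.

Local Open Scope classical_set_scope.
Local Open Scope ring_scope.

(* [R[i]] as a normed module over itself; the library only provides this for its
   alias [R[i]^o].  Row vectors over [R[i]] then carry the maximum norm. *)
HB.instance Definition _ (R : realType) := NormedModule.copy R[i] R[i]^o.

(* [`|w|] has type [R[i]]; this is the same modulus as an element of [R]. *)
Definition modulus (R : realType) (w : R[i]) : R := ComplexField.Normc.normc w.

Definition polydisk (R : realType) (n : nat) (r : R) : set 'rV[R[i]]_n :=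
  [set z | forall i : 'I_n, modulus (z ord0 i) < r].

(* [differentiable] is Frechet differentiability between normed modules over
   [R[i]], so the differential is complex linear.  Meaningful for [D] open: then
   the values of the total function [f] outside [D] are irrelevant. *)
Definition holomorphic_on (R : realType) (n m : nat) (D : set 'rV[R[i]]_n)
    (f : 'rV[R[i]]_n -> 'rV[R[i]]_m) : Prop :=
  forall z, D z -> differentiable f z.

Definition squeezing_radii (R : realType) (n : nat) (D : set 'rV[R[i]]_n)
    (z : 'rV[R[i]]_n) : set R :=
  [set r | 0 < r /\
    exists f : 'rV[R[i]]_n -> 'rV[R[i]]_n,
      [/\ holomorphic_on D f, set_inj D f, f @` D `<=` polydisk 1,
          f z = 0 & polydisk r `<=` f @` D]].

(* For [D] a bounded domain, [z] in [D] and [0 < n], the set of radii is nonempty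
   and bounded above by 1, so [sup] is the actual least upper bound. *)
Definition squeezing (R : realType) (n : nat) (D : set 'rV[R[i]]_n)
    (z : 'rV[R[i]]_n) : R :=
  sup (squeezing_radii D z).

(* Main.v *)
(* Let D be the polydisk shell r < |x| < 1 (maximum norm) and g the right-hand
   side at z.  The Moebius automorphism of the polydisk taking z to 0 maps the
   inner closed polydisk off the polydisk of radius g, so g is an admissible
   radius.  Conversely, let f be admissible for a radius s > g.  By Hartogs f
   extends to F on the whole polydisk, and by the Schwarz lemma on a disc through
   z and a nearest point w of the inner polydisk, |F(w)| <= g < s.  Hence every
   point near w has its F-value in f(D).  This is impossible: F has nonzero
   Jacobian somewhere (an injective holomorphic map cannot have everywhere
   degenerate differential), hence at some w' with |w'| = r near w; writing
   F(w') = f(u), the local inverse of F at w' composed with f maps a neighborhood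
   of u into the closed polydisk of radius r and u to its boundary, so by the
   maximum principle one component is constant and the Jacobian of f vanishes
   near u, hence identically.

   The one-variable theory starts from Goursat's bisection argument, applied to
   finite trapezoid sums; Cauchy's formula is obtained for limits of such sums
   over circles, in logarithmic coordinates, without integration theory. *)
Require Import Defs.
From HB Require Import structures.
From mathcomp Require Import all_boot all_order all_algebra.
From mathcomp Require Import complex ring lra.
From mathcomp Require Import all_classical all_reals.
From mathcomp Require Import topology normedtype landau derive.
From mathcomp Require Import interval_inference sequences exp trigo.

Set Implicit Arguments.
Unset Strict Implicit.
Unset Printing Implicit Defensive.

Import Order.TTheory GRing.Theory Num.Theory.
Import numFieldNormedType.Exports.

Local Open Scope classical_set_scope.
Local Open Scope ring_scope.

(** Dimension at least 2 enters through Hartogs: a second coordinate is required to move a disc off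
    the inner polydisk. Of the extension [F] only the restriction to the shell is controlled; there
    it is injective and bounded by 1. Schwarz is therefore applied on circles close to the unit
    circle, where the disc through z runs in the shell, and injectivity is used only between points
    of the shell.

    That a nonzero Jacobian is nonzero somewhere on the sphere near w rests on the shape of the
    sphere: in the maximum norm it contains circles in a single coordinate, along which a
    holomorphic function with accumulating zeros vanishes identically.

    Several-variable facts are read off complex lines through first- and second-order estimates
    whose constants depend only on a bound and a radius. Being uniform, they pass to pointwise
    limits; this gives holomorphy of partial derivatives, hence of the Jacobian, and of Cauchy
    integrals depending on a parameter. *)

Section Modulus.
Variable R : realType.
Local Notation C := R[i].
Implicit Types (z w : C) (x y e : R).

Lemma modulus_ge0 z : 0 <= modulus z.
Proof. by case: z => a b; rewrite /modulus /= sqrtr_ge0. Qed.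

Lemma modulus0 : modulus (0 : C) = 0.
Proof. exact: ComplexField.Normc.normc0. Qed.

Lemma modulus1 : modulus (1 : C) = 1.
Proof. exact: ComplexField.Normc.normc1. Qed.

Lemma modulusM z w : modulus (z * w) = modulus z * modulus w.
Proof. exact: ComplexField.Normc.normcM. Qed.

Lemma modulusV z : modulus z^-1 = (modulus z)^-1.
Proof. exact: ComplexField.Normc.normcV. Qed.

Lemma modulusX z k : modulus (z ^+ k) = modulus z ^+ k.
Proof. by elim: k => [|k IH]; rewrite ?expr0 ?modulus1// !exprS modulusM IH. Qed.

Lemma modulusN z : modulus (- z) = modulus z.
Proof. by rewrite /modulus normcN. Qed.

Lemma modulus_leD z w : modulus (z + w) <= modulus z + modulus w.
Proof. exact: le_normcD. Qed.

Lemma modulus_leB z w : modulus (z - w) <= modulus z + modulus w.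
Proof. by rewrite -(modulusN w); exact: modulus_leD. Qed.

Lemma modulus_eq0 z : (modulus z == 0) = (z == 0).
Proof.
apply/eqP/eqP => [|->]; last exact: modulus0.
exact: ComplexField.Normc.eq0_normc.
Qed.

Lemma modulus_gt0 z : (0 < modulus z) = (z != 0).
Proof. by rewrite lt_def modulus_ge0 andbT modulus_eq0. Qed.

Lemma modulus_subC z w : modulus (z - w) = modulus (w - z).
Proof. by rewrite -modulusN opprB. Qed.

Lemma modulus_tri z w v : modulus (z - w) <= modulus (z - v) + modulus (v - w).
Proof. by apply: le_trans (modulus_leD _ _); rewrite addrA subrK. Qed.

Lemma modulus_geB z w : modulus z - modulus w <= modulus (z - w).
Proof. by rewrite lerBlDr; apply: le_trans (modulus_leD _ _); rewrite subrK. Qed.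

Lemma modulus_real x : modulus x%:C%C = `|x|.
Proof. by rewrite /modulus /= expr0n /= addr0 sqrtr_sqr. Qed.

Lemma modulus_sum (I : finType) (F : I -> C) :
  modulus (\sum_i F i) <= \sum_i modulus (F i).
Proof.
elim/big_ind2 : _ => [|z x w y zx wy|//]; first by rewrite modulus0.
exact: le_trans (modulus_leD _ _) (lerD zx wy).
Qed.

Lemma modulus_Re z : `|complex.Re z| <= modulus z.
Proof.
case: z => a b; rewrite /modulus /= -sqrtr_sqr ler_wsqrtr// lerDl sqr_ge0//.
Qed.

Lemma modulus_Im z : `|complex.Im z| <= modulus z.
Proof.
case: z => a b; rewrite /modulus /= -sqrtr_sqr ler_wsqrtr// lerDr sqr_ge0//.
Qed.

Lemma modulus_ReIm z : modulus z <= `|complex.Re z| + `|complex.Im z|.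
Proof.
case: z => a b; have -> : (a +i* b)%C = a%:C%C + 'i%C * b%:C%C by simpc.
apply: le_trans (modulus_leD _ _) _; rewrite modulusM !modulus_real.
have -> : modulus ('i%C : C) = 1 by rewrite /modulus /= expr0n expr1n add0r sqrtr1.
by simpc.
Qed.

Lemma modulus_i : modulus ('i%C : C) = 1.
Proof. by rewrite /modulus /= expr0n expr1n add0r sqrtr1. Qed.

Lemma sqr_modulus z : modulus z ^+ 2 = complex.Re z ^+ 2 + complex.Im z ^+ 2.
Proof. by case: z => a b; rewrite /modulus /= sqr_sqrtr ?addr_ge0 ?sqr_ge0. Qed.

Lemma modulus_le0 z : (forall e, 0 < e -> modulus z <= e) -> z = 0.
Proof.
move=> h; apply/eqP; rewrite -modulus_eq0 eq_le modulus_ge0 andbT.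
by apply/ler_addgt0Pr => e e0; rewrite add0r; exact: h.
Qed.

End Modulus.

(** * Limits of complex sequences *)

Section Limits.
Variable R : realType.
Local Notation C := R[i].
Implicit Types (u v : nat -> C) (l : C).

(** The bound is a real number on [modulus], so that estimates stay in [R], where linear arithmetic
    applies. *)
Definition tends u l :=
  forall e : R, 0 < e -> exists m0, forall m, (m0 <= m)%N -> modulus (u m - l) <= e.

Lemma tends_cst l : tends (fun=> l) l.
Proof. by move=> e e0; exists 0%N => m _; rewrite subrr modulus0 ltW. Qed.

Lemma tends_uniq u l l' : tends u l -> tends u l' -> l = l'.
Proof.
move=> ul ul'; apply/eqP; rewrite -subr_eq0; apply/eqP/modulus_le0 => e e0.
have e2 : 0 < e / 2 by lra.
have [m hm] := ul _ e2; have [m' hm'] := ul' _ e2.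
have := hm _ (leq_maxl m m'); have := hm' _ (leq_maxr m m').
rewrite modulus_subC => h1 h2.
have := modulus_tri l' l (u (maxn m m')).
rewrite (modulus_subC l' l) (modulus_subC l'); move: h1; rewrite modulus_subC; lra.
Qed.

Lemma tendsD u v l l' : tends u l -> tends v l' -> tends (fun m => u m + v m) (l + l').
Proof.
move=> ul vl e e0; have e2 : 0 < e / 2 by lra.
have [m hm] := ul _ e2; have [m' hm'] := vl _ e2.
exists (maxn m m') => k; rewrite geq_max => /andP[/hm h1 /hm' h2].
have -> : u k + v k - (l + l') = (u k - l) + (v k - l') by ring.
by have := modulus_leD (u k - l) (v k - l'); lra.
Qed.

Lemma tendsZ (a : C) u l : tends u l -> tends (fun m => a * u m) (a * l).
Proof.
move=> ul e e0; have a1 : 0 < modulus a + 1 by have := modulus_ge0 a; lra.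
have [m hm] := ul _ (divr_gt0 e0 a1); exists m => k /hm h.
rewrite -mulrBr modulusM.
have : (modulus a + 1) * modulus (u k - l) <= e by rewrite mulrC -ler_pdivlMr.
by have := modulus_ge0 (u k - l); nra.
Qed.

Lemma tendsB u v l l' : tends u l -> tends v l' -> tends (fun m => u m - v m) (l - l').
Proof.
move=> ul vl; have := tendsD ul (tendsZ (-1) vl); rewrite mulN1r.
by congr (tends _ _); apply/funext => m; rewrite mulN1r.
Qed.

Lemma tends_modulus_le u l (M : R) :
  tends u l -> (forall m, modulus (u m) <= M) -> modulus l <= M.
Proof.
move=> ul uM; apply/ler_addgt0Pr => e e0; have [m hm] := ul _ e0.
have := hm _ (leqnn m); have := uM m; have := modulus_tri l 0 (u m).
by rewrite !subr0 (modulus_subC l); lra.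
Qed.

Lemma complex_cauchy u :
  (forall e : R, 0 < e -> exists m0, forall m k,
     (m0 <= m)%N -> (m0 <= k)%N -> modulus (u m - u k) <= e) -> exists l, tends u l.
Proof.
move=> cu.
have aux (f : nat -> R) : (forall m k, `|f m - f k| <= modulus (u m - u k)) ->
    exists l : R, forall e : R, 0 < e -> exists m0, forall m, (m0 <= m)%N -> `|f m - l| <= e.
  move=> hf; have : cvg (f @ \oo).
    apply/cauchy_cvgP/cauchy_exP => e e0.
    have e2 : 0 < e / 2 by lra.
    have [m0 hm0] := cu _ e2; exists (f m0), m0 => // m /= m0m.
    rewrite /ball /=; apply: le_lt_trans (hf _ _) _.
    by have := hm0 _ _ (leqnn m0) m0m; lra.
  move/cvg_ex => [l /cvgrPdist_le fl]; exists l => e /fl [m0 _ hm0].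
  by exists m0 => m m0m; rewrite distrC; exact: hm0.
have [a ha] := aux (fun m => complex.Re (u m)) (fun m k =>
  eq_ind _ (fun x => `|x| <= _) (modulus_Re _) _ (raddfB _ _ _)).
have [b hb] := aux (fun m => complex.Im (u m)) (fun m k =>
  eq_ind _ (fun x => `|x| <= _) (modulus_Im _) _ (raddfB _ _ _)).
exists (a +i* b)%C => e e0; have e2 : 0 < e / 2 by lra.
have [m hm] := ha _ e2; have [k hk] := hb _ e2.
exists (maxn m k) => j; rewrite geq_max => /andP[/hm h1 /hk h2].
apply: le_trans (modulus_ReIm _) _.
by rewrite !raddfB /=; lra.
Qed.

Lemma half_pow_lt (e : R) : 0 < e -> exists m, 2^-1 ^+ m < e.
Proof.
move=> e0; have : 2^-1 ^+ m @[m --> \oo] --> (0 : R) by apply: cvg_expr; rewrite ger0_norm; lra.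
move/cvgrPdist_lt => /(_ _ e0) [m0 _ /(_ m0 (leqnn _))] /=.
have h0 : 0 <= 2^-1 ^+ m0 :> R by apply: exprn_ge0; lra.
by rewrite sub0r normrN ger0_norm//; exists m0.
Qed.

(** Completeness for geometrically decreasing steps; the bound on the limit keeps the iteration of
    [inverse_function] inside its ball. *)
Lemma tends_geometric u (c : R) :
  (forall m, modulus (u m.+1 - u m) <= c * 2^-1 ^+ m) ->
  exists2 l, tends u l & modulus (l - u 0%N) <= 2 * c.
Proof.
move=> hu.
have c0 : 0 <= c by have := hu 0%N; rewrite expr0 mulr1; apply: le_trans; exact: modulus_ge0.
(* The exact partial sum of the geometric series, rather than a bound for it, lets the induction on
   [k] close. *)
have hk m k : modulus (u (m + k)%N - u m) <= 2 * c * (2^-1 ^+ m - 2^-1 ^+ (m + k)).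
  elim: k => [|k IH]; first by rewrite addn0 !subrr modulus0 mulr0.
  rewrite addnS; have := hu (m + k)%N; have := modulus_tri (u (m + k).+1) (u m) (u (m + k)%N).
  by rewrite exprS; lra.
have p0 m : 0 <= 2^-1 ^+ m :> R by apply: exprn_ge0; lra.
have [l ul] : exists l, tends u l.
  apply: complex_cauchy => e e0.
  have c1 : 0 < 2 * c + 1 by lra.
  have e2 : 0 < e / 2 by lra.
  have [m0] := half_pow_lt (divr_gt0 e2 c1); rewrite ltr_pdivlMr// => hm0.
  exists m0 => m k m0m m0k.
  have := hk m0 (m - m0)%N; have := hk m0 (k - m0)%N; rewrite !subnKC//.
  have := modulus_tri (u m) (u k) (u m0); rewrite (modulus_subC (u m0)).
  have := p0 m; have := p0 k; have := p0 m0; nra.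
exists l => //; apply: (@tends_modulus_le (fun m => u m - u 0%N)).
  exact: tendsB ul (tends_cst _).
move=> m; have := hk 0%N m; rewrite add0n expr0; have := p0 m; nra.
Qed.

End Limits.

(** * The maximum norm with real values, and little-o remainders *)

Section LittleO.
Variable R : realType.
Local Notation C := R[i].

Definition vnorm n (x : 'rV[C]_n) : R := \big[Num.max/0]_i modulus (x ord0 i).

Lemma vnorm_ge0 n (x : 'rV[C]_n) : 0 <= vnorm x.
Proof. by rewrite /vnorm; elim/big_ind : _ => // [a b a0 b0|*];
  rewrite ?le_max ?a0 ?modulus_ge0. Qed.

Lemma modulus_le_vnorm n (x : 'rV[C]_n) i : modulus (x ord0 i) <= vnorm x.
Proof. by rewrite /vnorm (bigD1 i)//= le_max lexx. Qed.

Lemma vnorm_le n (x : 'rV[C]_n) (e : R) :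
  0 <= e -> (forall i, modulus (x ord0 i) <= e) -> vnorm x <= e.
Proof.
by move=> e0 h; rewrite /vnorm; elim/big_ind : _ => // a b ha hb; rewrite ge_max ha.
Qed.

Lemma vnorm_lt n (x : 'rV[C]_n) (e : R) :
  0 < e -> (forall i, modulus (x ord0 i) < e) -> vnorm x < e.
Proof.
by move=> e0 h; rewrite /vnorm; elim/big_ind : _ => // a b ha hb; rewrite gt_max ha.
Qed.

Lemma vnorm_attained n (x : 'rV[C]_n.+1) : exists i, vnorm x = modulus (x ord0 i).
Proof.
have [i _ hi] := @arg_maxP _ _ _ ord0 xpredT (fun i => modulus (x ord0 i)) isT.
exists i; apply/eqP; rewrite eq_le modulus_le_vnorm andbT.
by apply: vnorm_le => [|j]; [exact: modulus_ge0|exact: hi].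
Qed.

Lemma vnorm0 n : vnorm (0 : 'rV[C]_n) = 0.
Proof.
apply/eqP; rewrite eq_le vnorm_ge0 andbT; apply: vnorm_le => // i.
by rewrite mxE modulus0.
Qed.

Lemma vnormZ n (a : C) (x : 'rV[C]_n) : vnorm (a *: x) = modulus a * vnorm x.
Proof.
case: n x => [|n] x.
  by rewrite /vnorm !big_ord0 mulr0.
have [i xi] := vnorm_attained x.
apply/eqP; rewrite eq_le; apply/andP; split.
  apply: vnorm_le => [|j]; first by rewrite mulr_ge0 ?modulus_ge0 ?vnorm_ge0.
  by rewrite mxE modulusM ler_wpM2l ?modulus_ge0 ?modulus_le_vnorm.
by rewrite xi -modulusM; have := modulus_le_vnorm (a *: x) i; rewrite mxE.
Qed.

Lemma vnorm_leD n (x y : 'rV[C]_n) : vnorm (x + y) <= vnorm x + vnorm y.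
Proof.
apply: vnorm_le => [|i]; first by rewrite addr_ge0 ?vnorm_ge0.
by rewrite mxE (le_trans (modulus_leD _ _))// lerD ?modulus_le_vnorm.
Qed.

Lemma vnormN n (x : 'rV[C]_n) : vnorm (- x) = vnorm x.
Proof. by rewrite -scaleN1r vnormZ modulusN modulus1 mul1r. Qed.

Lemma vnorm_subC n (x y : 'rV[C]_n) : vnorm (x - y) = vnorm (y - x).
Proof. by rewrite -vnormN opprB. Qed.

Lemma vnorm_tri n (x y z : 'rV[C]_n) : vnorm (x - y) <= vnorm (x - z) + vnorm (z - y).
Proof. by apply: le_trans (vnorm_leD _ _); rewrite addrA subrK. Qed.

Lemma vnorm_le0 n (x : 'rV[C]_n) : vnorm x <= 0 -> x = 0.
Proof.
move=> x0; apply/rowP => i; rewrite mxE; apply/eqP; rewrite -modulus_eq0 eq_le.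
by rewrite modulus_ge0 (le_trans (modulus_le_vnorm _ _) x0).
Qed.

Lemma vnorm_gt0 n (x : 'rV[C]_n) : x != 0 -> 0 < vnorm x.
Proof. by move=> x0; rewrite ltNge; apply/negP => /vnorm_le0 /eqP; apply/negP. Qed.

Lemma vnorm_mulmx n m (A : 'M[C]_(n, m)) :
  exists2 c : R, 0 < c & forall x : 'rV[C]_n, vnorm (x *m A) <= c * vnorm x.
Proof.
(* The summand 1 makes the constant positive even for [A = 0], so that it can be divided by. *)
pose c := 1 + \sum_i \sum_j modulus (A i j).
have s0 i : 0 <= \sum_j modulus (A i j) by apply: sumr_ge0 => *; exact: modulus_ge0.
have c1 : 1 <= c by rewrite lerDl; apply: sumr_ge0.
exists c; first lra.
move=> x; have x0 := vnorm_ge0 x; apply: vnorm_le => [|j]; first by rewrite mulr_ge0; lra.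
rewrite mxE (le_trans (modulus_sum _))// /c mulrDl mul1r.
apply: (@le_trans _ _ ((\sum_i \sum_j modulus (A i j)) * vnorm x)); last lra.
rewrite mulr_suml; apply: ler_sum => i _; rewrite modulusM mulrC.
apply: ler_pM; rewrite ?modulus_ge0 ?modulus_le_vnorm//.
by rewrite (bigD1 j)//= lerDl; apply: sumr_ge0 => *; exact: modulus_ge0.
Qed.

(** Remainders are measured by a gauge [d] on an arbitrary type, so that one set of rules serves
    functions of one and of several variables. *)
Definition lino T (d : T -> R) (r : T -> C) :=
  forall e : R, 0 < e -> exists2 t : R, 0 < t & forall w, d w < t -> modulus (r w) <= e * d w.

Lemma linoD T (d : T -> R) r s : lino d r -> lino d s -> lino d (fun w => r w + s w).
Proof.
move=> hr hs e e0; have e2 : 0 < e / 2 by lra.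
have [t t0 ht] := hr _ e2; have [t' t'0 ht'] := hs _ e2.
exists (Num.min t t'); first by rewrite lt_min t0.
move=> w; rewrite lt_min => /andP[/ht h1 /ht' h2].
by apply: le_trans (modulus_leD _ _) _; lra.
Qed.

Lemma linoZ T (d : T -> R) (a : C) r : lino d r -> lino d (fun w => a * r w).
Proof.
move=> hr e e0; have a1 : 0 < modulus a + 1 by have := modulus_ge0 a; lra.
have [t t0 ht] := hr _ (divr_gt0 e0 a1); exists t => // w /ht h.
rewrite modulusM; have d0 : (modulus a + 1) * modulus (r w) <= e * d w.
  by rewrite mulrC -ler_pdivlMr// mulrAC.
by have := modulus_ge0 (r w); nra.
Qed.

Lemma lino_sum T (d : T -> R) n (r : 'I_n -> T -> C) :
  (forall w, 0 <= d w) -> (forall i, lino d (r i)) -> lino d (fun w => \sum_i r i w).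
Proof.
move=> d0; elim: n r => [|n IH] r hr.
  by move=> e e0; exists 1 => // w _; rewrite big_ord0 modulus0 mulr_ge0// ltW.
under [X in lino _ X]funext do rewrite big_ord_recr.
by apply: linoD (hr _); apply: IH => i; exact: hr.
Qed.

End LittleO.

(** * Complex derivatives in one and several variables *)

Section Derivative.
Variable R : realType.
Local Notation C := R[i].

(* [f = a + u L + o(d)].  One variable: [d w = |w - z|] and [u w = w - z]; several
   variables: [d w = vnorm (w - x)] and [u w = w - x]. *)
Definition lin_at T n (d : T -> R) (u : T -> 'rV[C]_n) (f : T -> C) (a : C) (L : 'cV[C]_n) :=
  lino d (fun w => f w - a - (u w *m L) ord0 ord0).

Section Rules.
Variables (T : Type) (n : nat) (d : T -> R) (u : T -> 'rV[C]_n).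
Hypothesis d_ge0 : forall w, 0 <= d w.
Hypothesis u_le : forall w, vnorm (u w) <= d w.

Lemma lin_at_eq f g a L (t : R) : 0 < t -> (forall w, d w < t -> f w = g w) ->
  lin_at d u f a L -> lin_at d u g a L.
Proof.
move=> t0 fg hf e e0; have [s s0 hs] := hf _ e0.
exists (Num.min t s); first by rewrite lt_min t0.
by move=> w; rewrite lt_min => /andP[/fg <- /hs].
Qed.

Lemma mulmx_col_le (L : 'cV[C]_n) : exists2 c : R, 0 < c &
  forall w, modulus ((u w *m L) ord0 ord0) <= c * d w.
Proof.
have [c c0 hc] := vnorm_mulmx L; exists c => // w.
apply: le_trans (modulus_le_vnorm _ _) _; apply: le_trans (hc _) _.
by rewrite ler_pM2l.
Qed.

Lemma lin_at_growth f a L : lin_at d u f a L -> exists c t : R,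
  [/\ 0 < c, 0 < t & forall w, d w < t -> modulus (f w - a) <= c * d w].
Proof.
move=> hf; have [t t0 ht] := hf _ ltr01; have [c c0 hc] := mulmx_col_le L.
exists (c + 1), t; split => //; first lra.
move=> w /ht h1; have h2 := hc w.
have := modulus_tri (f w - a) 0 ((u w *m L) ord0 ord0); rewrite !subr0; lra.
Qed.

Lemma lin_at_cst a : lin_at d u (fun=> a) a 0.
Proof.
by move=> e e0; exists 1 => // w _; rewrite mulmx0 mxE !subrr modulus0 mulr_ge0// ltW.
Qed.

Lemma lin_atD f g a b L M : lin_at d u f a L -> lin_at d u g b M ->
  lin_at d u (fun w => f w + g w) (a + b) (L + M).
Proof.
move=> hf hg; have := linoD hf hg; congr lino; apply/funext => w.
by rewrite mulmxDr !mxE; ring.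
Qed.

Lemma lin_atZ f a L c : lin_at d u f a L -> lin_at d u (fun w => c * f w) (c * a) (c *: L).
Proof.
move=> hf; have := linoZ c hf; congr lino; apply/funext => w.
by rewrite -scalemxAr !mxE; ring.
Qed.

Lemma lin_atB f g a b L M : lin_at d u f a L -> lin_at d u g b M ->
  lin_at d u (fun w => f w - g w) (a - b) (L - M).
Proof.
move=> hf hg; have := linoD hf (linoZ (-1) hg); congr lino; apply/funext => w.
by rewrite mulmxBr !mxE; ring.
Qed.

(** Each factor is O(d), so the product is O(d^2), hence o(d): this is the mixed term of the product
    rule. *)
Lemma lino_mul f g a b L M : lin_at d u f a L -> lin_at d u g b M ->
  lino d (fun w => (f w - a) * (g w - b)).
Proof.
move=> /lin_at_growth[c [t [c0 t0 ht]]] /lin_at_growth[c' [t' [c'0 t'0 ht']]] e e0.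
have cc : 0 < c * c' by rewrite mulr_gt0.
exists (Num.min (Num.min t t') (e / (c * c'))); first by rewrite !lt_min t0 t'0 divr_gt0.
move=> w; rewrite !lt_min => /andP[/andP[/ht h1 /ht' h2]]; rewrite ltr_pdivlMr// => h3.
rewrite modulusM; have := d_ge0 w => dw.
apply: (@le_trans _ _ ((c * d w) * (c' * d w))); first by apply: ler_pM; rewrite ?modulus_ge0.
have : d w * (d w * (c * c')) <= d w * e by apply: ler_wpM2l => //; exact: ltW.
lra.
Qed.

Lemma lin_atM f g a b L M : lin_at d u f a L -> lin_at d u g b M ->
  lin_at d u (fun w => f w * g w) (a * b) (b *: L + a *: M).
Proof.
move=> hf hg; have := linoD (linoD (linoZ a hg) (linoZ b hf)) (lino_mul hf hg).
congr lino; apply/funext => w; rewrite mulmxDr -!scalemxAr !mxE; ring.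
Qed.

(** The remainder splits in two: that of [g] at [F w], which is o(|F w - b|) and thus o(d) by linear
    growth of [F], and the image under [M] of the remainders of the coordinates of [F]. *)
Lemma lin_at_comp m (F : T -> 'rV[C]_m) (b : 'rV[C]_m) (A : 'M[C]_(n, m)) g c (M : 'cV[C]_m) :
  (forall j, lin_at d u (fun w => F w ord0 j) (b ord0 j) (col j A)) ->
  lin_at (fun y => vnorm (y - b)) (fun y => y - b) g c M ->
  lin_at d u (g \o F) c (A *m M).
Proof.
move=> hF hg.
have [cF [tF [cF0 tF0 hFg]]] : exists cF tF : R, [/\ 0 < cF, 0 < tF &
    forall w, d w < tF -> vnorm (F w - b) <= cF * d w].
  have : forall j, exists ct : R * R, [/\ 0 < ct.1, 0 < ct.2 &
      forall w, d w < ct.2 -> modulus (F w ord0 j - b ord0 j) <= ct.1 * d w].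
    by move=> j; have [c' [t' ?]] := lin_at_growth (hF j); exists (c', t').
  move/choice => [ct hct]; exists (1 + \sum_j (ct j).1), (\big[Num.min/1]_j (ct j).2).
  have s0 : 0 <= \sum_j (ct j).1 by apply: sumr_ge0 => j _; have [/ltW] := hct j.
  split; first lra.
    by elim/big_ind : _ => // [x y x0 y0|j _]; [rewrite lt_min x0|have [] := hct j].
  move=> w dw; apply: vnorm_le => [|j]; first by rewrite mulr_ge0//; lra.
  have dwj : d w < (ct j).2 by apply: lt_le_trans dw _; rewrite (bigD1 j)//= ge_min lexx.
  have [cj0 _ /(_ _ dwj) h] := hct j; rewrite !mxE.
  apply: le_trans h _; apply: ler_wpM2r => //.
  rewrite (bigD1 j)//=.
  have : 0 <= \sum_(i | i != j) (ct i).1 by apply: sumr_ge0 => i _; have [/ltW] := hct i.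
  by lra.
have h1 : lino d (fun w => g (F w) - c - ((F w - b) *m M) ord0 ord0).
  move=> e e0; have [t t0 ht] := hg _ (divr_gt0 e0 cF0).
  exists (Num.min tF (t / cF)); first by rewrite lt_min tF0 divr_gt0.
  move=> w; rewrite lt_min ltr_pdivlMr// => /andP[/hFg h1 h2].
  have /ht : vnorm (F w - b) < t by apply: le_lt_trans h1 _; rewrite mulrC.
  move=> h; apply: le_trans h _; rewrite -mulrA ler_pM2l// mulrC ler_pdivrMr//.
  by rewrite mulrC.
have h2 := @lino_sum R T d m (fun j w => M j ord0 * (F w ord0 j - b ord0 j - (u w *m col j A)
  ord0 ord0))
  d_ge0 (fun j => linoZ (M j ord0) (hF j)).
have := linoD h1 h2; congr lino; apply/funext => w /=.
rewrite mulmxA; under eq_bigr do rewrite colE mulmxA -colE mulrBr.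
rewrite big_split/= sumrN; rewrite [((F w - b) *m M) _ _]mxE [(u w *m A *m M) _ _]mxE.
under [X in _ - X + _]eq_bigr do rewrite !mxE mulrC.
under [X in _ + (_ - X)]eq_bigr do rewrite mxE mulrC.
rewrite addrA subrK; reflexivity.
Qed.

Lemma lin_at_comp1 f a L g (c : C) :
  lin_at d u f a L -> lin_at (fun y => modulus (y - a)) (fun y => (y - a)%:M) g (g a) c%:M ->
  lin_at d u (g \o f) (g a) (c *: L).
Proof.
move=> hf hg; have [k [t [k0 t0 ht]]] := lin_at_growth hf.
have h1 : lino d (fun w => g (f w) - g a - c * (f w - a)).
  move=> e e0; have [s s0 hs] := hg _ (divr_gt0 e0 k0).
  exists (Num.min t (s / k)); first by rewrite lt_min t0 divr_gt0.
  move=> w; rewrite lt_min ltr_pdivlMr// => /andP[/ht h1 h2].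
  have /hs : modulus (f w - a) < s by apply: le_lt_trans h1 _; rewrite mulrC.
  rewrite -scalar_mxM mxE eqxx mulr1n mulrC => h; apply: le_trans h _.
  by rewrite -mulrA ler_pM2l// mulrC ler_pdivrMr// mulrC.
have := linoD h1 (linoZ c hf); congr lino; apply/funext => w /=.
have -> : (u w *m (c *: L)) ord0 ord0 = c * (u w *m L) ord0 ord0 by rewrite -scalemxAr mxE.
ring.
Qed.

End Rules.

Definition cd (f : C -> C) (z c : C) :=
  lin_at (fun w => modulus (w - z)) (fun w => (w - z)%:M : 'rV_1) f (f z) c%:M.

Definition sd n (f : 'rV[C]_n -> C) (x : 'rV[C]_n) (L : 'cV[C]_n) :=
  lin_at (fun w => vnorm (w - x)) (fun w => w - x) f (f x) L.

Lemma vnorm_scalar (a : C) : vnorm (a%:M : 'rV_1) = modulus a.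
Proof. by rewrite /vnorm big_ord_recl big_ord0 mxE eqxx mulr1n; apply/max_idPl/modulus_ge0. Qed.

Lemma cdP f z c : cd f z c <-> forall e : R, 0 < e -> exists2 t : R, 0 < t &
  forall w, modulus (w - z) < t -> modulus (f w - f z - (w - z) * c) <= e * modulus (w - z).
Proof.
split => h e e0; have [t t0 ht] := h _ e0; exists t => // w /ht;
by rewrite -scalar_mxM mxE eqxx mulr1n.
Qed.

Let u1 (z w : C) : vnorm ((w - z)%:M : 'rV_1) <= modulus (w - z).
Proof. by rewrite vnorm_scalar. Qed.
Let d1 (z w : C) : 0 <= modulus (w - z). Proof. exact: modulus_ge0. Qed.

Lemma cd_eq f g z c (t : R) : 0 < t -> (forall w, modulus (w - z) < t -> f w = g w) ->
  cd f z c -> cd g z c.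
Proof.
move=> t0 fg; rewrite /cd -(fg z); last by rewrite subrr modulus0.
exact: lin_at_eq t0 fg.
Qed.

Lemma cd_continuous f z c : cd f z c -> forall e : R, 0 < e -> exists2 t : R, 0 < t &
  forall w, modulus (w - z) < t -> modulus (f w - f z) < e.
Proof.
move=> /(lin_at_growth (@u1 z)) [k [t [k0 t0 ht]]] e e0.
exists (Num.min t (e / k)); first by rewrite lt_min t0 divr_gt0.
by move=> w; rewrite lt_min ltr_pdivlMr// mulrC => /andP[/ht h1]; apply: le_lt_trans.
Qed.

Lemma cd_cst a z : cd (fun=> a) z 0.
Proof. by rewrite /cd raddf0; exact: lin_at_cst. Qed.

Lemma cd_id z : cd id z 1.
Proof.
by apply/cdP => e e0; exists 1 => // w _; rewrite mulr1 subrr modulus0 mulr_ge0// ltW.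
Qed.

Lemma cdD f g z b c : cd f z b -> cd g z c -> cd (fun w => f w + g w) z (b + c).
Proof. by move=> hf hg; rewrite /cd raddfD; exact: lin_atD. Qed.

Lemma cdB f g z b c : cd f z b -> cd g z c -> cd (fun w => f w - g w) z (b - c).
Proof. by move=> hf hg; rewrite /cd raddfB; exact: lin_atB. Qed.

Lemma cdZ f z b a : cd f z b -> cd (fun w => a * f w) z (a * b).
Proof. by move=> hf; rewrite /cd -scale_scalar_mx; exact: lin_atZ. Qed.

Lemma cdM f g z b c : cd f z b -> cd g z c ->
  cd (fun w => f w * g w) z (g z * b + f z * c).
Proof.
move=> hf hg; rewrite /cd raddfD /= -!scale_scalar_mx.
exact: (lin_atM (@d1 z) (@u1 z) hf hg).
Qed.

Lemma cd_comp f g z b c : cd f z b -> cd g (f z) c -> cd (g \o f) z (c * b).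
Proof.
by move=> hf hg; rewrite /cd -scale_scalar_mx; exact: (lin_at_comp1 (@u1 z) hf hg).
Qed.

Lemma cd_inv z : z != 0 -> cd (fun w => w^-1) z (- (z ^- 2)).
Proof.
move=> z0; apply/cdP => e e0; have z0' : 0 < modulus z by rewrite modulus_gt0.
have z3 : 0 < modulus z ^+ 3 by rewrite exprn_gt0.
(* Within [modulus z / 2] of [z] the modulus of [w] exceeds half that of [z]; the second bound then
   makes the remainder (w - z)^2 / (w z^2) small. *)
exists (Num.min (modulus z / 2) (e * modulus z ^+ 3 / 2)).
  by rewrite lt_min !divr_gt0 ?mulr_gt0.
move=> w; rewrite lt_min => /andP[h1 h2].
have wz : modulus z / 2 < modulus w.
  by have := modulus_geB z w; rewrite modulus_subC; lra.
have w0 : w != 0 by rewrite -modulus_gt0; lra.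
have -> : w^-1 - z^-1 - (w - z) * - (z ^- 2) = (w - z) ^+ 2 / (w * z ^+ 2).
  by field; rewrite z0 w0.
rewrite modulusM modulusX modulusV modulusM modulusX expr2 -mulrA mulrC.
rewrite ler_wpM2r ?modulus_ge0// ler_pdivrMr; last by rewrite mulr_gt0 ?exprn_gt0//; lra.
have : 0 <= e * modulus z ^+ 2 * (modulus w - modulus z / 2).
  by rewrite mulr_ge0 ?mulr_ge0 ?exprn_ge0 ?modulus_ge0 ?ltW//; lra.
by move: h2; rewrite !exprS expr0; lra.
Qed.

Lemma cdV f z b : f z != 0 -> cd f z b -> exists c, cd (fun w => (f w)^-1) z c.
Proof. by move=> fz hf; eexists; exact: (cd_comp hf (cd_inv fz)). Qed.

Lemma cdX f z b k : cd f z b -> exists c, cd (fun w => f w ^+ k) z c.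
Proof.
move=> hf; elim: k => [|k [c hc]]; first by exists 0; exact: cd_cst.
by eexists; under eq_fun do rewrite exprS; exact: cdM hf hc.
Qed.

Lemma cd_uniq f z b c : cd f z b -> cd f z c -> b = c.
Proof.
move=> hb hc; apply/eqP; rewrite -subr_eq0; apply/eqP/modulus_le0 => e e0.
have [t t0 ht] := linoD (linoZ (-1) hb) hc e0.
have := ht (z + (t / 2)%:C%C).
have -> : z + (t / 2)%:C%C - z = (t / 2)%:C%C by ring.
rewrite modulus_real ger0_norm; last lra.
move=> /(_ ltac:(lra)); rewrite -!scalar_mxM !mxE eqxx !mulr1n.
set x := f _ - f z; set y := (t / 2)%:C%C.
have -> : -1 * (x - y * b) + (x - y * c) = y * (b - c) by ring.
by rewrite modulusM modulus_real ger0_norm ?[e * _]mulrC ?ler_pM2l//; lra.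
Qed.

Section Several.
Variable n : nat.
Implicit Types (f g : 'rV[C]_n -> C) (x : 'rV[C]_n).

Let un x w : vnorm (w - x) <= vnorm (w - x). Proof. exact: lexx. Qed.
Let dn x w : 0 <= vnorm (w - x). Proof. exact: vnorm_ge0. Qed.

Lemma sd_eq f g x L (t : R) : 0 < t -> (forall w, vnorm (w - x) < t -> f w = g w) ->
  sd f x L -> sd g x L.
Proof.
move=> t0 fg; rewrite /sd -(fg x); last by rewrite subrr vnorm0.
exact: lin_at_eq t0 fg.
Qed.

Lemma sd_continuous f x L : sd f x L -> forall e : R, 0 < e -> exists2 t : R, 0 < t &
  forall w, vnorm (w - x) < t -> modulus (f w - f x) < e.
Proof.
move=> /(lin_at_growth (@un x)) [k [t [k0 t0 ht]]] e e0.
exists (Num.min t (e / k)); first by rewrite lt_min t0 divr_gt0.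
by move=> w; rewrite lt_min ltr_pdivlMr// mulrC => /andP[/ht h1]; apply: le_lt_trans.
Qed.

Lemma sd_cst a x : sd (fun=> a) x 0.
Proof. exact: lin_at_cst. Qed.

Lemma sd_linear (b : C) (L : 'cV[C]_n) x : sd (fun w => b + (w *m L) ord0 ord0) x L.
Proof.
move=> e e0; exists 1 => // w _; rewrite mulmxBl !mxE.
by rewrite [X in modulus X](_ : _ = 0) ?modulus0 ?mulr_ge0 ?vnorm_ge0 ?ltW//; ring.
Qed.

Lemma sd_coord i x : sd (fun w => w ord0 i) x (delta_mx i ord0).
Proof.
have := sd_linear 0 (delta_mx i ord0) x; congr (sd _ x _).
by apply/funext => w; rewrite add0r -colE mxE.
Qed.

Lemma sdD f g x L M : sd f x L -> sd g x M -> sd (fun w => f w + g w) x (L + M).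
Proof. by move=> hf hg; exact: lin_atD. Qed.

Lemma sdB f g x L M : sd f x L -> sd g x M -> sd (fun w => f w - g w) x (L - M).
Proof. by move=> hf hg; exact: lin_atB. Qed.

Lemma sdZ f x L a : sd f x L -> sd (fun w => a * f w) x (a *: L).
Proof. by move=> hf; exact: lin_atZ. Qed.

Lemma sdM f g x L M : sd f x L -> sd g x M ->
  sd (fun w => f w * g w) x (g x *: L + f x *: M).
Proof. by move=> hf hg; exact: (lin_atM (@dn x) (@un x) hf hg). Qed.

Lemma sd_sum m (f : 'I_m -> 'rV[C]_n -> C) x L :
  (forall i, sd (f i) x (L i)) -> sd (fun w => \sum_i f i w) x (\sum_i L i).
Proof.
elim: m f L => [|m IH] f L hf.
  by under eq_fun do rewrite big_ord0; rewrite big_ord0; exact: sd_cst.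
under eq_fun do rewrite big_ord_recr /=; rewrite big_ord_recr /=.
by apply: sdD => //; exact: IH.
Qed.

Lemma sd_comp1 f x L (g : C -> C) c : sd f x L -> cd g (f x) c -> sd (g \o f) x (c *: L).
Proof. by move=> hf hg; exact: (lin_at_comp1 (@un x) hf hg). Qed.

Lemma sd_comp m (F : 'rV[C]_n -> 'rV[C]_m) x (A : 'M[C]_(n, m)) (g : 'rV[C]_m -> C) M :
  (forall j, sd (fun w => F w ord0 j) x (col j A)) -> sd g (F x) M ->
  sd (g \o F) x (A *m M).
Proof. by move=> hF hg; exact: (lin_at_comp (@dn x) (@un x) hF hg). Qed.

Lemma cd_curve (F : C -> 'rV[C]_n) z (v : 'rV[C]_n) g M :
  (forall j, cd (fun w => F w ord0 j) z (v ord0 j)) -> sd g (F z) M ->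
  cd (g \o F) z ((v *m M) ord0 ord0).
Proof.
move=> hF hg; rewrite /cd -mx11_scalar.
apply: (lin_at_comp (@d1 z) (@u1 z) (A := v) _ hg) => j.
have := hF j; rewrite /cd; congr lin_at.
by apply/matrixP => i k; rewrite !ord1 !mxE eqxx mulr1n.
Qed.

(** Restriction to complex lines, by which the several-variable estimates below are reduced to one
    variable. *)
Lemma cd_line g x h M z : sd g (x + z *: h) M ->
  cd (fun w => g (x + w *: h)) z ((h *m M) ord0 ord0).
Proof.
move=> hg; apply: (cd_curve (F := fun w => x + w *: h)) hg => j.
under eq_fun do rewrite !mxE.
have := cdD (cd_cst (x ord0 j) z) (cdZ (h ord0 j) (cd_id z)); rewrite add0r mulr1.
by congr cd; apply/funext => w; rewrite /= mulrC.
Qed.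

Lemma sd_uniq f x L M : sd f x L -> sd f x M -> L = M.
Proof.
move=> hL hM; apply/colP => i.
have e (N : 'cV[C]_n) : ((delta_mx ord0 i : 'rV_n) *m N) ord0 ord0 = N i ord0.
  by rewrite -rowE mxE.
have x0 : x + 0 *: delta_mx ord0 i = x by rewrite scale0r addr0.
have hL' : sd f (x + 0 *: delta_mx ord0 i) L by rewrite x0.
have hM' : sd f (x + 0 *: delta_mx ord0 i) M by rewrite x0.
by have := cd_uniq (cd_line hL') (cd_line hM'); rewrite !e.
Qed.

End Several.
End Derivative.

(** * Compactness by bisection *)

Section Bisection.
Variable R : realType.

(** If the property failed, bad quarters would nest down to a point, yet every small rectangle
    containing that point is good. This is the form in which compactness is used below, also for
    segments, taken as rectangles of width 0. *)
Lemma bisect_rect (P : R -> R -> R -> R -> Prop) (x0 y0 a0 b0 : R) :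
  0 <= a0 -> 0 <= b0 ->
  (forall x y a b, 0 <= a -> 0 <= b -> P x y (a / 2) (b / 2) ->
     P (x + a / 2) y (a / 2) (b / 2) -> P x (y + b / 2) (a / 2) (b / 2) ->
     P (x + a / 2) (y + b / 2) (a / 2) (b / 2) -> P x y a b) ->
  (forall s t, x0 <= s <= x0 + a0 -> y0 <= t <= y0 + b0 ->
     exists2 r : R, 0 < r & forall x y a b,
       0 <= a < r -> 0 <= b < r -> x <= s <= x + a -> y <= t <= y + b ->
       x0 <= x -> x + a <= x0 + a0 -> y0 <= y -> y + b <= y0 + b0 -> P x y a b) ->
  P x0 y0 a0 b0.
Proof.
move=> a00 b00 Pglue Ploc; apply: contrapT => nP.
pose bad q := ~ P q.1.1 q.1.2 q.2.1 q.2.2.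
pose child (q q' : R * R * (R * R)) := [/\ q.1.1 <= q'.1.1, q'.1.1 + q'.2.1 <= q.1.1 + q.2.1,
   q.1.2 <= q'.1.2 & q'.1.2 + q'.2.2 <= q.1.2 + q.2.2] /\
   q'.2.1 = q.2.1 / 2 /\ q'.2.2 = q.2.2 / 2.
(* [g] selects a bad quarter of a bad rectangle; its other values are arbitrary. *)
have /choice [g hg] : forall q, exists q', 0 <= q.2.1 -> 0 <= q.2.2 -> bad q ->
    bad q' /\ child q q'.
  move=> [[x y] [a b]]; have [|/existsNP] := pselect (forall q', ~ (0 <= a -> 0 <= b -> bad
    (x,y,(a,b)) ->
    bad q' /\ child (x,y,(a,b)) q')); last by move=> [q' /contrapT]; exists q'.
  move=> h; exfalso.
  have [pa pb bq] : [/\ 0 <= a, 0 <= b & bad (x,y,(a,b))].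
    by split; apply: contrapT => n; refine (h (x,y,(a,b)) _) => u v w;
      [case: (n u)|case: (n v)|case: (n w)].
  apply: bq; apply: Pglue => //=; apply: contrapT => n.
  - by refine (h (x, y, (a / 2, b / 2)) _) => _ _ _; split => //; split; split; rewrite /=; lra.
  - by refine (h (x + a / 2, y, (a / 2, b / 2)) _) => _ _ _; split => //; split; split;
    rewrite /=; lra.
  - by refine (h (x, y + b / 2, (a / 2, b / 2)) _) => _ _ _; split => //; split; split;
    rewrite /=; lra.
  - by refine (h (x + a / 2, y + b / 2, (a / 2, b / 2)) _) => _ _ _; split => //; split;
    split; rewrite /=; lra.
pose q k := iter k g (x0, y0, (a0, b0)).
have h2 k : 0 <= 2^-1 ^+ k :> R by apply: exprn_ge0; lra.
have qP k : bad (q k) /\ (q k).2 = (a0 * 2^-1 ^+ k, b0 * 2^-1 ^+ k).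
  elim: k => [|k [bk ek]]; first by rewrite /q /= !expr0 !mulr1.
  have w1 : 0 <= (q k).2.1 by rewrite ek mulr_ge0.
  have w2 : 0 <= (q k).2.2 by rewrite ek mulr_ge0.
  have [b' [_ [ea eb]]] := hg (q k) w1 w2 bk.
  split; first exact: b'.
  rewrite [LHS](surjective_pairing (q k.+1).2) /= ea eb ek /= !exprSr.
  by rewrite !mulrA.
have qc k : child (q k) (q k.+1).
  have [bk ek] := qP k.
  by have [] := hg (q k); rewrite ?ek ?mulr_ge0.
have mono k j : [/\ (q k).1.1 <= (q (k + j)%N).1.1,
   (q (k + j)%N).1.1 + (q (k + j)%N).2.1 <= (q k).1.1 + (q k).2.1,
   (q k).1.2 <= (q (k + j)%N).1.2 &
   (q (k + j)%N).1.2 + (q (k + j)%N).2.2 <= (q k).1.2 + (q k).2.2].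
  elim: j => [|j [i1 i2 i3 i4]]; first by rewrite addn0.
  rewrite addnS; have [[j1 j2 j3 j4] _] := qc (k + j)%N; split; lra.
have w0 k : 0 <= (q k).2.1 /\ 0 <= (q k).2.2 by rewrite (qP k).2 !mulr_ge0.
have cross1 k j : (q k).1.1 <= (q j).1.1 + (q j).2.1.
  have [i1 i2 _ _] := mono k j; have [j1 j2 _ _] := mono j k.
  by rewrite addnC in i1 i2; have [] := w0 (j + k)%N; lra.
have cross2 k j : (q k).1.2 <= (q j).1.2 + (q j).2.2.
  have [_ _ i1 i2] := mono k j; have [_ _ j1 j2] := mono j k.
  by rewrite addnC in i1 i2; have [] := w0 (j + k)%N; lra.
(* Every lower left corner lies below every upper right one, so these suprema give a point common to
   all the rectangles. *)
pose s := sup (range (fun k => (q k).1.1)); pose t := sup (range (fun k => (q k).1.2)).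
have sk k : (q k).1.1 <= s <= (q k).1.1 + (q k).2.1.
  apply/andP; split.
    apply: ub_le_sup; last by exists k.
    by exists ((q 0%N).1.1 + (q 0%N).2.1) => _ [j _ <-].
  by apply: ge_sup => [|_ [j _ <-]//]; exists (q 0%N).1.1, 0%N.
have tk k : (q k).1.2 <= t <= (q k).1.2 + (q k).2.2.
  apply/andP; split.
    apply: ub_le_sup; last by exists k.
    by exists ((q 0%N).1.2 + (q 0%N).2.2) => _ [j _ <-].
  by apply: ge_sup => [|_ [j _ <-]//]; exists (q 0%N).1.2, 0%N.
have [r r0 hr] := Ploc s t (sk 0%N) (tk 0%N).
have [k hk] : exists k, (a0 + b0 + 1) * 2^-1 ^+ k < r.
  have c0 : 0 < a0 + b0 + 1 by lra.
  have [k hk] := half_pow_lt (divr_gt0 r0 c0).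
  by exists k; rewrite mulrC -ltr_pdivlMr.
have [bk ek] := qP k; apply: bk; have [m1 m2 m3 m4] := mono 0%N k.
have [wa wb] := w0 k; have := h2 k => h2k.
have a2 : 0 <= a0 * 2^-1 ^+ k by rewrite mulr_ge0.
have b2 : 0 <= b0 * 2^-1 ^+ k by rewrite mulr_ge0.
apply: hr => //; try exact: sk; try exact: tk.
- by rewrite wa ek /=; lra.
- by rewrite wb ek /=; lra.
Qed.

End Bisection.

(** * Trapezoid sums and Goursat's theorem *)

Section TrapezoidAverage.
Variable R : realType.
Local Notation C := R[i].
Implicit Types (g h : C -> C) (p d a b : C).

(* Composite trapezoid rule with 2^m steps on the segment from p to p + d, divided
   by d.  The recursion by halving makes contour sums additive under bisection,
   so that Goursat's argument applies before any limit is taken. *)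
Fixpoint av (m : nat) g p d : C :=
  if m is m'.+1 then (av m' g p (d / 2) + av m' g (p + d / 2) (d / 2)) / 2
  else (g p + g (p + d)) / 2.

(** The trapezoid value is built from values of [g] on the segment by midpoints alone, so any
    condition stable under midpoints passes to it. *)
Lemma av_ind (P : C -> Prop) g p d m :
  (forall x y, P x -> P y -> P ((x + y) / 2)) ->
  (forall s : R, 0 <= s <= 1 -> P (g (p + s%:C%C * d))) -> P (av m g p d).
Proof.
move=> Pmid; elim: m p d => [|m IH] p d hP /=.
  apply: Pmid; [have := hP 0|have := hP 1]; rewrite ?mul0r ?mul1r ?addr0; apply; lra.
have e (s : R) : (s / 2)%:C%C = s%:C%C / 2 :> C by rewrite rmorphM fmorphV rmorph_nat.
have e1 (s : R) : ((s + 1) / 2)%:C%C = s%:C%C / 2 + 2^-1 :> C.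
  by rewrite e rmorphD rmorph1 mulrDl mul1r.
apply: Pmid; apply: IH => s s01.
  have -> : s%:C%C * (d / 2) = (s / 2)%:C%C * d by rewrite e; ring.
  by apply: hP; lra.
have -> : p + d / 2 + s%:C%C * (d / 2) = p + ((s + 1) / 2)%:C%C * d by rewrite e1; ring.
by apply: hP; lra.
Qed.

Lemma av_ext m g h p d : (forall s : R, 0 <= s <= 1 -> g (p + s%:C%C * d) = h (p + s%:C%C * d)) ->
  av m g p d = av m h p d.
Proof.
elim: m p d => [|m IH] p d gh /=.
  have := gh 0; have := gh 1; rewrite mul0r mul1r addr0 => -> ; last lra.
  by move=> ->; last lra.
have e (s : R) : (s / 2)%:C%C = s%:C%C / 2 :> C by rewrite rmorphM fmorphV rmorph_nat.
have e1 (s : R) : ((s + 1) / 2)%:C%C = s%:C%C / 2 + 2^-1 :> C.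
  by rewrite e rmorphD rmorph1 mulrDl mul1r.
congr ((_ + _) / 2); apply: IH => s s01.
  have -> : s%:C%C * (d / 2) = (s / 2)%:C%C * d by rewrite e; ring.
  by apply: gh; lra.
have -> : p + d / 2 + s%:C%C * (d / 2) = p + ((s + 1) / 2)%:C%C * d by rewrite e1; ring.
by apply: gh; lra.
Qed.

Lemma modulus2 : modulus (2 : C) = 2.
Proof. by have := modulus_real (2 : R); rewrite rmorph_nat ger0_norm; [|lra]. Qed.

Lemma modulus_mid (x y : C) : modulus ((x + y) / 2) <= (modulus x + modulus y) / 2.
Proof.
rewrite modulusM modulusV modulus2; have := modulus_leD x y; lra.
Qed.

Lemma av_le m g p d (M : R) :
  (forall s : R, 0 <= s <= 1 -> modulus (g (p + s%:C%C * d)) <= M) -> modulus (av m g p d) <= M.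
Proof.
apply: (@av_ind (fun x => modulus x <= M)) => x y xM yM.
by have := modulus_mid x y; lra.
Qed.

Lemma avD m g h p d : av m (fun w => g w + h w) p d = av m g p d + av m h p d.
Proof. by elim: m p d => [|m IH] p d /=; rewrite ?IH; ring. Qed.

Lemma avZ m c g p d : av m (fun w => c * g w) p d = c * av m g p d.
Proof. by elim: m p d => [|m IH] p d /=; rewrite ?IH; ring. Qed.

(** Exactness on affine functions at every level [m] is what lets Goursat's argument remove the
    linear part before any limit is taken. *)
Lemma av_affine m b c p d : av m (fun w => b + c * w) p d = b + c * (p + d / 2).
Proof. by elim: m p d => [|m IH] p d /=; rewrite ?IH; field. Qed.

Lemma av_translate m g p d w : av m g (p + w) d = av m (fun x => g (x + w)) p d.
Proof.
elim: m p d => [|m IH] p d /=; first by rewrite (addrAC p).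
by rewrite (addrAC p) !IH.
Qed.

(* Trapezoid approximation of the contour integral of [g] around the
   parallelogram with vertices p, p + a, p + a + b, p + b. *)
Definition contour m g p a b : C :=
  a * av m g p a + b * av m g (p + a) b - a * av m g (p + b) a - b * av m g p b.

(** Each inner edge occurs twice with opposite signs, and the halves of an outer edge combine by the
    recursion of [av], which accounts for one level. *)
Lemma contour_split m g p a b : contour m.+1 g p a b =
  contour m g p (a / 2) (b / 2) + contour m g (p + a / 2) (a / 2) (b / 2) +
  contour m g (p + b / 2) (a / 2) (b / 2) + contour m g (p + a / 2 + b / 2) (a / 2) (b / 2).
Proof.
rewrite /contour /=.
have ea : p + a / 2 + a / 2 = p + a by field.
have eb : p + b / 2 + b / 2 = p + b by field.
have ea' : p + a / 2 + b / 2 + a / 2 = p + a + b / 2 by field.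
have eb' : p + a / 2 + b / 2 + b / 2 = p + b + a / 2 by field.
rewrite ea eb ea' eb' (addrAC p (b / 2)) (addrAC p b).
by rewrite (addrAC p (a / 2) b); field.
Qed.

End TrapezoidAverage.

Section Goursat.
Variable R : realType.
Local Notation C := R[i].
Implicit Types (f g : C -> C).

Definition ctn g (z : C) := forall e : R, 0 < e -> exists2 t : R, 0 < t &
  forall w, modulus (w - z) < t -> modulus (g w - g z) < e.

Lemma contourD m g h (p a b : C) :
  contour m (fun w => g w + h w) p a b = contour m g p a b + contour m h p a b.
Proof. by rewrite /contour !avD; ring. Qed.

Lemma contour_affine m (b0 c p a b : C) : contour m (fun w => b0 + c * w) p a b = 0.
Proof. by rewrite /contour !av_affine; field. Qed.

Local Notation "x &+ y" := (Complex x y) (at level 50).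

Lemma contour_le m g (x y a b M : R) : 0 <= a -> 0 <= b ->
  (forall s t, x <= s <= x + a -> y <= t <= y + b -> modulus (g (s &+ t)) <= M) ->
  modulus (contour m g (x &+ y) a%:C%C ('i%C * b%:C%C)) <= 2 * (a + b) * M.
Proof.
move=> a0 b0 h.
have hs (s : R) : 0 <= s <= 1 -> 0 <= s * a <= a /\ 0 <= s * b <= b.
  by move=> s01; split; nra.
have e1 (p q s : R) : p &+ q + s%:C%C * a%:C%C = (p + s * a) &+ q by simpc.
have e2 (p q s : R) : p &+ q + s%:C%C * ('i%C * b%:C%C) = p &+ (q + s * b) by simpc.
have e3 : x &+ y + a%:C%C = (x + a) &+ y by simpc.
have e4 : x &+ y + 'i%C * b%:C%C = x &+ (y + b) by simpc.
have ma : modulus a%:C%C = a by rewrite modulus_real ger0_norm.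
have mb : modulus ('i%C * b%:C%C) = b by rewrite modulusM modulus_i modulus_real ger0_norm//
  mul1r.
rewrite /contour e3 e4.
have k1 : modulus (av m g (x &+ y) a%:C%C) <= M.
  by apply: av_le => s /hs[sa sb]; rewrite e1; apply: h; lra.
have k2 : modulus (av m g ((x + a) &+ y) ('i%C * b%:C%C)) <= M.
  by apply: av_le => s /hs[sa sb]; rewrite e2; apply: h; lra.
have k3 : modulus (av m g (x &+ (y + b)) a%:C%C) <= M.
  by apply: av_le => s /hs[sa sb]; rewrite e1; apply: h; lra.
have k4 : modulus (av m g (x &+ y) ('i%C * b%:C%C)) <= M.
  by apply: av_le => s /hs[sa sb]; rewrite e2; apply: h; lra.
have tri (p q r s : C) : modulus (p + q - r - s) <= modulus p + modulus q + modulus r + modulus s.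
  have := modulus_leB (p + q - r) s; have := modulus_leB (p + q) r; have := modulus_leD p q; lra.
apply: le_trans (tri _ _ _ _) _.
rewrite !(modulusM _ (av _ _ _ _)) ma mb.
have := ler_wpM2l a0 k1; have := ler_wpM2l b0 k2.
have := ler_wpM2l a0 k3; have := ler_wpM2l b0 k4; lra.
Qed.

(** The estimate e (a + b)^2 is reproduced exactly when four quarters are added. On a small
    rectangle the affine part of [g] contributes nothing, and the remainder, at most e/2 (a + b),
    meets a perimeter 2 (a + b). *)
Lemma goursat g (x y a b : R) : 0 <= a -> 0 <= b ->
  (forall s t, x <= s <= x + a -> y <= t <= y + b -> exists c, cd g (s &+ t) c) ->
  tends (fun m => contour m g (x &+ y) a%:C%C ('i%C * b%:C%C)) 0.
Proof.
move=> a0 b0 hg e0 e0_gt0.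
(* The added 1 keeps the divisor positive for a degenerate rectangle. *)
have ab : 0 < (a + b) ^+ 2 + 1 by have := sqr_ge0 (a + b); lra.
pose e := e0 / ((a + b) ^+ 2 + 1); have e_gt0 : 0 < e by rewrite divr_gt0.
suff [m0 hm0] : exists m0, forall m, (m0 <= m)%N ->
    modulus (contour m g (x &+ y) a%:C%C ('i%C * b%:C%C)) <= e * (a + b) ^+ 2.
  exists m0 => m /hm0; rewrite subr0 => h; apply: le_trans h _.
  by rewrite /e mulrAC ler_pdivrMr// ler_pM2l//; lra.
clearbody e; clear ab e0 e0_gt0.
pose P x y a b := exists m0, forall m, (m0 <= m)%N ->
    modulus (contour m g (x &+ y) a%:C%C ('i%C * b%:C%C)) <= e * (a + b) ^+ 2.
apply: (@bisect_rect R P x y a b a0 b0) => {a0 b0} [x' y' a' b' a0 b0|s t sx ty].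
  move=> [m1 h1] [m2 h2] [m3 h3] [m4 h4].
  (* One more than the four thresholds: level m + 1 on the rectangle is level m on its quarters. *)
  exists (maxn (maxn m1 m2) (maxn m3 m4)).+1 => -[//|m].
  rewrite ltnS !geq_max => /andP[/andP[/h1 k1 /h2 k2] /andP[/h3 k3 /h4 k4]].
  have half (u : R) : u%:C%C / 2 = (u / 2)%:C%C :> C by rewrite rmorphM fmorphV rmorph_nat.
  have q1 (p q : R) : p &+ q + (a' / 2)%:C%C = (p + a' / 2) &+ q by simpc.
  have q2 (p q : R) : p &+ q + 'i%C * (b' / 2)%:C%C = p &+ (q + b' / 2) by simpc.
  rewrite contour_split -mulrA !half q1 !q2.
  have tri (p q r s : C) : modulus (p + q + r + s) <= modulus p + modulus q + modulus r +
    modulus s.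
    have := modulus_leD (p + q + r) s; have := modulus_leD (p + q) r; have := modulus_leD p q;
      lra.
  apply: le_trans (tri _ _ _ _) _.
  have -> : e * (a' + b') ^+ 2 = 4 * (e * (a' / 2 + b' / 2) ^+ 2) by field.
  lra.
have [c /cdP hc] := hg s t sx ty.
have e2 : 0 < e / 2 by lra.
have [r r0 hr] := hc _ e2; exists (r / 2); first lra.
move=> x' y' a' b' /andP[a0 a0'] /andP[b0 b0'] sx' ty' _ _ _ _; exists 0%N => m _.
pose z := s &+ t; pose aff (w : C) := (g z - z * c) + c * w.
have -> : contour m g (x' &+ y') a'%:C%C ('i%C * b'%:C%C) =
    contour m (fun w => aff w + (g w - g z - (w - z) * c)) (x' &+ y') a'%:C%C ('i%C * b'%:C%C).
  by congr contour; apply/funext => w; rewrite /aff; ring.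
rewrite contourD contour_affine add0r.
have -> : e * (a' + b') ^+ 2 = 2 * (a' + b') * (e / 2 * (a' + b')) by field.
apply: contour_le => // u v ux vy.
have uz : modulus (u &+ v - z) <= a' + b'.
  apply: le_trans (modulus_ReIm _) _; rewrite /=.
  by apply: lerD; rewrite ler_norml; lra.
apply: le_trans (hr _ _) _; first lra.
by rewrite ler_pM2l.
Qed.

(** On a short piece all levels lie within e/2 of a single value of [g], and midpoints preserve
    closeness of two levels; bisection covers the segment. *)
Lemma av_converges g (y b : R) (x : R) : 0 <= b ->
  (forall t, y <= t <= y + b -> ctn g (x &+ t)) ->
  exists l, tends (fun m => av m g (x &+ y) ('i%C * b%:C%C)) l.
Proof.
move=> b0 hg; apply: complex_cauchy => e e0.
pose P (_ y _ b : R) := exists m0, forall m k, (m0 <= m)%N -> (m0 <= k)%N ->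
    modulus (av m g (x &+ y) ('i%C * b%:C%C) - av k g (x &+ y) ('i%C * b%:C%C)) <= e.
apply: (@bisect_rect R P 0 y 0 b (lexx _) b0) => {b0} [x0 y' a0 b' _ b0|s t _ ty].
  move=> [m1 h1] _ [m2 h2] _; exists (maxn m1 m2).+1 => -[//|m] [//|k].
  rewrite !ltnS !geq_max => /andP[p1 p2] /andP[q1 q2].
  have half (u : R) : u%:C%C / 2 = (u / 2)%:C%C :> C by rewrite rmorphM fmorphV rmorph_nat.
  have e2 (p q : R) : p &+ q + 'i%C * (b' / 2)%:C%C = p &+ (q + b' / 2) by simpc.
  rewrite /= -mulrA half e2 -mulrBl opprD addrACA.
  apply: le_trans (modulus_mid _ _) _.
  by have := h1 _ _ p1 q1; have := h2 _ _ p2 q2; lra.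
have e2 : 0 < e / 2 by lra.
have [r r0 hr] := hg t ty _ e2; exists r => // x0 y' a0 b' _ /andP[b0 br] _ ty' _ _ _ _.
exists 0%N => m k _ _.
have near m' : modulus (av m' g (x &+ y') ('i%C * b'%:C%C) - g (x &+ t)) <= e / 2.
  have -> : av m' g (x &+ y') ('i%C * b'%:C%C) - g (x &+ t) =
     av m' (fun w => g w + (- g (x &+ t) + 0 * w)) (x &+ y') ('i%C * b'%:C%C).
    by rewrite avD av_affine mul0r addr0.
  apply: av_le => u /andP[u0 u1]; rewrite mul0r addr0; apply/ltW/hr.
  apply: le_lt_trans (modulus_ReIm _) _; simpc; rewrite /=.
  have ub : 0 <= u * b' <= b' by nra.
  by rewrite normr0 add0r ltr_norml; lra.
by have := modulus_tri (av m g (x &+ y') ('i%C * b'%:C%C)) (av k g (x &+ y') ('i%C * b'%:C%C))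
  (g (x &+ t));
  have := near m; have := near k; rewrite (modulus_subC (g _)); lra.
Qed.

(** The radius is independent of the level [m]: bisection makes the nearby values of [g] close
    uniformly along the segment, and averages inherit the bound. *)
Lemma av_near_vertical g (x y b e : R) : 0 <= b -> 0 < e ->
  (forall t, y <= t <= y + b -> ctn g (x &+ t)) ->
  exists2 r : R, 0 < r & forall x' m, `|x' - x| < r ->
    modulus (av m g (x' &+ y) ('i%C * b%:C%C) - av m g (x &+ y) ('i%C * b%:C%C)) <= e.
Proof.
move=> b0 e0 hg.
pose Q (_ y _ b : R) := exists2 r : R, 0 < r & forall x' t, `|x' - x| < r -> y <= t <= y + b ->
    modulus (g (x' &+ t) - g (x &+ t)) <= e.
suff [r r0 hr] : Q 0 y 0 b.
  exists r => // x' m xr.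
  have -> : av m g (x' &+ y) ('i%C * b%:C%C) - av m g (x &+ y) ('i%C * b%:C%C) =
      av m (fun w => g (w + (x' - x)%:C%C) + -1 * g w) (x &+ y) ('i%C * b%:C%C).
    rewrite avD avZ mulN1r; congr (_ - _).
    have -> : x' &+ y = x &+ y + (x' - x)%:C%C by by simpc; rewrite addrC subrK.
    exact: av_translate.
  apply: av_le => s s01; rewrite mulN1r; simpc.
  have -> : x + (x' - x) = x' by ring.
  have : 0 <= s * b <= b by nra.
  by move=> sb; apply: hr => //; lra.
apply: (@bisect_rect R Q 0 y 0 b (lexx _) b0) => {b0} [x0 y' a0 b' _ b0|s t _ ty].
  move=> [r1 r10 h1] _ [r2 r20 h2] _; exists (Num.min r1 r2); first by rewrite lt_min r10.
  move=> x' t; rewrite lt_min => /andP[/h1 k1 /h2 k2] /andP[t1 t2].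
  by have [tm|tm] := leP t (y' + b' / 2); [apply: k1|apply: k2]; lra.
have e2 : 0 < e / 2 by lra.
have [r r0 hr] := hg t ty _ e2; exists (r / 2); first lra.
move=> x0 y' a0 b' _ /andP[b0 br] _ ty' _ _ _ _; exists (r / 2); first lra.
move=> x' t' xr ty''.
have tt : `|t' - t| <= b' by rewrite ler_norml; lra.
have k1 : modulus ((x' &+ t') - (x &+ t)) < r.
  by apply: le_lt_trans (modulus_ReIm _) _; rewrite /=; lra.
have k2 : modulus ((x &+ t') - (x &+ t)) < r.
  by apply: le_lt_trans (modulus_ReIm _) _; rewrite /= subrr normr0; lra.
have := modulus_tri (g (x' &+ t')) (g (x &+ t')) (g (x &+ t)).
have := hr _ k1; have := hr _ k2; rewrite (modulus_subC (g (x &+ t))); lra.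
Qed.

End Goursat.

(** * The complex exponential *)

Section ComplexExponential.
Variable R : realType.
Local Notation C := R[i].

Lemma real_derive_bound (f : R -> R) (x df : R) : is_derive x 1 f df ->
  forall e : R, 0 < e -> exists2 t : R, 0 < t & forall h, `|h| < t ->
    `|f (x + h) - f x - h * df| <= e * `|h|.
Proof.
move=> [dv <-] e e0; have : (fun h => h^-1 *: (f (h *: 1 + x) - f x)) @ 0^' --> 'D_1 f x by
  exact: dv.
move/cvgrPdist_le => /(_ _ e0) [t t0 ht]; exists t => // h hlt.
have [->|h0] := eqVneq h 0; first by rewrite addr0 mul0r subrr subr0 normr0 mulr0.
have := ht h; rewrite /ball_ /= sub0r normrN => /(_ hlt h0).
rewrite [h *: 1]mulr1 [h^-1 *: _]mulrC.
have -> : f (x + h) - f x - h * 'D_1 f x = - (('D_1 f x - (f (h + x) - f x) * h^-1) * h).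
  by rewrite (addrC x h); field.
by rewrite normrN normrM => k; apply: ler_wpM2r.
Qed.

Definition cexp (w : C) : C :=
  (expR (complex.Re w))%:C%C * Complex (cos (complex.Im w)) (sin (complex.Im w)).

Lemma cexpD w z : cexp (w + z) = cexp w * cexp z.
Proof.
case: w z => [a b] [c d]; rewrite /cexp /= expRD cosD sinD rmorphM /=.
rewrite mulrACA; congr (_ * _); simpc.
by congr Complex; ring.
Qed.

Lemma modulus_cexp w : modulus (cexp w) = expR (complex.Re w).
Proof.
case: w => a b; rewrite /cexp modulusM modulus_real ger0_norm ?expR_ge0//.
by rewrite /modulus /= cos2Dsin2 sqrtr1 mulr1.
Qed.

Lemma cexp_neq0 w : cexp w != 0.
Proof. by rewrite -modulus_gt0 modulus_cexp expR_gt0. Qed.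

Lemma cexp_periodic w : cexp (w + 'i%C * (2 * pi)%:C%C) = cexp w.
Proof.
case: w => a b; rewrite /cexp; simpc => /=.
by rewrite [2 * pi]mulr_natl cosD2pi sinD2pi.
Qed.

(** The functional equation moves the point to 0, where the real derivatives of exp, cos and sin
    suffice. *)
Lemma cd_cexp z : cd cexp z (cexp z).
Proof.
suff h0 : forall e : R, 0 < e -> exists2 t : R, 0 < t & forall h, modulus h < t ->
    modulus (cexp h - 1 - h) <= e * modulus h.
  apply/cdP => e e0; have z0 : 0 < modulus (cexp z) by rewrite modulus_gt0 cexp_neq0.
  have [t t0 ht] := h0 _ (divr_gt0 e0 z0); exists t => // w /ht h.
  have -> : cexp w - cexp z - (w - z) * cexp z = cexp z * (cexp (w - z) - 1 - (w - z)).
    have -> : cexp w = cexp z * cexp (w - z) by rewrite -cexpD addrC subrK.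
    ring.
  by rewrite modulusM mulrC -ler_pdivlMr// mulrAC.
(* The errors below add up to at most 9 k times the modulus of the increment; [k <= 1] serves the
   crude bounds on exp and sin. *)
move=> e e0; pose k := Num.min (e / 16) 1.
have k0 : 0 < k by rewrite lt_min ltr01 andbT; lra.
have ke : k <= e / 16 by rewrite ge_min lexx.
have k1 : k <= 1 by rewrite ge_min lexx orbT.
clearbody k.
have [t1 t10 h1] := real_derive_bound (is_derive_expR (0 : R)) k0.
have [t2 t20 h2] := real_derive_bound (is_derive_cos (0 : R)) k0.
have [t3 t30 h3] := real_derive_bound (is_derive_sin (0 : R)) k0.
exists (Num.min (Num.min t1 t2) (Num.min t3 k)); first by rewrite !lt_min t10 t20 t30 k0.
case=> a b; rewrite !lt_min => /andP[/andP[l1 l2] /andP[l3 l4]].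
have am : `|a| <= modulus (Complex a b) := modulus_Re (Complex a b).
have bm : `|b| <= modulus (Complex a b) := modulus_Im (Complex a b).
have {h1} := h1 a (le_lt_trans am l1); have {h2} := h2 b (le_lt_trans bm l2).
have {h3} := h3 b (le_lt_trans bm l3).
rewrite !add0r expR0 cos0 sin0 oppr0 mulr0 !addr0 !subr0 !mulr1 => h3 h2 h1.
set m := modulus (Complex a b) in l1 l2 l3 l4 am bm *.
have -> : cexp (Complex a b) - 1 - Complex a b =
   Complex (expR a * cos b - 1 - a) (expR a * sin b - b).
  by rewrite /cexp; simpc.
apply: le_trans (modulus_ReIm _) _ => /=.
have m0 : 0 <= m by exact: modulus_ge0.
have km : k * m <= e / 16 * m by apply: ler_wpM2r.
have kb : k * `|b| <= k * m by rewrite ler_pM2l.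
have ka : k * `|a| <= k * m by rewrite ler_pM2l.
have ea : `|expR a - 1| <= 2 * m.
  have -> : expR a - 1 = (expR a - 1 - a) + a by ring.
  by have := ler_normD (expR a - 1 - a) a; have := ler_wpM2r m0 k1; lra.
have ea2 : `|expR a| <= 3.
  have -> : expR a = (expR a - 1) + 1 by ring.
  by have := ler_normD (expR a - 1) 1; rewrite normr1; lra.
have sb : `|sin b| <= 2 * m.
  have -> : sin b = (sin b - b) + b by ring.
  by have := ler_normD (sin b - b) b; have := ler_wpM2r m0 k1; lra.
have -> : expR a * cos b - 1 - a = (expR a - 1 - a) + expR a * (cos b - 1) by ring.
have -> : expR a * sin b - b = (sin b - b) + (expR a - 1) * sin b by ring.
have n1 : `|expR a * (cos b - 1)| <= 3 * (k * m) by rewrite normrM; apply: ler_pM => //; lra.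
have n2 : `|(expR a - 1) * sin b| <= (2 * m) * (2 * m) by rewrite normrM; apply: ler_pM.
have mm : m * m <= k * m by apply: ler_wpM2r => //; exact: ltW.
have := ler_normD (expR a - 1 - a) (expR a * (cos b - 1)).
have := ler_normD (sin b - b) ((expR a - 1) * sin b).
have : 0 <= e * m by rewrite mulr_ge0// ltW.
lra.
Qed.

End ComplexExponential.

(** * Means over circles and Cauchy's formula *)

Section CircleMean.
Variable R : realType.
Local Notation C := R[i].
Implicit Types (f g : C -> C) (s t : R).

(* Approximate mean of [f] over the circle of radius [expR x]. *)
Definition circ (m : nat) f (x : R) : C :=
  av m (f \o @cexp R) (Complex x 0) ('i%C * (2 * pi)%:C%C).

Definition cmean f (x : R) (l : C) := tends (fun m => circ m f x) l.

Let point (x s : R) : Complex x 0 + s%:C%C * ('i%C * (2 * pi)%:C%C) = Complex x (s * (2 * pi)).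
Proof. by simpc. Qed.

Lemma circ_ext m f g x : (forall z, modulus z = expR x -> f z = g z) ->
  circ m f x = circ m g x.
Proof. by move=> fg; apply: av_ext => s _ /=; rewrite point fg// modulus_cexp. Qed.

Lemma circ_le m f x M : (forall z, modulus z = expR x -> modulus (f z) <= M) ->
  modulus (circ m f x) <= M.
Proof. by move=> fM; apply: av_le => s _ /=; rewrite point fM// modulus_cexp. Qed.

Lemma circD m f g x : circ m (fun z => f z + g z) x = circ m f x + circ m g x.
Proof. exact: avD. Qed.

Lemma circZ m c f x : circ m (fun z => c * f z) x = c * circ m f x.
Proof. exact: avZ. Qed.

Lemma circ_cst m c x : circ m (fun=> c) x = c.
Proof.
have := av_affine m c 0 (Complex x 0) ('i%C * (2 * pi)%:C%C); rewrite mul0r addr0 => e;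
  rewrite -[RHS]e.
by apply: av_ext => s _ /=; rewrite mul0r addr0.
Qed.

Lemma cmeanD f g x a b : cmean f x a -> cmean g x b -> cmean (fun z => f z + g z) x (a + b).
Proof.
move=> fa gb; have := tendsD fa gb; congr tends; apply/funext => m; by rewrite circD.
Qed.

Lemma cmeanZ c f x a : cmean f x a -> cmean (fun z => c * f z) x (c * a).
Proof.
move=> fa; have := tendsZ c fa; congr tends; apply/funext => m; by rewrite circZ.
Qed.

Lemma cmean_cst c x : cmean (fun=> c) x c.
Proof.
have := tends_cst c; congr tends; apply/funext => m; by rewrite circ_cst.
Qed.

Lemma cmean_ext f g x a : (forall z, modulus z = expR x -> f z = g z) ->
  cmean f x a -> cmean g x a.
Proof. by move=> fg; congr tends; apply/funext => m; exact: circ_ext. Qed.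

Lemma cmean_le f x l M : (forall z, modulus z = expR x -> modulus (f z) <= M) ->
  cmean f x l -> modulus l <= M.
Proof. by move=> fM fl; apply: tends_modulus_le fl _ => m; exact: circ_le. Qed.

Lemma ctn_comp_cexp f w : ctn f (cexp w) -> ctn (f \o @cexp R) w.
Proof.
move=> hf e e0; have [t t0 ht] := hf _ e0; have [r r0 hr] := cd_continuous (cd_cexp w) t0.
by exists r => // z /hr /ht.
Qed.

Lemma pi2_ge0 : 0 <= 2 * pi :> R. Proof. by have := pi_gt0 R; lra. Qed.

Lemma cmean_exists f x : (forall z, modulus z = expR x -> ctn f z) -> exists l, cmean f x l.
Proof.
move=> hf; apply: av_converges; first exact: pi2_ge0.
by move=> t _; apply: ctn_comp_cexp; apply: hf; rewrite modulus_cexp.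
Qed.

Lemma circ_near f (x e : R) : 0 < e -> (forall z, modulus z = expR x -> ctn f z) ->
  exists2 r : R, 0 < r & forall x' m, `|x' - x| < r ->
    modulus (circ m f x' - circ m f x) <= e.
Proof.
move=> e0 hf; apply: av_near_vertical => //; first exact: pi2_ge0.
by move=> t _; apply: ctn_comp_cexp; apply: hf; rewrite modulus_cexp.
Qed.

(** Goursat for [f] composed with [cexp] on the rectangle between [x] and [y] of height 2 pi: the
    horizontal sides cancel by periodicity, and the vertical ones are the circle means times 2 pi
    i. *)
Lemma circ_annulus f (x y : R) : x <= y ->
  (forall z, expR x <= modulus z <= expR y -> exists c, cd f z c) ->
  tends (fun m => circ m f y - circ m f x) 0.
Proof.
move=> xy hf.
have /goursat : 0 <= y - x by lra.
move=> /(_ (f \o @cexp R) x 0 (2 * pi) pi2_ge0) h.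
have {}h : tends (fun m => contour m (f \o @cexp R) (Complex x 0) (y - x)%:C%C ('i%C * (2 *
  pi)%:C%C)) 0.
  apply: h => s t /andP[s1 s2] _.
  have [|c hc] := hf (cexp (Complex s t)); first by rewrite modulus_cexp /= !ler_expR; lra.
  by eexists; exact: cd_comp (cd_cexp _) hc.
have per (p : C) : (f \o @cexp R) (p + 'i%C * (2 * pi)%:C%C) = (f \o @cexp R) p.
  by rewrite /= cexp_periodic.
have e1 : Complex x 0 + (y - x)%:C%C = Complex y 0 by simpc; rewrite addrC subrK.
have pi0 := pi_gt0 R.
pose p2 : C := 'i%C * (2 * pi)%:C%C.
have p20 : p2 != 0.
  by rewrite -modulus_gt0 modulusM modulus_i mul1r modulus_real normr_gt0; apply/eqP; lra.
have := tendsZ p2^-1 h; rewrite mulr0; congr tends; apply/funext => m.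
rewrite /contour e1 av_translate (_ : (fun _ => _) = f \o @cexp R); last exact/funext.
by rewrite /circ -/p2; field.
Qed.

Lemma cmean_annulus f (x y : R) l : x <= y ->
  (forall z, expR x <= modulus z <= expR y -> exists c, cd f z c) ->
  cmean f x l -> cmean f y l.
Proof.
move=> xy hf hl; have := tendsD (circ_annulus xy hf) hl; rewrite add0r.
by congr tends; apply/funext => m; rewrite subrK.
Qed.

End CircleMean.

Section CauchyFormula.
Variable R : realType.
Local Notation C := R[i].
Implicit Types (f g k : C -> C) (p z w : C) (r s t x y M e : R).

Lemma cd_ctn f z c : cd f z c -> ctn f z.
Proof. by move=> hf e e0; exact: cd_continuous hf _ e0. Qed.

(* [circ_annulus] does not apply across the circle of radius |p|, but circle
   means depend continuously on the radius. *)
Lemma cmean_removable k p r x : expR x < r -> modulus p < expR x -> k 0 = 0 ->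
  (forall z, modulus z < r -> ctn k z) ->
  (forall z, modulus z < r -> z != p -> exists c, cd k z c) -> cmean k x 0.
Proof.
move=> xr px k0 kc kd.
have r0 : 0 < r by apply: lt_trans xr; exact: expR_gt0.
pose close y y' e := exists m0, forall m, (m0 <= m)%N -> modulus (circ m k y' - circ m k y) <= e.
have annulus y y' e : y <= y' -> y' <= x -> (expR y <= modulus p <= expR y' -> False) ->
    0 < e -> close y y' e.
  move=> yy' y'x np e0; have [|m0 hm0] := @circ_annulus R k y y' yy' _ e e0.
    move=> z zy; apply: kd.
      by have : expR y' <= expR x by [rewrite ler_expR]; lra.
    by apply/eqP => zp; apply: np; rewrite -zp.
  by exists m0 => m /hm0; rewrite subr0.
have trans y1 y2 y3 e1 e2 : close y1 y2 e1 -> close y2 y3 e2 -> close y1 y3 (e1 + e2).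
  move=> [m1 h1] [m2 h2]; exists (maxn m1 m2) => m; rewrite geq_max => /andP[/h1 l1 /h2 l2].
  by have := modulus_tri (circ m k y3) (circ m k y1) (circ m k y2); lra.
(* The descent past the circle through [p] uses an annulus outside it, two steps by continuity
   across it and an annulus inside it, each costing e / 4. For [p = 0] there is no circle to
   cross. *)
have reach y e : y <= x -> 0 < e -> exists2 y', y' <= y & close y' x e.
  move=> yx e0; have [p0|p0] := eqVneq p 0.
    exists y => //; apply: annulus => //.
    by rewrite p0 modulus0; have := expR_gt0 y; lra.
  have pp : expR (ln (modulus p)) = modulus p by rewrite lnK// posrE modulus_gt0.
  set xp := ln _ in pp.
  have xpx : xp < x by rewrite -ltr_expR pp.
  have e8 : 0 < e / 4 by lra.
  have [z zp|d d0 hd] := circ_near (x := xp) (f := k) e8.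
    by apply: kc; rewrite zp pp; lra.
  pose y1 := Num.min y (xp - d / 2); pose y2 := xp - d / 2; pose y3 := Num.min x (xp + d / 2).
  have y1y : y1 <= y by rewrite ge_min lexx.
  have y12 : y1 <= y2 by rewrite ge_min lexx orbT.
  have y3x : y3 <= x by rewrite ge_min lexx.
  have y3d : y3 <= xp + d / 2 by rewrite ge_min lexx orbT.
  have y3p : xp < y3 by rewrite lt_min xpx /=; lra.
  have y2p : y2 < xp by rewrite /y2; lra.
  exists y1 => //.
  have -> : e = e / 4 + (e / 4 + e / 4) + e / 4 by field.
  apply: (trans _ y3); first apply: (trans _ y2).
  - by apply: annulus => //; rewrite -?pp ?ler_expR; lra.
  - apply: (trans _ xp); exists 0%N => m _; last by apply: hd; rewrite ltr_norml; lra.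
    by rewrite modulus_subC; apply: hd; rewrite ltr_norml /y2; lra.
  - by apply: annulus => //; rewrite -?pp ?ler_expR; lra.
(* Half of the tolerance pays for the descent; the other half bounds [k] on a small circle, since
   [k] is continuous and vanishes at 0. *)
move=> e0 e0_gt0; have e_gt0 : 0 < e0 / 2 by lra.
have [|d d0 hd] := kc 0 _ _ e_gt0; first by rewrite modulus0.
have [|y yy [m0 hm0]] := reach (Num.min x (ln (d / 2))) _ _ e_gt0; first by rewrite ge_min lexx.
exists m0 => m /hm0 h; rewrite subr0.
have : modulus (circ m k y) <= e0 / 2.
  apply: circ_le => z zy; have := hd z; rewrite k0 !subr0 zy => h'; apply/ltW/h'.
  have : expR y <= expR (ln (d / 2)) by rewrite ler_expR; move: yy; rewrite le_min => /andP[].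
  by rewrite lnK ?posrE ?divr_gt0//; lra.
have := modulus_tri (circ m k x) 0 (circ m k y); rewrite !subr0; lra.
Qed.

Lemma cd_geometric p z : z != p -> exists c, cd (fun w => w / (w - p)) z c.
Proof.
move=> zp; have := cdB (cd_id z) (cd_cst p z); rewrite subr0 => h.
have [|c hc] := cdV _ h; first by rewrite subr_eq0.
by eexists; exact: (cdM (cd_id z) hc).
Qed.

(** The mean does not change with the radius, and w / (w - p) tends to 1 as the radius grows. *)
Lemma cmean_geometric p x : modulus p < expR x -> cmean (fun w => w / (w - p)) x 1.
Proof.
move=> px.
have hz z y : expR x <= expR y -> modulus z = expR y -> z != p.
  by move=> xy zy; apply/eqP => zp; move: zy; rewrite zp; lra.
have [l hl] : exists l, cmean (fun w => w / (w - p)) x l.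
  apply: cmean_exists => z /(hz _ _ (lexx _)) /cd_geometric [c hc]; exact: cd_ctn hc.
suff : l - 1 = 0 by move/eqP; rewrite subr_eq0 => /eqP <-.
apply: modulus_le0 => e e0; have p0 := modulus_ge0 p.
(* On the circle of radius [T], |w - p| is at least |p| / e + expR x, so |p / (w - p)| is at most
   e. *)
pose T := expR x + modulus p + modulus p / e.
have pe : 0 <= modulus p / e by rewrite divr_ge0// ltW.
have T0 : 0 < T by rewrite /T; have := expR_gt0 x; lra.
have eT : expR (ln T) = T by rewrite lnK.
have xT : x <= ln T by rewrite -ler_expR eT /T; lra.
have hl' : cmean (fun w => w / (w - p)) (ln T) l.
  apply: cmean_annulus hl => // z /andP[xz _]; apply: cd_geometric.
  by apply/eqP => zp; move: xz; rewrite zp; lra.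
apply: cmean_le (cmeanD hl' (cmean_cst (-1) (ln T))) => z; rewrite eT => zT.
have zp : z - p != 0 by rewrite subr_eq0; apply: (hz _ (ln T)); rewrite ?eT// -eT ler_expR.
have -> : z / (z - p) + -1 = p / (z - p) by field.
have zp' : modulus p / e + expR x <= modulus (z - p).
  by have := modulus_geB z p; rewrite zT /T; lra.
have ex := expR_gt0 x.
rewrite modulusM modulusV ler_pdivrMr; last lra.
have : e * (modulus p / e + expR x) <= e * modulus (z - p) by rewrite ler_pM2l.
rewrite mulrDr mulrCA divff ?mulr1; last by apply/eqP; lra.
have : 0 <= e * expR x by rewrite mulr_ge0// ltW.
lra.
Qed.

(** Since dw = i w dt on the circle, the angular mean of f(w) w / (w - p) is Cauchy's integral.
    Subtracting f(p) times [cmean_geometric] leaves w (f(w) - f(p)) / (w - p), whose factor w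
    provides the value 0 at 0 that [cmean_removable] asks for. *)
Theorem cauchy_formula f r x p : expR x < r -> modulus p < expR x ->
  (forall z, modulus z < r -> exists c, cd f z c) ->
  cmean (fun w => f w * (w / (w - p))) x (f p).
Proof.
move=> xr px hf; have [|c hc] := hf p; first lra.
pose k w := if w == p then p * c else w * ((f w - f p) / (w - p)).
have kcd z : modulus z < r -> z != p -> exists c, cd k z c.
  move=> zr zp; have [b hb] := hf z zr.
  have zp0 : z - p != 0 by rewrite subr_eq0.
  have := cdB (cd_id z) (cd_cst p z); rewrite subr0 => h1.
  have [|b' hb'] := cdV _ h1; first by [].
  have := cdM (cd_id z) (cdM (cdB hb (cd_cst (f p) z)) hb').
  set b2 := (X in cd _ _ X) => h2; exists b2.
  apply: (cd_eq (t := modulus (z - p))) h2; first by rewrite modulus_gt0.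
  move=> w; rewrite /k; case: eqP => [->|//].
  by rewrite modulus_subC ltxx.
have k0 : cmean k x 0.
  apply: (@cmean_removable k p r x) => //.
    by rewrite /k; case: eqP => [<-|_]; rewrite mul0r.
  move=> z zr; have [->|zp] := eqVneq z p; last by have [b /cd_ctn] := kcd z zr zp.
  move=> e e0; have p0 := modulus_ge0 p; have c0 := modulus_ge0 c.
  have a0 : 0 < e / 2 / (modulus p + 1) by apply: divr_gt0; lra.
  have [t t0 ht] := (cdP f p c).1 hc _ a0.
  pose t' := Num.min (Num.min t 1) (e / 2 / (modulus c + 1)).
  have t'0 : 0 < t' by rewrite !lt_min t0 ltr01 divr_gt0//; lra.
  exists t' => // w; rewrite !lt_min => /andP[/andP[w1 w2] w3].
  rewrite /k eqxx; case: eqP => [_|/eqP wp]; first by rewrite subrr modulus0.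
  have wp0 : w - p != 0 by rewrite subr_eq0.
  have wpm : 0 < modulus (w - p) by rewrite modulus_gt0.
  have q : modulus ((f w - f p) / (w - p) - c) <= e / 2 / (modulus p + 1).
    have -> : (f w - f p) / (w - p) - c = (f w - f p - (w - p) * c) / (w - p) by field.
    by rewrite modulusM modulusV ler_pdivrMr// ht.
  have -> : w * ((f w - f p) / (w - p)) - p * c =
     w * ((f w - f p) / (w - p) - c) + (w - p) * c by ring.
  apply: le_lt_trans (modulus_leD _ _) _; rewrite !modulusM.
  have mw : modulus w <= modulus p + 1 by have := modulus_geB w p; lra.
  have : modulus w * modulus ((f w - f p) / (w - p) - c) <= (modulus p + 1) * (e / 2 /
    (modulus p + 1)).
    by apply: ler_pM => //; exact: modulus_ge0.
  rewrite mulrCA divff ?mulr1; last by apply/eqP; lra.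
  move: w3; rewrite ltr_pdivlMr; last lra.
  lra.
have := cmeanD k0 (cmeanZ (f p) (cmean_geometric px)); rewrite add0r mulr1.
apply: cmean_ext => z zx; rewrite /k; case: eqP => [zp|/eqP zp].
  by exfalso; move: zx; rewrite zp; lra.
have zp0 : z - p != 0 by rewrite subr_eq0.
by field.
Qed.

End CauchyFormula.

(** * Function theory in one variable *)

Section OneVariable.
Variable R : realType.
Local Notation C := R[i].
Implicit Types (f g q : C -> C) (p z w c : C) (r s t x y M e : R).

Definition hold r f := forall z, modulus z < r -> exists c, cd f z c.

Lemma polar z x : modulus z = expR x -> exists2 t, 0 <= t <= 2 * pi & z = cexp (Complex x t).
Proof.
move=> zx; have x0 := expR_gt0 x; case: z zx => a b zx.
have ab : a ^+ 2 + b ^+ 2 = expR x ^+ 2 by rewrite -zx sqr_modulus.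
pose u := a / expR x; pose v := b / expR x.
have aE : a = expR x * u by rewrite /u; field; apply/eqP; lra.
have bE : b = expR x * v by rewrite /v; field; apply/eqP; lra.
have uv : u ^+ 2 + v ^+ 2 = 1.
  apply: (@mulfI _ (expR x ^+ 2)); first by rewrite expf_neq0//; apply/eqP; lra.
  by rewrite mulr1 -[RHS]ab /u /v; field; apply/eqP; lra.
have u1 : -1 <= u <= 1 by have := sqr_ge0 v; nra.
have [/andP[t0 tpi] cost] := acos_def u1.
have sint : sin (acos u) ^+ 2 = v ^+ 2 by have := cos2Dsin2 (acos u); rewrite cost; lra.
have sin0 : 0 <= sin (acos u) by apply: sin_ge0_pi; rewrite t0.
(* [acos] only reaches the upper half of the circle. *)
have [v0|v0] := leP 0 v.
  exists (acos u); first lra.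
  rewrite /cexp /= cost; have -> : sin (acos u) = v by apply/eqP; rewrite -(@eqrXn2 _ 2)// sint.
  by simpc; rewrite aE bE.
exists (2 * pi - acos u); first lra.
have -> : 2 * pi - acos u = - acos u + pi *+ 2 by rewrite mulr_natl addrC.
rewrite /cexp /= cosD2pi sinD2pi cosN sinN cost.
have -> : sin (acos u) = - v.
  by apply/eqP; rewrite -(@eqrXn2 _ 2)// ?oppr_ge0 ?(ltW v0)// sint sqrrN.
by rewrite opprK; simpc; rewrite aE bE.
Qed.

Lemma circle_bounded f x : (forall z, modulus z = expR x -> ctn f z) ->
  exists M, forall z, modulus z = expR x -> modulus (f z) <= M.
Proof.
move=> hf.
pose Q (_ y _ b : R) := exists M, forall t, y <= t <= y + b -> modulus (f (cexp (Complex x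
  t))) <= M.
suff [M hM] : Q 0 0 0 (2 * pi).
  by exists M => z /polar[t t2 ->]; apply: hM; rewrite add0r.
apply: (@bisect_rect R Q 0 0 0 (2 * pi) (lexx _) (pi2_ge0 R)) => [x0 y' a0 b' _ b0|s t _ ty].
  move=> [M1 h1] _ [M2 h2] _; exists (Num.max M1 M2) => t /andP[t1 t2].
  rewrite le_max; have [tm|tm] := leP t (y' + b' / 2).
    by rewrite h1 ?t1.
  by rewrite [X in _ || X]h2 ?orbT//; lra.
have ct : ctn (f \o @cexp R) (Complex x t).
  by apply: ctn_comp_cexp; apply: hf; rewrite modulus_cexp.
have [r r0 hr] := ct _ ltr01; exists r => // x0 y' a0 b' _ /andP[b0 br] _ ty' _ _ _ _.
exists (modulus (f (cexp (Complex x t))) + 1) => t' t'y.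
have /hr : modulus (Complex x t' - Complex x t) < r.
  apply: le_lt_trans (modulus_ReIm _) _; rewrite /= subrr normr0 add0r ltr_norml; lra.
by rewrite /=; have := modulus_geB (f (cexp (Complex x t'))) (f (cexp (Complex x t))); lra.
Qed.

Lemma hold_circle_bounded f r t : 0 < t -> t < r -> hold r f ->
  exists M, forall z, modulus z = t -> modulus (f z) <= M.
Proof.
move=> t0 tr hf; have et : expR (ln t) = t by rewrite lnK.
have [|M hM] := @circle_bounded f (ln t); last by exists M => z zt; apply: hM; rewrite et.
by move=> z; rewrite et => zt; have [|c /cd_ctn] := hf z; rewrite ?zt.
Qed.

Lemma cauchy_bound f r t p M : t < r -> modulus p < t -> hold r f ->
  (forall z, modulus z = t -> modulus (f z) <= M) -> modulus (f p) <= M * (t / (t - modulus p)).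
Proof.
move=> tr pt hf fM; have t0 : 0 < t by have := modulus_ge0 p; lra.
have et : expR (ln t) = t by rewrite lnK.
have := @cauchy_formula _ f r (ln t) p; rewrite et => /(_ tr pt hf).
apply: cmean_le => z; rewrite et => zt; rewrite modulusM.
apply: ler_pM; rewrite ?modulus_ge0 ?fM// modulusM modulusV zt.
rewrite ler_pM2l// lef_pV2 ?posrE; first by have := modulus_geB z p; lra.
- by have := modulus_geB z p; lra.
- lra.
Qed.

Lemma power_bound (x M c : R) : 0 <= M -> (forall k, x ^+ k <= M ^+ k * c) -> x <= M.
Proof.
move=> M0 h; rewrite leNgt; apply/negP => Mx; have x0 : 0 < x by lra.
have c0 : 1 <= c by have := h 0%N; rewrite !expr0 mul1r.
have y1 : `|M / x| < 1 by rewrite ger0_norm ?divr_ge0// ?ltW// ltr_pdivrMr// mul1r.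
have : (M / x) ^+ m @[m --> \oo] --> (0 : R) by exact: cvg_expr.
have ci : 0 < c^-1 by rewrite invr_gt0; lra.
move/cvgrPdist_lt => /(_ _ ci) [m _ /(_ m (leqnn _))] /=.
rewrite sub0r normrN ger0_norm ?exprn_ge0 ?divr_ge0// ?ltW//.
rewrite expr_div_n ltr_pdivrMr ?exprn_gt0// mulrC ltr_pdivlMr; last lra.
by have := h m; lra.
Qed.

(* Landau's trick: the constant in [cauchy_bound] disappears when it is applied
   to all powers of [f]. *)
Lemma max_principle f r t p M : t < r -> modulus p < t -> hold r f ->
  (forall z, modulus z = t -> modulus (f z) <= M) -> modulus (f p) <= M.
Proof.
move=> tr pt hf fM; have p0 := modulus_ge0 p.
have M0 : 0 <= M.
  apply: le_trans (fM t%:C%C _); first exact: modulus_ge0.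
  by rewrite modulus_real ger0_norm//; lra.
apply: (@power_bound _ _ (t / (t - modulus p))) => // k.
rewrite -modulusX; apply: (@cauchy_bound (fun z => f z ^+ k) r) => //.
  by move=> z /hf[c hc]; exact: cdX hc.
by move=> z /fM h; rewrite modulusX lerXn2r ?nnegrE ?modulus_ge0.
Qed.

(** Cauchy's kernels at [z] and at 0 differ by z / (w - z), so [q z] is the mean of f(w) / (w - z),
    and its derivative is the mean of f(w) / (w - z)^2. *)
Lemma hold_div_local f r t : 0 < t -> t < r -> hold r f ->
  exists2 q, hold t q & forall z, modulus z < t -> f z = f 0 + z * q z.
Proof.
move=> t0 tr hf; have et : expR (ln t) = t by rewrite lnK.
set x := ln t in et.
have [M hM] := hold_circle_bounded t0 tr hf.
have nz z w : modulus z < t -> modulus w = t -> w - z != 0.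
  by move=> zt wt; rewrite subr_eq0; apply/eqP => wz; move: wt; rewrite wz; lra.
have inv z w : modulus z < t -> modulus w = t -> exists c, cd (fun w => (w - z)^-1) w c.
  move=> zt wt; have := cdB (cd_id w) (cd_cst z w) => h.
  exact: (@cdV R (fun w => w - z) w _ (nz z w zt wt) h).
have fc w : modulus w = t -> exists c, cd f w c by move=> wt; apply: hf; rewrite wt.
have /choice[q hq] : forall z, exists l, modulus z < t -> cmean (fun w => f w * (w - z)^-1) x l.
  move=> z; have [zt|zt] := ltP (modulus z) t; last by exists 0 => //; lra.
  have [w|l hl] := @cmean_exists _ (fun w => f w * (w - z)^-1) x; last by exists l.
  rewrite et => wt; have [b hb] := fc w wt; have [c hc] := inv z w zt wt.
  exact: cd_ctn (cdM hb hc).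
have /choice[q' hq'] : forall z, exists l, modulus z < t ->
    cmean (fun w => f w * ((w - z)^-1 * (w - z)^-1)) x l.
  move=> z; have [zt|zt] := ltP (modulus z) t; last by exists 0 => //; lra.
  have [w|l hl] := @cmean_exists _ (fun w => f w * ((w - z)^-1 * (w - z)^-1)) x; last by exists l.
  rewrite et => wt; have [b hb] := fc w wt; have [c hc] := inv z w zt wt.
  exact: cd_ctn (cdM hb (cdM hc hc)).
exists q => z zt; last first.
  have c0 : modulus (0 : C) < expR x by rewrite modulus0 et.
  have := @cauchy_formula _ f r x z; rewrite et => /(_ tr zt hf) h1.
  have := @cauchy_formula _ f r x 0; rewrite et modulus0 => /(_ tr t0 hf) h2.
  have h3 := cmeanD (cmeanZ z (hq z zt)) h2; rewrite [RHS]addrC.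
  apply: tends_uniq h1 _; apply: cmean_ext h3 => w; rewrite et => wt.
  have w0 : w != 0 by rewrite -modulus_gt0 wt.
  have := nz z w zt wt; rewrite subr0 => ?; field.
  by apply/andP.
exists (q' z); apply/cdP => e e0.
have M0 : 0 <= M.
  apply: le_trans (hM t%:C%C _); first exact: modulus_ge0.
  by rewrite modulus_real ger0_norm// ltW.
pose d := t - modulus z; have d0 : 0 < d by rewrite /d; lra.
(* With |u - z| >= d and |u - w| >= d / 2 on the circle, the remainder is at most |w - z|^2 M
   divided by d^3 / 2. *)
exists (Num.min (d / 2) (e * d ^+ 3 / 2 / (M + 1))).
  by rewrite lt_min !divr_gt0 ?mulr_gt0 ?exprn_gt0//; lra.
move=> w; rewrite lt_min => /andP[w1]; rewrite ltr_pdivlMr => [w2|]; last lra.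
have wt : modulus w < t by have := modulus_geB w z; rewrite /d in w1; lra.
have h := cmeanD (cmeanD (hq w wt) (cmeanZ (-1) (hq z zt))) (cmeanZ (- (w - z)) (hq' z zt)).
rewrite mulN1r mulNr in h.
apply: cmean_le h => u; rewrite et => ut.
have uz := nz z u zt ut; have uw := nz w u wt ut.
have -> : f u * (u - w)^-1 + -1 * (f u * (u - z)^-1) + - (w - z) * (f u * ((u - z)^-1 * (u -
  z)^-1))
   = (w - z) * (w - z) * f u / ((u - z) * (u - z) * (u - w)).
  by field; rewrite uw.
have uz' : d <= modulus (u - z) by have := modulus_geB u z; rewrite ut.
have uw' : d / 2 <= modulus (u - w) by have := modulus_geB u w; have := modulus_geB w z;
  rewrite ut /d in w1 *; lra.
rewrite !modulusM modulusV !modulusM.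
have fu := hM u ut; have wz0 := modulus_ge0 (w - z).
set a := modulus (w - z) in w1 w2 wz0 *.
have D0 : d * d * (d / 2) <= modulus (u - z) * modulus (u - z) * modulus (u - w).
  have dd : d * d <= modulus (u - z) * modulus (u - z) by apply: ler_pM => //; exact: ltW.
  by apply: ler_pM => //; [apply: mulr_ge0; exact: ltW|lra].
have d3 : 0 < d * d * (d / 2) by rewrite !mulr_gt0//; lra.
rewrite ler_pdivrMr; last exact: lt_le_trans D0.
apply: (@le_trans _ _ (e * a * (d * d * (d / 2)))); last first.
  by rewrite ler_wpM2l// mulr_ge0// ltW.
apply: (@le_trans _ _ (a * a * (M + 1))).
  by apply: ler_wpM2l; [exact: mulr_ge0|lra].
have := ler_wpM2l wz0 (ltW w2).
by rewrite !exprS expr0; lra.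
Qed.

(** Away from 0 the quotient is holomorphic by the rules of calculus; at 0 it agrees with the
    quotient built on a smaller disc. *)
Lemma hold_div f r : 0 < r -> hold r f ->
  exists2 q, hold r q & forall z, modulus z < r -> f z = f 0 + z * q z.
Proof.
move=> r0 hf; have r20 : 0 < r / 2 by lra.
have [|q0 hq0 fq0] := hold_div_local r20 _ hf; first lra.
pose q z := if z == 0 then q0 0 else (f z - f 0) / z.
exists q => z zr; last first.
  rewrite /q; case: eqP => [->|/eqP z0]; first by rewrite mul0r addr0.
  by field.
have [->|z0] := eqVneq z 0.
  have [|c hc] := hq0 0; first by rewrite modulus0.
  exists c; apply: (cd_eq r20 _ hc) => w; rewrite subr0 => wr.
  rewrite /q; case: eqP => [->//|/eqP w0].
  by rewrite fq0//; field.
have [c hc] := hf z zr.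
have := cdM (cdB hc (cd_cst (f 0) z)) (cd_inv z0); set b := (X in cd _ _ X) => h.
exists b; apply: (cd_eq (t := modulus z)) h; first by rewrite modulus_gt0.
move=> w; rewrite /q; case: eqP => [->|//].
by rewrite sub0r modulusN ltxx.
Qed.

(** The maximum principle applied to the cofactor of w^k: a zero of order k gains the factor (|z| /
    t)^k. *)
Lemma order_bound q r t k z M : t < r -> modulus z < t -> hold r q ->
  (forall w, modulus w = t -> modulus (w ^+ k * q w) <= M) ->
  modulus (z ^+ k * q z) <= M * (modulus z / t) ^+ k.
Proof.
move=> tr zt hq hM; have t0 : 0 < t by have := modulus_ge0 z; lra.
have : modulus (q z) <= M / t ^+ k.
  apply: (max_principle tr zt hq) => w wt; have := hM w wt.
  by rewrite modulusM modulusX wt ler_pdivlMr ?exprn_gt0// mulrC.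
rewrite modulusM modulusX expr_div_n => h.
rewrite [leRHS](_ : _ = modulus z ^+ k * (M / t ^+ k)); last by ring.
by apply: ler_wpM2l => //; rewrite exprn_ge0 ?modulus_ge0.
Qed.

Lemma schwarz f r t z M : t < r -> modulus z < t -> hold r f -> f 0 = 0 ->
  (forall w, modulus w = t -> modulus (f w) <= M) -> modulus (f z) <= M * (modulus z / t).
Proof.
move=> tr zt hf f0 hM; have r0 : 0 < r by have := modulus_ge0 z; lra.
have [q hq fq] := hold_div r0 hf.
have := @order_bound q r t 1 z M tr zt hq; rewrite !expr1 fq ?f0 ?add0r; last lra.
by apply => w wt; have := hM w wt; rewrite fq ?f0 ?add0r// wt.
Qed.

Lemma lipschitz_center f r t z M : t < r -> modulus z < t -> hold r f ->
  (forall w, modulus w = t -> modulus (f w) <= M) ->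
  modulus (f z - f 0) <= 2 * M * (modulus z / t).
Proof.
move=> tr zt hf hM; have t0 : 0 < t by have := modulus_ge0 z; lra.
apply: (@schwarz (fun w => f w - f 0) r) => //.
- by move=> w /hf[c hc]; eexists; exact: cdB hc (cd_cst _ _).
- by rewrite subrr.
- move=> w /hM wM; have f0M : modulus (f 0) <= M.
    by apply: (max_principle tr _ hf hM); rewrite modulus0.
  by have := modulus_leB (f w) (f 0); lra.
Qed.

(** After two divisions by z, [order_bound] applies with boundary bound 4 M: M for f, M for f(0),
    and 2 M for t |c|, because c is the value at 0 of the first quotient. *)
Lemma quadratic_center f r t z c M : t < r -> modulus z < t -> hold r f -> cd f 0 c ->
  (forall w, modulus w = t -> modulus (f w) <= M) ->
  modulus (f z - f 0 - z * c) <= 4 * M * (modulus z / t) ^+ 2.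
Proof.
move=> tr zt hf hc hM; have t0 : 0 < t by have := modulus_ge0 z; lra.
have r0 : 0 < r by lra.
have [q hq fq] := hold_div r0 hf; have [q2 hq2 qq] := hold_div r0 hq.
have f0M : modulus (f 0) <= M.
  by apply: (max_principle tr _ hf hM); rewrite modulus0.
have zr w : modulus w < r -> f w - f 0 - w * q 0 = w ^+ 2 * q2 w.
  by move=> wr; rewrite (fq w)// (qq w)//; ring.
have [b hb] := hq 0 ltac:(by rewrite modulus0).
have qc : q 0 = c.
  apply: cd_uniq hc; have := cdD (cd_cst (f 0) 0) (cdM (cd_id 0) hb).
  rewrite mul0r addr0 add0r mulr1; apply: (cd_eq r0) => w; rewrite subr0 => wr.
  by rewrite [RHS]fq.
have cM : modulus c <= 2 * M / t.
  rewrite -qc; apply: (max_principle tr _ hq) => [|w wt]; first by rewrite modulus0.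
  rewrite ler_pdivlMr// mulrC -{1}wt -modulusM.
  have -> : w * q w = f w - f 0.
    by rewrite (fq w) ?wt// addrAC subrr add0r.
  by have := modulus_leB (f w) (f 0); have := hM w wt; lra.
rewrite -qc zr; last lra.
apply: (order_bound tr zt hq2) => w wt; rewrite -zr ?wt// qc.
apply: le_trans (modulus_leB _ _) _; rewrite modulusM wt.
have : t * modulus c <= 2 * M by rewrite mulrC -ler_pdivlMr.
by have := modulus_leB (f w) (f 0); have := hM w wt; lra.
Qed.

(** Each successive quotient by w vanishes at the accumulating zeros, hence at 0, so [f] is
    divisible by every power of w and |f(z)| <= M (|z| / t)^k for all k. *)
Lemma identity_center f r : 0 < r -> hold r f ->
  (forall e, 0 < e -> exists z, [/\ z != 0, modulus z < e & f z = 0]) ->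
  forall z, modulus z < r -> f z = 0.
Proof.
move=> r0 hf acc z zr.
have qk k : exists2 q, hold r q & forall w, modulus w < r -> f w = w ^+ k * q w.
  elim: k => [|k [q hq fq]]; first by exists f => // w _; rewrite expr0 mul1r.
  have q0 : q 0 = 0.
    apply/eqP; apply: contraT; rewrite -modulus_gt0 => q0.
    have [|c /cd_continuous /(_ _ q0)[t t0 ht]] := hq 0; first by rewrite modulus0.
    have [|w [w0 wt fw]] := acc (Num.min t r); first by rewrite lt_min t0.
    move: wt; rewrite lt_min => /andP[wt wr].
    have := ht w; rewrite subr0 => /(_ wt).
    have : f w == 0 by rewrite fw.
    rewrite fq// mulf_eq0 expf_eq0 (negbTE w0) andbF /= => /eqP ->.
    by rewrite sub0r modulusN ltxx.
  have [q' hq' qq'] := hold_div r0 hq; exists q' => // w wr.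
  by rewrite fq// qq'// q0 add0r exprSr mulrA.
pose t := (modulus z + r) / 2.
have zt : modulus z < t by rewrite /t; lra.
have tr : t < r by rewrite /t; lra.
have z0 := modulus_ge0 z; have t0 : 0 < t by lra.
have [M hM] := hold_circle_bounded t0 tr hf.
apply/eqP; rewrite -modulus_eq0 eq_le modulus_ge0 andbT.
have [//|fz] := leP (modulus (f z)) 0.
have u0 : 0 <= modulus z / t by rewrite divr_ge0// ltW.
have b k : modulus (f z) <= M * (modulus z / t) ^+ k.
  have [q hq fq] := qk k; rewrite fq//; apply: (order_bound tr zt hq) => w wt.
  by rewrite -fq ?wt// hM.
have : (1 : R) <= modulus z / t.
  apply: (@power_bound _ _ (M / modulus (f z))) => // k.
  by rewrite expr1n mulrA ler_pdivlMr// mul1r mulrC.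
by rewrite ler_pdivlMr// mul1r; lra.
Qed.

(** The powers of u = f(z) / f(0) all stay within 1/2 of 1, by the Lipschitz bound for the powers of
    f / f(0), which are bounded by 1. Yet near 1 squaring multiplies the distance to 1 by at least
    3/2, so u = 1. The radius [r / 8] is where the Lipschitz bound equals 1/2. *)
Lemma strong_max f r M z : hold r f -> (forall w, modulus w < r -> modulus (f w) <= M) ->
  modulus (f 0) = M -> modulus z < r / 8 -> f z = f 0.
Proof.
move=> hf hM f0 zr; have z0 := modulus_ge0 z.
have [M0|M0] := eqVneq M 0.
  have e w : modulus w < r -> f w = 0.
    by move=> /hM; rewrite M0 => h; apply/eqP; rewrite -modulus_eq0 eq_le h modulus_ge0.
  by rewrite !e ?modulus0//; lra.
have f00 : f 0 != 0 by rewrite -modulus_eq0 f0.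
have Mpos : 0 < M by rewrite -f0 modulus_gt0.
pose u := (f 0)^-1 * f z.
suff u1 : u = 1 by rewrite -[LHS]mul1r -(divff f00) -mulrA -/u u1 mulr1.
have ub k : modulus (u ^+ k - 1) <= 1 / 2.
  have hg : hold r (fun w => ((f 0)^-1 * f w) ^+ k).
    by move=> w /hf[c hc]; exact: cdX (cdZ (f 0)^-1 hc).
  have := @lipschitz_center _ r (r / 2) z 1 _ _ hg; rewrite mulVf// expr1n => h.
  apply: le_trans (h _ _ _) _; [lra|lra| |].
    move=> w wr; rewrite modulusX modulusM modulusV f0.
    rewrite exprn_ile1 ?mulr_ge0 ?modulus_ge0 ?invr_ge0 ?(ltW Mpos)//.
    by rewrite mulrC ler_pdivrMr// mul1r hM// wr; lra.
  by rewrite mulr1 -ler_pdivlMl// ler_pdivrMr; lra.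
have dbl j : (3 / 2) ^+ j * modulus (u - 1) <= modulus (u ^+ (2 ^ j) - 1).
  elim: j => [|j IH]; first by rewrite expr0 mul1r expn0 expr1.
  rewrite expnSr exprM; set v := u ^+ _ in IH *.
  have -> : v ^+ 2 - 1 = (v - 1) * (v + 1) by ring.
  have v1 : 3 / 2 <= modulus (v + 1).
    have := modulus_geB 2 (1 - v); rewrite modulus2 (modulus_subC 1 v).
    have -> : 2 - (1 - v) = v + 1 by ring.
    by have := ub (2 ^ j)%N; rewrite -/v; lra.
  rewrite modulusM exprS; have := modulus_ge0 (v - 1); nra.
apply/eqP; rewrite -subr_eq0 -modulus_eq0 eq_le modulus_ge0 andbT.
have [//|d0] := leP (modulus (u - 1)) 0.
have : (3 / 2 : R) <= 1.
  apply: (@power_bound _ _ ((1 / 2) / modulus (u - 1))) => // k.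
  by rewrite expr1n mul1r ler_pdivlMr//; exact: le_trans (dbl k) (ub _).
lra.
Qed.

(** A mean value inequality along the segment from 0 to [z], by bisection: the increment over a
    piece of parameter length b is at most e b. *)
Lemma cd0_constant f r z : (forall w, modulus w < r -> cd f w 0) -> modulus z < r -> f z = f 0.
Proof.
move=> hf zr; apply/eqP; rewrite -subr_eq0; apply/eqP/modulus_le0 => e e0.
pose Q (_ y _ b : R) := modulus (f ((y + b)%:C%C * z) - f (y%:C%C * z)) <= e * b.
suff : Q 0 0 0 1 by rewrite /Q add0r mul1r mul0r mulr1.
apply: (@bisect_rect R Q 0 0 0 1) => // [x0 y a0 b _ b0 h1 _ h2 _|s t _ /andP[t0 t1]].
  move: h1 h2; rewrite /Q -addrA (_ : b / 2 + b / 2 = b); last by field.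
  have := modulus_tri (f ((y + b)%:C%C * z)) (f (y%:C%C * z)) (f ((y + b / 2)%:C%C * z)).
  by lra.
have zs : 0 < modulus z + 1 by have := modulus_ge0 z; lra.
have tz : modulus (t%:C%C * z) < r.
  rewrite modulusM modulus_real ger0_norm//.
  by apply: le_lt_trans zr; rewrite ler_piMl ?modulus_ge0//; lra.
have [d d0 hd] := (cdP _ _ _).1 (hf _ tz) _ (divr_gt0 e0 zs).
exists (d / (modulus z + 1)); first exact: divr_gt0.
move=> x0 y a0 b _ /andP[b0]; rewrite ltr_pdivlMr// => bd _ /andP[y1 y2] _ _ _ _.
have near u : y <= u <= y + b -> modulus (f (u%:C%C * z) - f (t%:C%C * z)) <= e * `|u - t|.
  move=> uy; have dz : modulus (u%:C%C * z - t%:C%C * z) = `|u - t| * modulus z.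
    by rewrite -mulrBl -rmorphB modulusM modulus_real.
  have ub : `|u - t| <= b by rewrite ler_norml; lra.
  have un := normr_ge0 (u - t); have z0 := modulus_ge0 z.
  have := hd (u%:C%C * z); rewrite mulr0 subr0 dz => h.
  apply: le_trans (h _) _.
    by have : `|u - t| * modulus z <= b * modulus z; [apply: ler_wpM2r|nra].
  rewrite mulrAC ler_pdivrMr// -!mulrA ler_pM2l//.
  by rewrite ler_wpM2l//; lra.
have k1 := near y; have k2 := near (y + b).
rewrite /Q; have := modulus_tri (f ((y + b)%:C%C * z)) (f (y%:C%C * z)) (f (t%:C%C * z)).
rewrite (modulus_subC (f (t%:C%C * z))).
have /k1 : y <= y <= y + b by lra.
have /k2 : y <= y + b <= y + b by lra.
rewrite ger0_norm ?ler0_norm; lra.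
Qed.

End OneVariable.

(** * Uniform estimates and limits in several variables *)

Section SeveralVariables.
Variable R : realType.
Local Notation C := R[i].
Variable n : nat.
Implicit Types (f : 'rV[C]_n -> C) (a x y h v : 'rV[C]_n) (r s t e M : R).

Definition bal m (a : 'rV[C]_m) r : set 'rV[C]_m := [set x | vnorm (x - a) < r].

Definition hol (D : set 'rV[C]_n) f := forall x, D x -> exists L, sd f x L.

Lemma bal_center a r : 0 < r -> bal a r a.
Proof. by move=> r0; rewrite /bal /= subrr vnorm0. Qed.

Lemma bal_sub a x r s : vnorm (x - a) + s <= r -> bal x s `<=` bal a r.
Proof. by move=> h y; rewrite /bal /= => yx; have := vnorm_tri y a x; lra. Qed.

Lemma vnorm1 i : vnorm (delta_mx ord0 i : 'rV[C]_n) = 1.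
Proof.
apply/eqP; rewrite eq_le; apply/andP; split.
  apply: vnorm_le => // j; rewrite mxE eqxx /=.
  by case: (j == i); rewrite ?modulus0 ?modulus1.
by have := modulus_le_vnorm (delta_mx ord0 i : 'rV[C]_n) i; rewrite mxE !eqxx modulus1.
Qed.

Lemma delta_mulmx i (L : 'cV[C]_n) : ((delta_mx ord0 i : 'rV_n) *m L) ord0 ord0 = L i ord0.
Proof. by rewrite -rowE mxE. Qed.

Lemma hold_slice f a h r s : hol (bal a s) f -> r * vnorm h <= s ->
  hold r (fun w => f (a + w *: h)).
Proof.
move=> hf rs w wr; have [h0|h0] := eqVneq h 0.
  exists 0; rewrite (_ : (fun _ => _) = (fun=> f a)); first exact: cd_cst.
  by apply/funext => z; rewrite h0 scaler0 addr0.
have [|L hL] := hf (a + w *: h); last by eexists; exact: cd_line hL.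
rewrite /bal /= addrAC subrr add0r vnormZ; apply: lt_le_trans rs.
by rewrite ltr_pM2r// vnorm_gt0.
Qed.

(** The slice through [a] in direction [h] lives on a disc of radius s / |h|; [quadratic_center] at
    w = 1, with a circle of half that radius, gives 4 M (2 |h| / s)^2, whence the 16. *)
Lemma quadratic_bound f a L h s M : hol (bal a s) f ->
  (forall x, bal a s x -> modulus (f x) <= M) -> sd f a L -> vnorm h < s / 2 ->
  modulus (f (a + h) - f a - (h *m L) ord0 ord0) <= 16 * M * (vnorm h / s) ^+ 2.
Proof.
move=> hf fM fL hs; have h0 := vnorm_ge0 h; have s0 : 0 < s by lra.
have [->|hn0] := eqVneq h 0.
  by rewrite addr0 mul0mx mxE !subrr modulus0 vnorm0 mul0r expr0n mulr0.
have {}h0 : 0 < vnorm h by rewrite vnorm_gt0.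
have sl : hold (s / vnorm h) (fun w => f (a + w *: h)).
  by apply: hold_slice hf _; rewrite divfK//; apply/eqP; lra.
have L0 : sd f (a + 0 *: h) L by rewrite scale0r addr0.
have := @quadratic_center R _ (s / vnorm h) (s / 2 / vnorm h) 1 _ M _ _ sl (cd_line L0).
rewrite scale0r addr0 scale1r mul1r modulus1 => k.
have -> : 16 * M * (vnorm h / s) ^+ 2 = 4 * M * (1 / (s / 2 / vnorm h)) ^+ 2.
  by field; apply/andP; split; apply/eqP; lra.
apply: k.
- by rewrite ltr_pM2r ?invr_gt0//; lra.
- by rewrite ltr_pdivlMr// mul1r.
- move=> w ws; apply: fM; rewrite /bal /= addrAC subrr add0r vnormZ ws divfK; first lra.
  by apply/eqP; lra.
Qed.

Lemma lipschitz_bound f a h s M : hol (bal a s) f ->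
  (forall x, bal a s x -> modulus (f x) <= M) -> vnorm h < s / 2 ->
  modulus (f (a + h) - f a) <= 4 * M * (vnorm h / s).
Proof.
move=> hf fM hs; have h0 := vnorm_ge0 h; have s0 : 0 < s by lra.
have [->|hn0] := eqVneq h 0.
  by rewrite addr0 subrr modulus0 vnorm0 mul0r mulr0.
have {}h0 : 0 < vnorm h by rewrite vnorm_gt0.
have sl : hold (s / vnorm h) (fun w => f (a + w *: h)).
  by apply: hold_slice hf _; rewrite divfK//; apply/eqP; lra.
have := @lipschitz_center R _ (s / vnorm h) (s / 2 / vnorm h) 1 M _ _ sl.
rewrite scale0r addr0 scale1r modulus1 => k.
have -> : 4 * M * (vnorm h / s) = 2 * M * (1 / (s / 2 / vnorm h)).
  by field; apply/andP; split; apply/eqP; lra.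
apply: k.
- by rewrite ltr_pM2r ?invr_gt0//; lra.
- by rewrite ltr_pdivlMr// mul1r.
- move=> w ws; apply: fM; rewrite /bal /= addrAC subrr add0r vnormZ ws divfK; first lra.
  by apply/eqP; lra.
Qed.

Lemma tends_sum (I : finType) (u : I -> nat -> C) (l : I -> C) :
  (forall i, tends (u i) (l i)) -> tends (fun m => \sum_i u i m) (\sum_i l i).
Proof.
move=> ul; suff : forall s : seq I, tends (fun m => \sum_(i <- s) u i m) (\sum_(i <- s) l i)
  by [].
elim=> [|i s IH].
  by under eq_fun do rewrite big_nil; rewrite big_nil; exact: tends_cst.
by under eq_fun do rewrite big_cons; rewrite big_cons; exact: tendsD.
Qed.

(* For uniformly bounded sequences pointwise convergence is enough, by the
   uniform estimate [quadratic_bound]. *)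
Lemma weierstrass (G : nat -> 'rV[C]_n -> C) f a s M : 0 < s ->
  (forall k, hol (bal a s) (G k)) ->
  (forall k x, bal a s x -> modulus (G k x) <= M) ->
  (forall x, bal a s x -> tends (fun k => G k x) (f x)) -> exists L, sd f a L.
Proof.
move=> s0 hG GM Gf; have ba := bal_center a s0.
have M0 : 0 <= M by apply: le_trans (GM 0%N a ba); exact: modulus_ge0.
have /choice[L hL] : forall k, exists L, sd (G k) a L by move=> k; exact: hG.
have qb k h : vnorm h < s / 2 ->
    modulus (G k (a + h) - G k a - (h *m L k) ord0 ord0) <= 16 * M * (vnorm h / s) ^+ 2.
  by move=> hs; apply: quadratic_bound => //; exact: GM.
have /choice[l hl] : forall i, exists l, tends (fun k => L k i ord0) l.
  move=> i; apply: complex_cauchy => e e0.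
  (* For a step of length [t] the difference quotients are within e / 4 of the partial derivatives
     for all [k] at once; convergence at the two points [a + h] and [a] then gives the Cauchy
     property. *)
  pose c := 16 * M / s ^+ 2 + 1.
  have c0 : 0 < c by rewrite ltr_wpDl// divr_ge0 ?mulr_ge0 ?exprn_ge0// ltW.
  pose t := Num.min (s / 4) (e / 4 / c).
  have t0 : 0 < t by rewrite lt_min !divr_gt0.
  have ts : t <= s / 4 by rewrite ge_min lexx.
  have tc : c * t <= e / 4 by rewrite mulrC -ler_pdivlMr// ge_min lexx orbT.
  clearbody t; pose h : 'rV[C]_n := t%:C%C *: delta_mx ord0 i.
  have ht : vnorm h = t by rewrite vnormZ vnorm1 mulr1 modulus_real ger0_norm// ltW.
  have bh : bal a s (a + h) by rewrite /bal /= addrAC subrr add0r ht; lra.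
  have et : 0 < e * t / 8 by rewrite divr_gt0// mulr_gt0.
  have [m1 h1] := Gf _ bh _ et; have [m2 h2] := Gf _ ba _ et.
  exists (maxn m1 m2) => p q; rewrite !geq_max => /andP[/h1 p1 /h2 p2] /andP[/h1 q1 /h2 q2].
  have est k : modulus (G k (a + h) - G k a - t%:C%C * L k i ord0) <= e / 4 * t.
    have := qb k h; rewrite -scalemxAl mxE delta_mulmx ht => z.
    apply: le_trans (z _) _; first lra.
    rewrite (_ : 16 * M * (t / s) ^+ 2 = (c - 1) * t * t); last by rewrite /c; field;
      apply/eqP; lra.
    by rewrite ler_pM2r//; lra.
  have tp : modulus (t%:C%C * (L p i ord0 - L q i ord0)) = t * modulus (L p i ord0 - L q i ord0).
    by rewrite modulusM modulus_real ger0_norm// ltW.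
  rewrite -(ler_pM2l t0) -tp.
  have -> : t%:C%C * (L p i ord0 - L q i ord0) =
    (G q (a + h) - G q a - t%:C%C * L q i ord0) - (G p (a + h) - G p a - t%:C%C * L p i ord0)
    + ((G p (a + h) - f (a + h)) - (G q (a + h) - f (a + h)))
    - ((G p a - f a) - (G q a - f a)) by ring.
  have := est p; have := est q.
  set u1 := G q (a + h) - G q a - _; set u2 := G p (a + h) - G p a - _.
  set u3 := G p (a + h) - f (a + h) in p1 *; set u4 := G q (a + h) - f (a + h) in q1 *.
  set u5 := G p a - f a in p2 *; set u6 := G q a - f a in q2 *.
  have := modulus_leB (u1 - u2 + (u3 - u4)) (u5 - u6).
  have := modulus_leD (u1 - u2) (u3 - u4).
  have := modulus_leB u1 u2; have := modulus_leB u3 u4; have := modulus_leB u5 u6.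
  lra.
exists (\col_i l i) => e e0.
(* The quadratic bound survives the limit, and it implies differentiability of [f]. *)
have qf h : vnorm h < s / 2 ->
    modulus (f (a + h) - f a - (h *m \col_i l i) ord0 ord0) <= 16 * M * (vnorm h / s) ^+ 2.
  move=> hs; apply: (tends_modulus_le (u := fun k => G k (a + h) - G k a - (h *m L k) ord0 ord0)).
    apply: tendsB.
      by apply: tendsB; apply: Gf => //; rewrite /bal /= addrAC subrr add0r; lra.
    under eq_fun do rewrite mxE; rewrite mxE; apply: tends_sum => i.
    by rewrite mxE; apply: tendsZ.
  by move=> k; exact: qb.
pose c := 16 * M / s ^+ 2 + 1.
have c0 : 0 < c by rewrite ltr_wpDl// divr_ge0 ?mulr_ge0 ?exprn_ge0// ltW.
exists (Num.min (s / 2) (e / c)); first by rewrite lt_min !divr_gt0.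
move=> w; rewrite lt_min => /andP[w1]; rewrite ltr_pdivlMr// => w2.
have := qf _ w1; rewrite [a + _]addrC subrK => k; apply: le_trans k _.
have w0 := vnorm_ge0 (w - a).
rewrite (_ : _ * _ ^+ 2 = (c - 1) * vnorm (w - a) * vnorm (w - a)); last by rewrite /c; field;
  apply/eqP; lra.
by rewrite ler_wpM2r//; lra.
Qed.

Lemma sd_bounded_near f a L : sd f a L -> exists2 t, 0 < t &
  forall x, bal a t x -> modulus (f x) <= modulus (f a) + 1.
Proof.
move=> /sd_continuous /(_ _ ltr01)[t t0 ht]; exists t => // x /ht.
by have := modulus_geB (f x) (f a); lra.
Qed.

Lemma sd_translate f x v L : sd f (x + v) L -> sd (fun w => f (w + v)) x L.
Proof.
move=> h; rewrite -(mul1mx L); apply: (sd_comp (F := fun w => w + v)) h => j.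
have := sdD (sd_coord j x) (sd_cst (v ord0 j) x); rewrite addr0 => k.
rewrite (_ : col j 1%:M = delta_mx j ord0); last by rewrite colE mul1mx.
by move: k; congr (sd _ x _); apply/funext => w; rewrite mxE.
Qed.

(** The partial derivative is the limit of difference quotients with steps r / 8 times 2^-k; these
    are holomorphic and, by [lipschitz_bound], bounded by 8 M / r, so [weierstrass] applies. *)
Lemma partial_derivative f (D : 'rV[C]_n -> 'cV[C]_n) a s i : 0 < s ->
  (forall x, bal a s x -> sd f x (D x)) -> exists L, sd (fun x => D x i ord0) a L.
Proof.
move=> s0 fD.
have [t t0 ht] := sd_bounded_near (fD a (bal_center a s0)).
set M := _ + 1 in ht; pose r := Num.min s t.
have r0 : 0 < r by rewrite lt_min s0.
have hf : hol (bal a r) f.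
  by move=> x xr; exists (D x); apply: fD; move: xr; rewrite /bal /= lt_min => /andP[].
have fM x : bal a r x -> modulus (f x) <= M.
  by move=> xr; apply: ht; move: xr; rewrite /bal /= lt_min => /andP[].
pose T k := r / 8 * 2^-1 ^+ k; pose u k : 'rV[C]_n := (T k)%:C%C *: delta_mx ord0 i.
have p0 k : 0 < 2^-1 ^+ k :> R by apply: exprn_gt0; lra.
have p1 k : 2^-1 ^+ k <= 1 :> R by apply: exprn_ile1; lra.
have T0 k : 0 < T k by rewrite mulr_gt0//; lra.
have Tr k : T k <= r / 8 by rewrite -[leRHS]mulr1 ler_pM2l//; lra.
have uT k : vnorm (u k) = T k by rewrite vnormZ vnorm1 mulr1 modulus_real ger0_norm// ltW.
have mT k : modulus (T k)%:C%C = T k by rewrite modulus_real ger0_norm// ltW.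
have inner x : bal a (r / 4) x -> bal x (r / 2) `<=` bal a r.
  by rewrite /bal /= => xr; apply: bal_sub; lra.
pose G k x := ((T k)%:C%C)^-1 * (f (x + u k) - f x).
have G_hol k : hol (bal a (r / 4)) (G k).
  move=> x xr; have [|L hL] := hf (x + u k).
    by apply: (inner x) => //; rewrite /bal /= addrAC subrr add0r uT; have := Tr k; lra.
  have [|L' hL'] := hf x; first by apply: (inner x) => //; apply: bal_center; lra.
  by eexists; exact: sdZ (sdB (sd_translate hL) hL').
apply: (weierstrass (G := G) (s := r / 4) (M := 8 * M / r)) => //; first lra.
  move=> k x xr; rewrite modulusM modulusV mT ler_pdivrMl//.
  have hx := @lipschitz_bound f x (u k) (r / 2) M (fun y yx => hf y (inner x xr y yx))
    (fun y yx => fM y (inner x xr y yx)).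
  apply: le_trans (hx _) _; rewrite uT; first by have := Tr k; lra.
  rewrite [leLHS](_ : _ = T k * (8 * M / r))//; field; apply/eqP; lra.
move=> x xr e e0.
have M0 : 0 <= M by rewrite addr_ge0 ?modulus_ge0.
have b0 : 0 < e / (8 * M / r + 1).
  by rewrite divr_gt0// ltr_wpDl// divr_ge0 ?mulr_ge0// ltW.
have [m hm] := half_pow_lt b0; exists m => k mk.
have Dx : sd f x (D x).
  apply: fD; have : bal a r x by apply: (inner x) => //; apply: bal_center; lra.
  by rewrite /bal /= lt_min => /andP[].
have Tn : (T k)%:C%C != 0 :> C by rewrite -modulus_gt0 mT.
have -> : G k x - D x i ord0 = ((T k)%:C%C)^-1 * (f (x + u k) - f x - (u k *m D x) ord0 ord0).
  rewrite /u -scalemxAl mxE delta_mulmx /G; field.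
  exact: Tn.
rewrite modulusM modulusV mT ler_pdivrMl//.
have := @quadratic_bound f x (D x) (u k) (r / 2) M (fun y yx => hf y (inner x xr y yx))
    (fun y yx => fM y (inner x xr y yx)) Dx.
rewrite uT => hx; apply: le_trans (hx _) _; first by have := Tr k; lra.
have km : 2^-1 ^+ k <= 2^-1 ^+ m :> R by apply: ler_wiXn2l => //; lra.
have : (8 * M / r + 1) * 2^-1 ^+ k <= e.
  rewrite mulrC -ler_pdivlMr; first lra.
  by rewrite ltr_wpDl// divr_ge0 ?mulr_ge0// ltW.
rewrite (_ : 16 * M * (T k / (r / 2)) ^+ 2 = T k * (8 * M / r * 2^-1 ^+ k)); last first.
  by rewrite /T; field; apply/eqP; lra.
by move=> h; rewrite ler_pM2l//; have := p0 k; lra.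
Qed.

End SeveralVariables.

(** * Jacobian matrices and the inverse function theorem *)

Section InverseFunction.
Variable R : realType.
Local Notation C := R[i].
Implicit Types (r s t e M : R).

(** Vectors are rows, so the differential acts by multiplication on the right, and composition
    multiplies matrices in the order of application. *)
Definition vsd n m (F : 'rV[C]_n -> 'rV[C]_m) x (A : 'M[C]_(n, m)) :=
  forall j, sd (fun w => F w ord0 j) x (col j A).

Definition vhol n m (D : set 'rV[C]_n) (F : 'rV[C]_n -> 'rV[C]_m) :=
  forall x, D x -> exists A, vsd F x A.

Lemma vsd_of_coord n m (F : 'rV[C]_n -> 'rV[C]_m) x :
  (forall j, exists L, sd (fun w => F w ord0 j) x L) -> exists A, vsd F x A.
Proof.
move=> /choice[L hL]; exists (\matrix_(i, j) L j i ord0) => j.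
rewrite (_ : col j _ = L j)//; apply/colP => i; by rewrite !mxE.
Qed.

Lemma vsd_uniq n m (F : 'rV[C]_n -> 'rV[C]_m) x A B : vsd F x A -> vsd F x B -> A = B.
Proof.
move=> hA hB; apply/matrixP => i j.
by have := sd_uniq (hA j) (hB j) => /colP/(_ i); rewrite !mxE.
Qed.

Lemma vsd_mulmx n m k (F : 'rV[C]_n -> 'rV[C]_m) x A (B : 'M[C]_(m, k)) :
  vsd F x A -> vsd (fun w => F w *m B) x (A *m B).
Proof.
move=> hA j; have := sd_sum (fun i => sdZ (B i j) (hA i)).
rewrite (_ : \sum_i _ = col j (A *m B)); last first.
  by apply/colP => l; rewrite summxE !mxE; apply: eq_bigr => i _; rewrite !mxE mulrC.
by congr (sd _ x _); apply/funext => w; rewrite mxE; apply: eq_bigr => i _; rewrite mulrC.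
Qed.

Lemma vsdD n m (F G : 'rV[C]_n -> 'rV[C]_m) x A B :
  vsd F x A -> vsd G x B -> vsd (fun w => F w + G w) x (A + B).
Proof.
move=> hA hB j; have := sdD (hA j) (hB j); rewrite linearD.
by congr (sd _ x _); apply/funext => w; rewrite mxE.
Qed.

Lemma vsdB n m (F G : 'rV[C]_n -> 'rV[C]_m) x A B :
  vsd F x A -> vsd G x B -> vsd (fun w => F w - G w) x (A - B).
Proof.
move=> hA hB j; have := sdB (hA j) (hB j); rewrite linearB.
by congr (sd _ x _); apply/funext => w; rewrite !mxE.
Qed.

Lemma vsd_id n x : vsd (@id 'rV[C]_n) x 1%:M.
Proof. by move=> j; rewrite colE mul1mx; exact: sd_coord. Qed.

Lemma vsd_comp n m k (F : 'rV[C]_n -> 'rV[C]_m) (G : 'rV[C]_m -> 'rV[C]_k) x A B :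
  vsd F x A -> vsd G (F x) B -> vsd (G \o F) x (A *m B).
Proof.
move=> hA hB j; have := sd_comp hA (hB j).
by rewrite (_ : A *m col j B = col j (A *m B))// !colE mulmxA.
Qed.

Lemma mulmx_col_entry n m (v : 'rV[C]_n) (A : 'M[C]_(n, m)) j :
  (v *m col j A) ord0 ord0 = (v *m A) ord0 j.
Proof. by rewrite colE mulmxA -colE mxE. Qed.

Lemma vsd_bound n m (F : 'rV[C]_n -> 'rV[C]_m) x A : vsd F x A ->
  forall e, 0 < e -> exists2 t, 0 < t & forall w, vnorm (w - x) < t ->
    vnorm (F w - F x - (w - x) *m A) <= e * vnorm (w - x).
Proof.
move=> hF e e0; have /choice[t ht] : forall j, exists t, 0 < t /\ forall w, vnorm (w - x) < t ->
   modulus (F w ord0 j - F x ord0 j - ((w - x) *m col j A) ord0 ord0) <= e * vnorm (w - x).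
  by move=> j; have [t t0 ?] := hF j e e0; exists t.
exists (\big[Num.min/1]_j t j).
  by elim/big_ind : _ => // [a b a0 b0|j _]; [rewrite lt_min a0|have [] := ht j].
move=> w wt; apply: vnorm_le => [|j]; first by rewrite mulr_ge0 ?vnorm_ge0// ltW.
have [_ /(_ w)] := ht j; rewrite mulmx_col_entry !mxE; apply.
by apply: lt_le_trans wt _; rewrite (bigD1 j)//= ge_min lexx.
Qed.

Lemma vsd_continuous n m (F : 'rV[C]_n -> 'rV[C]_m) x A : vsd F x A ->
  forall e, 0 < e -> exists2 t, 0 < t & forall w, vnorm (w - x) < t -> vnorm (F w - F x) < e.
Proof.
move=> hF e e0; have [t t0 ht] := vsd_bound hF ltr01; have [c c0 hc] := vnorm_mulmx A.
have c1 : 0 < c + 1 by lra.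
exists (Num.min t (e / (c + 1))); first by rewrite lt_min t0 divr_gt0.
move=> w; rewrite lt_min => /andP[/ht h1]; rewrite ltr_pdivlMr// => h2.
have := vnorm_tri (F w - F x) 0 ((w - x) *m A); rewrite !subr0.
by have := hc (w - x); lra.
Qed.

Lemma tends_vnorm n (u : nat -> 'rV[C]_n) (l : 'rV[C]_n) :
  (forall i, tends (fun k => u k ord0 i) (l ord0 i)) ->
  forall e, 0 < e -> exists m0, forall m, (m0 <= m)%N -> vnorm (u m - l) <= e.
Proof.
move=> h e e0; have /choice[m hm] : forall i, exists m0, forall m, (m0 <= m)%N ->
    modulus (u m ord0 i - l ord0 i) <= e by move=> i; exact: h.
exists (\max_i m i)%N => k mk; apply: vnorm_le => [|i]; first exact: ltW.
by rewrite !mxE; apply: hm; apply: leq_trans mk; exact: leq_bigmax.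
Qed.

Variable n : nat.
Implicit Types (G : 'rV[C]_n -> 'rV[C]_n) (a x y : 'rV[C]_n).

(* After normalizing the differential at [a] to the identity, [G - id] has
   vanishing differential at [a], so it is a contraction near [a]. *)
Lemma near_identity G a r (A : 'M[C]_n) r0 : 0 < r -> vhol (bal a r) G -> vsd G a A ->
  A \in unitmx -> 0 < r0 -> exists s, [/\ 0 < s, s <= r, s <= r0 &
    forall x y, bal a s x -> bal a s y ->
      vnorm ((G x *m invmx A - x) - (G y *m invmx A - y)) <= 2^-1 * vnorm (x - y)].
Proof.
move=> rpos hG GA Au r00; pose g x := G x *m invmx A - x.
have ga : vsd g a 0.
  by have := vsdB (vsd_mulmx (invmx A) GA) (vsd_id a); rewrite mulmxV// subrr.
have hg : vhol (bal a r) g.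
  by move=> x /hG[B hB]; eexists; exact: vsdB (vsd_mulmx (invmx A) hB) (vsd_id x).
have [t t0 ht] := vsd_continuous ga ltr01.
pose r1 := Num.min r t; have r10 : 0 < r1 by rewrite lt_min rpos.
have gM j x : bal a r1 x -> modulus (g x ord0 j - g a ord0 j) <= 1.
  rewrite /bal /= lt_min => /andP[_ /ht] h.
  by have := modulus_le_vnorm (g x - g a) j; rewrite !mxE in h *; lra.
have hol1 j : hol (bal a r1) (fun x => g x ord0 j - g a ord0 j).
  move=> x; rewrite /bal /= lt_min => /andP[/hg[B hB] _].
  by eexists; exact: sdB (hB j) (sd_cst _ _).
pose c := 16 / r1 ^+ 2; have c0 : 0 < c by rewrite divr_gt0// exprn_gt0.
have quad j x : vnorm (x - a) < r1 / 2 ->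
    modulus (g x ord0 j - g a ord0 j) <= c * vnorm (x - a) ^+ 2.
  move=> xr; have h0 := sdB (ga j) (sd_cst (g a ord0 j) a).
  have := @quadratic_bound _ _ _ a _ (x - a) r1 1 (hol1 j) (gM j) h0 xr.
  have z : (0 : 'M[C]_1) ord0 ord0 = 0 by rewrite mxE.
  rewrite [a + _]addrC subrK linear0 subr0 mulmx0 z subrr !subr0 mulr1.
  by rewrite /c expr_div_n mulrA mulrAC.
(* The bound 1 / (32 c) serves both cases below: if |x - y| < s / 2, [lipschitz_bound] gives the
   factor 16 c s <= 1/2; otherwise two values of at most 4 c s^2 add up to at most s / 4. *)
pose s := Num.min (Num.min (r1 / 8) r0) (32 * c)^-1.
have s0 : 0 < s by rewrite !lt_min divr_gt0// r00 invr_gt0 mulr_gt0.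
have s1 : s <= r1 / 8 by rewrite !ge_min lexx.
have s2 : s <= r0 by rewrite !ge_min lexx !orbT.
have s3 : s <= (32 * c)^-1 by rewrite !ge_min lexx !orbT.
clearbody s.
have {}s3 : 32 * c * s <= 1.
  have c32 : 0 < 32 * c by rewrite mulr_gt0.
  by have := ler_wpM2l (ltW c32) s3; rewrite divff//; apply/eqP; lra.
have r1r : r1 <= r by rewrite ge_min lexx.
exists s; split => //; first lra.
move=> x y xs ys; rewrite -/(g x) -/(g y).
have xy0 := vnorm_ge0 (x - y).
apply: vnorm_le => [|j]; first by rewrite mulr_ge0//; lra.
rewrite mxE [(- g y) _ _]mxE.
have small z : bal a (2 * s) z -> modulus (g z ord0 j - g a ord0 j) <= 4 * c * s ^+ 2.
  rewrite /bal /= => zs; apply: le_trans (quad j z _) _; first lra.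
  have -> : 4 * c * s ^+ 2 = c * (2 * s) ^+ 2 by ring.
  by rewrite ler_pM2l// lerXn2r ?nnegrE ?vnorm_ge0//; lra.
have [xys|xys] := ltP (vnorm (x - y)) (s / 2).
  have ybal : bal y s `<=` bal a (2 * s) by apply: bal_sub; move: ys; rewrite /bal /=; lra.
  have ysub : bal y s `<=` bal a r1 by apply: bal_sub; move: ys; rewrite /bal /=; lra.
  have := @lipschitz_bound _ _ _ y (x - y) s (4 * c * s ^+ 2)
    (fun z zy => hol1 j z (ysub z zy)) (fun z zy => small z (ybal z zy)) xys.
  rewrite [y + _]addrC subrK.
  have -> : g x ord0 j - g a ord0 j - (g y ord0 j - g a ord0 j) = g x ord0 j - g y ord0 j by ring.
  move=> h; apply: le_trans h _.
  rewrite [leLHS](_ : _ = 16 * c * s * vnorm (x - y)); last by field; apply/eqP; lra.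
  by rewrite ler_wpM2r//; lra.
have sx := small x; have sy := small y.
have -> : g x ord0 j - g y ord0 j = (g x ord0 j - g a ord0 j) - (g y ord0 j - g a ord0 j) by ring.
apply: le_trans (modulus_leB _ _) _.
have /sx : bal a (2 * s) x by move: xs; rewrite /bal /=; lra.
have /sy : bal a (2 * s) y by move: ys; rewrite /bal /=; lra.
have : 32 * c * s * s <= 1 * s by rewrite ler_pM2r.
by rewrite expr2; lra.
Qed.

(** The contraction of [near_identity] bounds |x - y| by a multiple of |G x - G y|, which yields
    injectivity, invertible differentials and a Lipschitz inverse; a fixed point iteration yields
    the solutions. The ceiling [r0] on [s] allows the ball to be kept away from a given point. *)
Theorem inverse_function G a r (A : 'M[C]_n) r0 : 0 < r -> vhol (bal a r) G -> vsd G a A ->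
  A \in unitmx -> 0 < r0 -> exists s t (H : 'rV[C]_n -> 'rV[C]_n),
  [/\ 0 < s <= r0 /\ s <= r, 0 < t,
    (forall x y, bal a s x -> bal a s y -> G x = G y -> x = y),
    (forall x B, bal a s x -> vsd G x B -> B \in unitmx) &
    (forall y, bal (G a) t y -> [/\ bal a s (H y), G (H y) = y & exists B, vsd H y B])].
Proof.
move=> rpos hG GA Au r00.
have [s [s0 sr sr0 contr]] := near_identity rpos hG GA Au r00.
have [c c0 hc] := vnorm_mulmx (invmx A).
(* With this radius the first step of the iteration below is at most s / 4, and the iterates stay
   within s / 2 of [a]. *)
pose t := s / 4 / c; have t0 : 0 < t by rewrite !divr_gt0.
pose g x := G x *m invmx A - x.
have sub3 (p q w : 'rV[C]_n) : p - q - (p - w) = - (q - w).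
  by rewrite (opprD p) opprK addrACA subrr add0r opprB addrC.
have inj x y : bal a s x -> bal a s y -> G x = G y -> x = y.
  move=> xs ys gxy; have := contr x y xs ys; rewrite gxy.
  have -> : G y *m invmx A - x - (G y *m invmx A - y) = - (x - y) by exact: sub3.
  rewrite vnormN => h; have := vnorm_ge0 (x - y) => h0.
  by apply/eqP; rewrite -subr_eq0; apply/eqP/vnorm_le0; lra.
have lip x y : bal a s x -> bal a s y -> vnorm (x - y) <= 2 * c * vnorm (G x - G y).
  move=> xs ys; have h := contr x y xs ys; have k := hc (G x - G y).
  have := vnorm_tri ((G x - G y) *m invmx A) ((G x *m invmx A - x) - (G y *m invmx A - y)) 0.
  have -> : (G x - G y) *m invmx A - (G x *m invmx A - x - (G y *m invmx A - y)) = x - y.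
    rewrite mulmxBl; move: (G x *m _) (G y *m _) => p q.
    by rewrite !opprB !addrA; apply/rowP => i; rewrite !mxE; ring.
  rewrite subr0 sub0r vnormN; lra.
have unit x B : bal a s x -> vsd G x B -> B \in unitmx.
  move=> xs GB; rewrite -row_free_unit; apply/inj_row_free => v vB.
  (* A displacement h along a kernel vector would change [G] by at most |h| / (4 c), so that [lip]
     would give |h| <= |h| / 2. *)
  have e0 : 0 < (4 * c)^-1 by rewrite invr_gt0 mulr_gt0.
  have [d d0 hd] := vsd_bound GB e0.
  apply/eqP; apply: contraT => v0.
  have vn : 0 < vnorm v by rewrite vnorm_gt0.
  pose l := Num.min d (s - vnorm (x - a)) / 2 / vnorm v.
  have xs0 : 0 < s - vnorm (x - a) by move: xs; rewrite /bal /=; lra.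
  have m0 : 0 < Num.min d (s - vnorm (x - a)) by rewrite lt_min d0.
  have l0 : 0 < l by rewrite !divr_gt0.
  have lv : vnorm (l%:C%C *: v) = Num.min d (s - vnorm (x - a)) / 2.
    by rewrite vnormZ modulus_real ger0_norm ?(ltW l0)// divfK//; apply/eqP; lra.
  have md : Num.min d (s - vnorm (x - a)) <= d by rewrite ge_min lexx.
  have ms : Num.min d (s - vnorm (x - a)) <= s - vnorm (x - a) by rewrite ge_min lexx orbT.
  have ys : bal a s (x + l%:C%C *: v).
    rewrite /bal /= addrAC; apply: le_lt_trans (vnorm_leD _ _) _; rewrite lv; lra.
  have := hd (x + l%:C%C *: v); rewrite [x + _]addrC addrK lv -scalemxAl vB scaler0 subr0 => h.
  have /h {}h : Num.min d (s - vnorm (x - a)) / 2 < d by lra.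
  have := lip _ _ ys xs; rewrite [x + _]addrC addrK lv.
  have : 2 * c * vnorm (G (l%:C%C *: v + x) - G x) <= 2 * c * ((4 * c)^-1 * (Num.min d (s -
    vnorm (x - a)) / 2)).
    by rewrite ler_pM2l// mulr_gt0.
  rewrite [X in _ <= X -> _](_ : _ = Num.min d (s - vnorm (x - a)) / 4).
    lra.
  by field; apply/eqP; lra.
have solve y : bal (G a) t y -> exists x, bal a s x /\ G x = y.
  rewrite /bal /= => yt.
  (* Fixed points of [Phi] solve [G x = y], and [Phi] contracts because [g] does. *)
  pose y' := y *m invmx A; pose Phi x := y' - g x.
  pose u k := iter k Phi a; pose eta := s / 4.
  have eta0 : 0 < eta by rewrite divr_gt0.
  have u1 : vnorm (Phi a - a) <= eta.
    rewrite /Phi /g opprB addrCA addrAC subrr add0r.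
    rewrite -mulmxBl; apply: le_trans (hc _) _.
    by move: yt; rewrite /t ltr_pdivlMr// mulrC => /ltW.
  have p0 k : 0 < 2^-1 ^+ k :> R by apply: exprn_gt0; lra.
  have uP k : bal a s (u k) /\ vnorm (u k - a) <= 2 * eta * (1 - 2^-1 ^+ k) /\
      vnorm (u k.+1 - u k) <= eta * 2^-1 ^+ k.
    elim: k => [|k [bk [dk ek]]].
      split; first exact: bal_center.
      by rewrite expr0 mulr1 [1 - 1]subrr mulr0 [u 0%N - a]subrr vnorm0.
    have dk1 : vnorm (u k.+1 - a) <= 2 * eta * (1 - 2^-1 ^+ k.+1).
      have := vnorm_tri (u k.+1) a (u k); rewrite exprS; lra.
    have bk1 : bal a s (u k.+1).
      rewrite /bal /=; apply: le_lt_trans dk1 _; have := p0 k.+1; rewrite /eta => h.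
      by have := mulr_gt0 s0 h; lra.
    split => //; split => //.
    have -> : u k.+2 - u k.+1 = - (g (u k.+1) - g (u k)).
      exact: (sub3 y' (g (u k.+1)) (g (u k))).
    rewrite vnormN; apply: le_trans (contr _ _ bk1 bk) _; rewrite exprS; lra.
  have /choice[x hx] : forall i, exists l, tends (fun k => u k ord0 i) l /\ modulus (l - a
    ord0 i) <= 2 * eta.
    move=> i; have [|l h1 h2] := @tends_geometric R (fun k => u k ord0 i) eta; last by exists l.
    move=> k; have [_ [_ h]] := uP k.
    by apply: le_trans h; have := modulus_le_vnorm (u k.+1 - u k) i; rewrite !mxE.
  exists (\row_i x i).
  have xs : bal a s (\row_i x i).
    rewrite /bal /=; apply: (@le_lt_trans _ _ (2 * eta)); last by rewrite /eta; lra.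
    by apply: vnorm_le => [|i]; [lra|rewrite !mxE; have [] := hx i].
  split => //.
  have fix_x : \row_i x i = Phi (\row_i x i).
    apply/rowP => i.
    have ux : forall j, tends (fun k => u k ord0 j) ((\row_i x i) ord0 j).
      by move=> j; rewrite mxE; have [] := hx j.
    have shift : tends (fun k => u k.+1 ord0 i) ((\row_i x i) ord0 i).
      by move=> e /(ux i)[m hm]; exists m => k mk; apply: hm; exact: leqW.
    apply: tends_uniq shift _ => e e0; have [m hm] := tends_vnorm ux e0; exists m => k /hm h.
    have [bk _] := uP k; have h2 := contr _ _ bk xs.
    have := modulus_le_vnorm (Phi (u k) - Phi (\row_i x i)) i.
    rewrite mxE [(- Phi _) _ _]mxE => h1; apply: le_trans h1 _; rewrite /Phi sub3 vnormN.
    by have := vnorm_ge0 (u k - \row_i x i); rewrite /g; lra.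
  have : G (\row_i x i) *m invmx A = y *m invmx A.
    move: fix_x; rewrite /Phi /g opprB addrCA -[LHS]addr0 => /addrI/esym/eqP.
    by rewrite subr_eq0 => /eqP <-.
  by move/(congr1 (mulmx^~ A)); rewrite !mulmxKV.
have /choice[H hH] : forall y, exists x, bal (G a) t y -> bal a s x /\ G x = y.
  move=> y; have [/solve[x hx]|ny] := pselect (bal (G a) t y); first by exists x.
  by exists a.
exists s, t, H; split => //; first by rewrite s0.
move=> y yt; have [Hs GH] := hH y yt; split => //.
have [B GB] : exists B, vsd G (H y) B.
  by apply: hG; move: Hs; rewrite /bal /=; lra.
have Bu := unit _ _ Hs GB; exists (invmx B) => j.
have [b b0 hb] := vnorm_mulmx (invmx B).
move=> e e0; have k0 : 0 < e / (b * (2 * c)) by rewrite !divr_gt0 ?mulr_gt0.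
have [d d0 hd] := vsd_bound GB k0.
have yt0 : 0 < t - vnorm (y - G a) by move: yt; rewrite /bal /=; lra.
exists (Num.min (t - vnorm (y - G a)) (d / (2 * c)));
  first by rewrite lt_min yt0 divr_gt0// mulr_gt0.
move=> w; rewrite lt_min => /andP[w1]; rewrite ltr_pdivlMr ?mulr_gt0// => w2.
have wt : bal (G a) t w by rewrite /bal /=; have := vnorm_tri w (G a) y; lra.
have [Hw GHw] := hH w wt.
have := lip _ _ Hw Hs; rewrite GHw GH => l1.
have /hd : vnorm (H w - H y) < d by apply: le_lt_trans l1 _; lra.
rewrite GHw GH => l2.
(* The remainder of [H] at [y] is that of [G] at [H y], multiplied by the negative of the inverse of
   [B]; [lip] converts its size into one in terms of |w - y|. *)
have := le_trans (modulus_le_vnorm ((w - y - (H w - H y) *m B) *m invmx B) j) (hb _).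
have -> : (w - y - (H w - H y) *m B) *m invmx B = (w - y) *m invmx B - (H w - H y).
  by rewrite mulmxBl mulmxK.
have -> : ((w - y) *m invmx B - (H w - H y)) ord0 j =
    - (H w ord0 j - H y ord0 j - ((w - y) *m col j (invmx B)) ord0 ord0).
  by rewrite mulmx_col_entry mxE [(- (H w - H y)) _ _]mxE [(H w - _) _ _]mxE [(- H y) _ _]mxE;
    ring.
rewrite modulusN => l3; apply: le_trans l3 _.
apply: (@le_trans _ _ (b * (e / (b * (2 * c)) * (2 * c * vnorm (w - y))))).
  rewrite ler_pM2l//; apply: le_trans l2 _; apply: ler_wpM2l => //; exact: ltW.
rewrite [leLHS](_ : _ = e * vnorm (w - y))//; field; apply/andP; split; apply/eqP; lra.
Qed.

End InverseFunction.

(** * Injective holomorphic maps have a regular point *)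

Section InjectiveRegular.
Variable R : realType.
Local Notation C := R[i].
Variable n : nat.
Implicit Types (D : set 'rV[C]_n) (f F : 'rV[C]_n -> 'rV[C]_n) (a x y : 'rV[C]_n).

Definition opens D := forall x, D x -> exists2 r : R, 0 < r & bal x r `<=` D.

(* At a point of maximal rank k < n of the differential, local coordinates
   produce a disc along which the first k components of [f], hence all of [f],
   are constant. *)
Lemma injective_regular D f x0 : opens D -> vhol D f -> D x0 ->
  (forall x y, D x -> D y -> f x = f y -> x = y) ->
  exists a A, [/\ D a, vsd f a A & A \in unitmx].
Proof.
move=> Dop hf Dx0 finj.
have /choice[Df hDf] : forall x, exists A, D x -> vsd f x A.
  move=> x; have [/hf[A hA]|nDx] := pselect (D x); first by exists A.
  by exists 0.
have exk : exists k, `[< exists x, D x /\ \rank (Df x) = k >].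
  by exists (\rank (Df x0)); apply/asboolP; exists x0.
have kn k : `[< exists x, D x /\ \rank (Df x) = k >] -> (k <= n)%N.
  by move=> /asboolP[x [_ <-]]; exact: rank_leq_row.
have [k /asboolP[a [Da ak]] kmax] := ex_maxnP exk kn.
have {}kmax x : D x -> (\rank (Df x) <= k)%N.
  by move=> Dx; apply: kmax; apply/asboolP; exists x.
pose A := Df a; have hA : vsd f a A by exact: hDf.
have : (k <= n)%N by rewrite -ak rank_leq_row.
rewrite leq_eqVlt => /orP[/eqP kn'|kltn].
  by exists a, A; split => //; rewrite -row_free_unit -row_leq_rank -/A ak kn'.
exfalso.
have [r r0 rD] := Dop a Da.
(* Rank normal form: after multiplication by the inverse of [E], the first k components of [f] carry
   the whole rank at [a]. *)
pose Cm := col_ebase A; pose E := row_ebase A; pose P : 'M[C]_n := pid_mx k.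
have AE : Cm *m P *m E = A by rewrite /P -ak mulmx_ebase.
have PP : P *m P = P by rewrite /P pid_mx_id// ltnW.
have cP : copid_mx k *m P = 0 :> 'M[C]_n by rewrite mul_copid_mx_pid// ltnW.
pose N := invmx E *m P.
(* Those k components are completed by linear coordinates of [x] so that the differential at [a]
   becomes Cm P + Cm (1 - P) = Cm, which is invertible. *)
pose G x := f x *m N + x *m (Cm *m copid_mx k).
have hG x B : vsd f x B -> vsd G x (B *m N + Cm *m copid_mx k).
  move=> hB; apply: vsdD; first exact: vsd_mulmx.
  by have := vsd_mulmx (Cm *m copid_mx k) (vsd_id x); rewrite mul1mx.
have GA : vsd G a Cm.
  have := hG _ _ hA; rewrite -AE /N !mulmxA mulmxK ?row_ebase_unit// -(mulmxA Cm) PP.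
  by rewrite -mulmxDr /copid_mx addrC subrK mulmx1.
have hGr : vhol (bal a r) G by move=> x /rD Dx; eexists; exact: hG _ _ (hDf x Dx).
have [s [t [H [[s0 sr] t0 Ginj Gunit GH]]]] := inverse_function r0 hGr GA (col_ebase_unit A) r0.
pose i0 := Ordinal kltn; pose e : 'rV[C]_n := delta_mx ord0 i0.
have eP : e *m P = 0.
  by apply/rowP => j; rewrite -rowE !mxE /= ltnn andbF.
have sD x : bal a s x -> D x.
  by move=> xs; apply: rD; move: xs; rewrite /bal /=; lra.
have GP x : G x *m P = f x *m N.
  by rewrite /G mulmxDl -!mulmxA cP !mulmx0 addr0 PP.
(* The disc [y] moves in the coordinate of index [k], which [P] kills; the k chosen components of
   [f] are therefore constant along its preimage [c]. *)
pose y (l : C) := G a + l *: e; pose c l := H (y l).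
have yt l : modulus l < t -> bal (G a) t (y l).
  by rewrite /bal /= /y addrAC subrr add0r vnormZ vnorm1 mulr1.
have fc l : modulus l < t -> f (c l) *m N = G a *m P.
  by move=> /yt/GH[_ Gc _]; rewrite -GP /c Gc /y mulmxDl -scalemxAl eP scaler0 addr0.
have fc0 l j : modulus l < t -> cd (fun w => f (c w) ord0 j) l 0.
  move=> lt; have [cs Gc [B hB]] := GH _ (yt l lt).
  have Dx := sD _ cs; have hx := hDf _ Dx.
  pose v := e *m B.
  have cdc i : cd (fun w => c w ord0 i) l (v ord0 i).
    by have := cd_line (hB i); rewrite mulmx_col_entry.
  have vMN : v *m (Df (c l) *m N) = 0.
    apply/rowP => i; rewrite [RHS]mxE -mulmx_col_entry.
    apply: (@cd_uniq R (fun w => (f (c w) *m N) ord0 i) l).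
      exact: (cd_curve cdc (vsd_mulmx N hx i)).
    have tl : 0 < t - modulus l by lra.
    apply: (cd_eq tl _ (cd_cst ((G a *m P) ord0 i) l)) => w wl.
    by rewrite fc//; have := modulus_geB w l; lra.
  (* The chosen components still have rank k at [c l], while [Df] has rank at most k by maximality.
     The kernels then coincide, so the tangent [v] is killed by [Df] itself. *)
  have vM : v *m Df (c l) = 0.
    have rMN : \rank (Df (c l) *m N) = k.
      have U := Gunit _ _ cs (hG _ _ hx).
      have : (Df (c l) *m N + Cm *m copid_mx k) *m P = Df (c l) *m N.
        by rewrite mulmxDl -!mulmxA cP mulmx0 addr0 PP.
      move=> <-; rewrite eqmxMfull ?row_full_unit//.
      by rewrite rank_pid_mx// ltnW.
    have sub : (kermx (Df (c l)) <= kermx (Df (c l) *m N))%MS.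
      by apply/sub_kermxP; rewrite mulmxA mulmx_ker mul0mx.
    have : (kermx (Df (c l) *m N) <= kermx (Df (c l)))%MS.
      by rewrite -(geq_leqif (mxrank_leqif_sup sub)) !mxrank_ker rMN leq_sub2l// kmax.
    by move/(submx_trans (introT sub_kermxP vMN)) => /sub_kermxP.
  by have := cd_curve cdc (hx j); rewrite mulmx_col_entry vM mxE.
have t2 : modulus (t / 2)%:C%C < t by rewrite modulus_real ger0_norm; lra.
have t00 : modulus (0 : C) < t by rewrite modulus0.
have feq : f (c (t / 2)%:C%C) = f (c 0).
  by apply/rowP => j; apply: (cd0_constant (f := fun w => f (c w) ord0 j)) t2 => w; exact: fc0.
have [cs1 Gc1 _] := GH _ (yt _ t2); have [cs0 Gc0 _] := GH _ (yt _ t00).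
have := finj _ _ (sD _ cs1) (sD _ cs0) feq; rewrite /c => /(congr1 G).
rewrite Gc1 Gc0 /y scale0r addr0 -[RHS]addr0 => /addrI/rowP/(_ i0).
rewrite !mxE !eqxx mulr1 => /(congr1 (@modulus R)).
rewrite modulus_real modulus0 ger0_norm; lra.
Qed.

End InjectiveRegular.

(** * Moebius maps of the disc and the polydisk *)

Section Moebius.
Variable R : realType.
Local Notation C := R[i].
Implicit Types (a w z : C) (r s t e : R).

(** With this sign the map takes 0 to [a], and its inverse is the map for [- a]. *)
Definition moebius a w : C := (w + a) / (1 + (a^*)%C * w).

Lemma modulus_conj a : modulus (a^*)%C = modulus a.
Proof. by case: a => x y; rewrite /modulus /= sqrrN. Qed.

Lemma conj_mul_modulus a : a * (a^*)%C = ((modulus a) ^+ 2)%:C%C.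
Proof. by rewrite sqr_modulus; case: a => x y; simpc; congr Complex; ring. Qed.

Lemma moebius_den a w : modulus a < 1 -> modulus w < 1 -> 1 + (a^*)%C * w != 0.
Proof.
move=> a1 w1; rewrite -modulus_gt0.
have := modulus_geB 1 (- ((a^*)%C * w)); rewrite opprK modulus1 modulusN modulusM modulus_conj.
have := modulus_ge0 a; have := modulus_ge0 w; nra.
Qed.

Lemma moebius_sqr a w : modulus (1 + (a^*)%C * w) ^+ 2 - modulus (w + a) ^+ 2 =
  (1 - modulus a ^+ 2) * (1 - modulus w ^+ 2).
Proof. by rewrite !sqr_modulus; case: a => p q; case: w => x y /=; ring. Qed.

Lemma moebius_lt1 a w : modulus a < 1 -> modulus w < 1 -> modulus (moebius a w) < 1.
Proof.
move=> a1 w1; have d0 := moebius_den a1 w1; rewrite -modulus_gt0 in d0.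
rewrite modulusM modulusV ltr_pdivrMr// mul1r.
rewrite -ltr_sqr ?nnegrE ?modulus_ge0// -subr_gt0 moebius_sqr.
have := modulus_ge0 a; have := modulus_ge0 w => w0 a0.
by rewrite mulr_gt0//; nra.
Qed.

Lemma moebius0 a : moebius a 0 = a.
Proof. by rewrite /moebius add0r mulr0 addr0 divr1. Qed.

Lemma moebiusK a w : modulus a < 1 -> modulus w < 1 -> moebius (- a) (moebius a w) = w.
Proof.
move=> a1 w1; have d0 := moebius_den a1 w1; rewrite /moebius rmorphN /=.
have aa : 1 - a * (a^*)%C != 0.
  rewrite conj_mul_modulus -modulus_gt0 -(rmorph1 (real_complex R)) -rmorphB modulus_real.
  by rewrite normr_gt0; have a0 := modulus_ge0 a; apply: lt0r_neq0; nra.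
set b := (a^*)%C in d0 aa *; field.
apply/andP; split => //.
by move: aa; congr (is_true (_ != 0)); ring.
Qed.

(** For given moduli the left factor on the right is least when conj(a) w = - |a| |w|: the
    difference of the squares is a nonnegative multiple of Re(conj(a) w) + |a| |w|. *)
Lemma moebius_lower a w : modulus a < 1 -> modulus w < 1 ->
  `|modulus a - modulus w| <= modulus (moebius a w) * (1 - modulus a * modulus w).
Proof.
move=> a1 w1; have d0 := moebius_den a1 w1; rewrite -modulus_gt0 in d0.
have a0 := modulus_ge0 a; have w0 := modulus_ge0 w.
have aw : 0 < 1 - modulus a * modulus w by nra.
rewrite modulusM modulusV mulrAC ler_pdivlMr//.
have tau : - (modulus a * modulus w) <= complex.Re ((a^*)%C * w).
  by have := modulus_Re ((a^*)%C * w); rewrite ler_norml modulusM modulus_conj => /andP[].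
have e1 : modulus (w + a) ^+ 2 = modulus a ^+ 2 + modulus w ^+ 2 + 2 * complex.Re ((a^*)%C * w).
  by rewrite !sqr_modulus; case: a {tau a1 a0 aw d0} => p q; case: w {w1 w0} => x y /=; ring.
have e2 : modulus (1 + (a^*)%C * w) ^+ 2 = 1 + modulus a ^+ 2 * modulus w ^+ 2 + 2 *
  complex.Re ((a^*)%C * w).
  by rewrite !sqr_modulus; case: a {tau a1 a0 aw d0 e1} => p q; case: w {w1 w0} => x y /=; ring.
rewrite -ler_sqr ?nnegrE ?mulr_ge0 ?modulus_ge0 ?(ltW aw)//.
rewrite !exprMn e1 e2 real_normK ?num_real//.
move: (modulus a) (modulus w) (complex.Re _) a0 w0 a1 w1 tau => A W T a0 w0 a1 w1 tau.
rewrite -subr_ge0.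
have -> : (A ^+ 2 + W ^+ 2 + 2 * T) * (1 - A * W) ^+ 2 - (A - W) ^+ 2 * (1 + A ^+ 2 * W ^+ 2 +
  2 * T)
  = 2 * (T + A * W) * ((1 - A ^+ 2) * (1 - W ^+ 2)) by ring.
have : 0 <= 1 - A ^+ 2 by nra.
have : 0 <= 1 - W ^+ 2 by nra.
by move=> ? ?; rewrite !mulr_ge0//; lra.
Qed.

Lemma cd_moebius a w : modulus a < 1 -> modulus w < 1 -> exists c, cd (moebius a) w c.
Proof.
move=> a1 w1; have h := cdD (cd_cst 1 w) (cdZ (a^*)%C (cd_id w)).
have [c hc] := @cdV R (fun z => 1 + (a^*)%C * z) w _ (moebius_den a1 w1) h.
by eexists; exact: cdM (cdD (cd_id w) (cd_cst a w)) hc.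
Qed.

(* Moving [p] to the center by a Moebius map. *)
Lemma identity_disk (g : C -> C) p : hold 1 g -> modulus p < 1 ->
  (forall e, 0 < e -> exists z, [/\ z != p, modulus (z - p) < e & g z = 0]) ->
  forall z, modulus z < 1 -> g z = 0.
Proof.
move=> hg p1 acc z z1.
have np1 : modulus (- p) < 1 by rewrite modulusN.
have h : hold 1 (g \o moebius p).
  move=> w w1; have [c hc] := cd_moebius p1 w1; have [b hb] := hg _ (moebius_lt1 p1 w1).
  by eexists; exact: cd_comp hc hb.
have mm : moebius p (moebius (- p) z) = z by rewrite -{1}(opprK p) moebiusK.
rewrite -mm; apply: (identity_center ltr01 h); last exact: moebius_lt1.
move=> e e0.
have [c hc] := cd_moebius np1 p1.
have [t t0 ht] := cd_continuous hc e0.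
have mp : moebius (- p) p = 0 by rewrite /moebius subrr mul0r.
have [|w [wp wt gw]] := acc (Num.min t (1 - modulus p)); first by rewrite lt_min t0; lra.
move: wt; rewrite lt_min => /andP[wt w1].
have {}w1 : modulus w < 1 by have := modulus_geB w p; lra.
have mw : moebius p (moebius (- p) w) = w by rewrite -{1}(opprK p) moebiusK.
exists (moebius (- p) w); split => /=.
- by apply: contra_neq wp => w0; rewrite -mw w0 moebius0.
- by have := ht w wt; rewrite mp subr0.
- by rewrite mw.
Qed.

End Moebius.

Section Polydisk.
Variable R : realType.
Local Notation C := R[i].
Variable n : nat.
Implicit Types (f : 'rV[C]_n -> C) (a b v x y : 'rV[C]_n) (r s t e : R).

Lemma polydiskP r x : 0 < r -> polydisk r x <-> vnorm x < r.
Proof.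
move=> r0; split => [h|h i]; first exact: vnorm_lt.
exact: le_lt_trans (modulus_le_vnorm x i) h.
Qed.

Lemma opens_polydisk : opens (polydisk 1 : set 'rV[C]_n).
Proof.
move=> x /polydiskP x1; exists (1 - vnorm x); first by have := x1 ltr01; lra.
move=> y; rewrite /bal /= => yx; apply/polydiskP => //.
by have := vnorm_tri y 0 x; rewrite !subr0; lra.
Qed.

Definition pmoebius b x : 'rV[C]_n := \row_i moebius (b ord0 i) (x ord0 i).

Lemma pmoebius_polydisk b x : polydisk 1 b -> polydisk 1 x -> polydisk 1 (pmoebius b x).
Proof. by move=> b1 x1 i; rewrite mxE; apply: moebius_lt1; [exact: b1|exact: x1]. Qed.

Lemma pmoebius0 b : pmoebius b 0 = b.
Proof. by apply/rowP => i; rewrite !mxE moebius0. Qed.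

Lemma pmoebiusK b x : polydisk 1 b -> polydisk 1 x -> pmoebius (- b) (pmoebius b x) = x.
Proof. by move=> b1 x1; apply/rowP => i; rewrite !mxE moebiusK. Qed.

Lemma polydiskN x r : polydisk r x -> polydisk r (- x).
Proof. by move=> h i; rewrite mxE modulusN; exact: h. Qed.

Lemma cd_pmoebius b v w : polydisk 1 b -> polydisk 1 (w *: v) ->
  exists u : 'rV[C]_n, forall j, cd (fun l => pmoebius b (l *: v) ord0 j) w (u ord0 j).
Proof.
move=> b1 v1; suff /choice[u hu] : forall j, exists c, cd (fun l => pmoebius b (l *: v) ord0
  j) w c.
  by exists (\row_j u j) => j; rewrite mxE.
move=> j; have v1j : modulus (w * v ord0 j) < 1 by have := v1 j; rewrite mxE.
have [c hc] := cd_moebius (b1 j) v1j.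
have := cd_comp (g := moebius (b ord0 j)) (cdZ (v ord0 j) (cd_id w)).
rewrite [v ord0 j * id w]mulrC => /(_ _ hc) h; eexists.
by apply: cd_eq ltr01 _ h => l _; rewrite /= !mxE mulrC.
Qed.

Lemma hold_disk f b v r : hol (polydisk 1) f -> polydisk 1 b ->
  (forall w, modulus w < r -> polydisk 1 (w *: v)) -> hold r (fun w => f (pmoebius b (w *: v))).
Proof.
move=> hf b1 v1 w wr; have [u hu] := cd_pmoebius b1 (v1 w wr).
have [L hL] := hf _ (pmoebius_polydisk b1 (v1 w wr)).
by eexists; exact: cd_curve hu hL.
Qed.

Lemma cd_curve_continuous (F : C -> 'rV[C]_n) z (u : 'rV[C]_n) :
  (forall j, cd (fun w => F w ord0 j) z (u ord0 j)) -> forall e, 0 < e ->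
  exists2 t, 0 < t & forall w, modulus (w - z) < t -> vnorm (F w - F z) < e.
Proof.
move=> hF e e0.
have /choice[t ht] : forall j, exists t, 0 < t /\ forall w, modulus (w - z) < t ->
    modulus (F w ord0 j - F z ord0 j) < e.
  by move=> j; have [t t0 h] := cd_continuous (hF j) e0; exists t.
exists (\big[Num.min/1]_j t j).
  by elim/big_ind : _ => // [p q p0 q0|j _]; [rewrite lt_min p0|have [] := ht j].
move=> w wt; apply: vnorm_lt => // j; have [_ h] := ht j; rewrite !mxE; apply: h.
by apply: lt_le_trans wt _; rewrite (bigD1 j)//= ge_min lexx.
Qed.

(** A holomorphic disc joins [b] to [x]: the Moebius image of the line spanned by [v], with [b] at
    parameter 0 and [x] at parameter 1. Zeros near parameter 0 propagate along it. *)
Lemma identity_polydisk f b e : hol (polydisk 1) f -> polydisk 1 b -> 0 < e ->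
  (forall x, bal b e x -> f x = 0) -> forall x, polydisk 1 x -> f x = 0.
Proof.
move=> hf b1 e0 fb x x1; pose v := pmoebius (- b) x.
have v1 : vnorm v < 1.
  by apply/polydiskP => //; apply: pmoebius_polydisk => //; exact: polydiskN.
have xv : pmoebius b (1 *: v) = x.
  by rewrite scale1r /v -{1}(opprK b) pmoebiusK//; exact: polydiskN.
(* This radius exceeds 1, so the disc reaches [x], and r |v| < 1 keeps it inside the polydisk. *)
have v0 := vnorm_ge0 v; pose r := 2 / (1 + vnorm v).
have r1 : 1 < r by rewrite ltr_pdivlMr; lra.
have rv w : modulus w < r -> polydisk 1 (w *: v).
  rewrite /r ltr_pdivlMr => [wr|]; last lra.
  apply/polydiskP => //; rewrite vnormZ; have := modulus_ge0 w; nra.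
have h := hold_disk hf b1 rv; rewrite -xv.
apply: (identity_center (r := r)) h _ _ _; [lra| |by rewrite modulus1].
move=> d d0.
have [|u hu] := @cd_pmoebius b v 0 b1; first by apply: rv; rewrite modulus0; lra.
have [t t0 ht] := cd_curve_continuous hu e0.
pose l := Num.min t d / 2.
have m0 : 0 < Num.min t d by rewrite lt_min t0.
have mt : Num.min t d <= t by rewrite ge_min lexx.
have md : Num.min t d <= d by rewrite ge_min lexx orbT.
have ml : modulus l%:C%C = l by rewrite modulus_real ger0_norm// /l; lra.
exists l%:C%C; split.
- by rewrite -modulus_gt0 ml /l; lra.
- by rewrite ml /l; lra.
- apply: fb; have := ht l%:C%C; rewrite subr0 ml scale0r pmoebius0; apply.
  by rewrite /l; lra.
Qed.

Definition upd x (i : 'I_n) (c : C) : 'rV[C]_n := \row_j (if j == i then c else x ord0 j).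

Lemma updE x i c : upd x i c = upd x i 0 + c *: delta_mx ord0 i.
Proof.
apply/rowP => j; rewrite !mxE eqxx /=; case: eqP => _; first by rewrite add0r mulr1.
by rewrite mulr0 addr0.
Qed.

Lemma upd_id x i : upd x i (x ord0 i) = x.
Proof. by apply/rowP => j; rewrite !mxE; case: eqP => [->|]. Qed.

Lemma cd_upd f x i c L : sd f (upd x i c) L -> cd (fun w => f (upd x i w)) c (L i ord0).
Proof.
rewrite updE => /cd_line; rewrite delta_mulmx; congr cd; apply/funext => w.
by rewrite [in RHS]updE.
Qed.

Lemma upd_lt x i c r : vnorm x < r -> modulus c < r -> vnorm (upd x i c) < r.
Proof.
move=> xr cr; have r0 : 0 < r by apply: le_lt_trans xr; exact: vnorm_ge0.
apply: vnorm_lt => // j; rewrite mxE; case: eqP => // _.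
exact: le_lt_trans (modulus_le_vnorm x j) xr.
Qed.

End Polydisk.

(** * The Jacobian near the inner sphere *)

Section BoundaryNotCovered.
Variable R : realType.
Local Notation C := R[i].

Section HolomorphicDeterminant.
Variable n : nat.
Implicit Types (D : set 'rV[C]_n).

Lemma holM D f g : hol D f -> hol D g -> hol D (fun x => f x * g x).
Proof. by move=> hf hg x Dx; have [L hL] := hf x Dx; have [M hM] := hg x Dx; eexists;
  exact: sdM hL hM. Qed.

Lemma holD D f g : hol D f -> hol D g -> hol D (fun x => f x + g x).
Proof. by move=> hf hg x Dx; have [L hL] := hf x Dx; have [M hM] := hg x Dx; eexists;
  exact: sdD hL hM. Qed.

Lemma hol_cst D c : hol D (fun=> c).
Proof. by move=> x _; exists 0; exact: sd_cst. Qed.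

Lemma hol_sum D (I : Type) (s : seq I) (f : I -> 'rV[C]_n -> C) :
  (forall i, hol D (f i)) -> hol D (fun x => \sum_(i <- s) f i x).
Proof.
move=> hf; elim: s => [|i s IH].
  by rewrite (_ : (fun _ => _) = fun=> 0); [exact: hol_cst|apply/funext => x; rewrite big_nil].
rewrite (_ : (fun _ => _) = fun x => f i x + \sum_(j <- s) f j x); first exact: holD.
by apply/funext => x; rewrite big_cons.
Qed.

Lemma hol_prod D (I : Type) (s : seq I) (f : I -> 'rV[C]_n -> C) :
  (forall i, hol D (f i)) -> hol D (fun x => \prod_(i <- s) f i x).
Proof.
move=> hf; elim: s => [|i s IH].
  by rewrite (_ : (fun _ => _) = fun=> 1); [exact: hol_cst|apply/funext => x; rewrite big_nil].
rewrite (_ : (fun _ => _) = fun x => f i x * \prod_(j <- s) f j x); first exact: holM.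
by apply/funext => x; rewrite big_cons.
Qed.

Lemma hol_det D m (M : 'rV[C]_n -> 'M[C]_m) :
  (forall i j, hol D (fun x => M x i j)) -> hol D (fun x => \det (M x)).
Proof.
move=> hM; apply: hol_sum => s; apply: holM; last by apply: hol_prod => i; exact: hM.
exact: hol_cst.
Qed.

Lemma hol_jacobian D (F : 'rV[C]_n -> 'rV[C]_n) (DF : 'rV[C]_n -> 'M[C]_n) :
  opens D -> (forall x, D x -> vsd F x (DF x)) -> hol D (fun x => \det (DF x)).
Proof.
move=> Dop hF; apply: hol_det => i j x Dx; have [r r0 rD] := Dop x Dx.
have := @partial_derivative R n (fun y => F y ord0 j) (fun y => col j (DF y)) x r i r0
  (fun y yr => hF y (rD y yr) j).
by rewrite (_ : (fun _ => _) = fun y => DF y i j)//; apply/funext => y; rewrite mxE.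
Qed.

End HolomorphicDeterminant.

Variable n : nat.
Local Notation V := 'rV[C]_n.+1.
Implicit Types (x w u : V) (r d e : R).

(** The quotient of 1 + i t by its conjugate, for small t > 0. *)
Lemma rotation e : 0 < e -> exists u : C, [/\ modulus u = 1, u != 1 & modulus (u - 1) < e].
Proof.
move=> e0; pose t := Num.min 1 (e / 4).
have t0 : 0 < t by rewrite lt_min ltr01 divr_gt0.
have te : t <= e / 4 by rewrite ge_min lexx orbT.
clearbody t; pose p : C := Complex 1 t; pose q : C := Complex 1 (- t).
have q1 : 1 <= modulus q by have := modulus_Re q; rewrite /= normr1.
have q0 : q != 0 by rewrite -modulus_gt0; lra.
have pq : modulus p = modulus q by rewrite /modulus /= sqrrN.
have d2 : modulus (p - q) = 2 * t.
  rewrite (_ : p - q = 'i%C * (2 * t)%:C%C); last by rewrite /p /q; simpc; congr Complex; ring.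
  by rewrite modulusM modulus_i mul1r modulus_real ger0_norm//; lra.
have e1 : p / q - 1 = (p - q) / q by field.
exists (p / q); split.
- by rewrite modulusM modulusV pq divff//; apply/eqP; lra.
- by rewrite -subr_eq0 -modulus_gt0 e1 modulusM modulusV d2 divr_gt0//; lra.
- by rewrite e1 modulusM modulusV d2 ltr_pdivrMr; nra.
Qed.

(** If coordinate [i] has modulus [r] and the others at most [r], rotating coordinate [i] stays on
    the sphere. On such a circle the zeros of [J] accumulate at [w ord0 i], so [J] vanishes on the
    whole disc in coordinate [i]. This holds for all values of the other coordinates near those of
    [b], hence on a ball, hence everywhere. *)
Lemma vanish_near_sphere (J : V -> C) w r d : hol (polydisk 1) J -> 0 < r -> r < 1 ->
  vnorm w = r -> 0 < d -> (forall x, vnorm x = r -> vnorm (x - w) < d -> J x = 0) ->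
  forall x, polydisk 1 x -> J x = 0.
Proof.
move=> hJ r0 r1 wr d0 hz; have [i wi] := vnorm_attained w.
rewrite wr in wi.
pose k := Num.min (1 / 2) (d / 4).
have k0 : 0 < k by rewrite lt_min !divr_gt0.
have k1 : k <= 1 / 2 by rewrite ge_min lexx.
have kd : k <= d / 4 by rewrite ge_min lexx orbT.
clearbody k.
(* The first bound keeps the other coordinates of a point near [b] at most (1 - k) r + k r = r, the
   second keeps coordinate [i] below 1. *)
pose e := Num.min (k * r) (1 - r).
have e0 : 0 < e by rewrite lt_min mulr_gt0//=; lra.
have ek : e <= k * r by rewrite ge_min lexx.
have e1 : e <= 1 - r by rewrite ge_min lexx orbT.
clearbody e.
(* All coordinates except [i] are pulled inward, which leaves room to vary them. *)
pose b := upd ((1 - k)%:C%C *: w) i (w ord0 i).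
have kr : k * r < k by rewrite gtr_pMr.
have mk : modulus (1 - k)%:C%C = 1 - k by rewrite modulus_real ger0_norm//; lra.
have bj j : j != i -> modulus (b ord0 j) <= (1 - k) * r.
  move=> ji; rewrite mxE (negbTE ji) mxE modulusM mk ler_wpM2l//; first lra.
  by rewrite -wr modulus_le_vnorm.
have bw : vnorm (b - w) <= k * r.
  apply: vnorm_le => [|j]; first by rewrite mulr_ge0 ?ltW.
  rewrite !mxE; case: eqP => [->|_]; first by rewrite subrr modulus0 mulr_ge0// ltW.
  rewrite -{2}[w ord0 j]mul1r -mulrBl -(rmorph1 (real_complex R)) -rmorphB modulusM modulus_real.
  rewrite (_ : 1 - k - 1 = - k); last by ring.
  by rewrite normrN ger0_norm ?(ltW k0)// ler_pM2l// -wr modulus_le_vnorm.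
have b1 : polydisk 1 b.
  apply/polydiskP => //; apply: (@le_lt_trans _ _ r) => //.
  apply: vnorm_le => [|j]; first exact: ltW.
  have [->|/bj h] := eqVneq j i; first by rewrite mxE eqxx -wi.
  by apply: le_trans h _; rewrite ler_piMl//; lra.
have bi : b ord0 i = w ord0 i by rewrite mxE eqxx.
clearbody b.
apply: (identity_polydisk hJ b1 e0) => x; rewrite /bal /= => xb.
have xbj j : modulus (x ord0 j) - modulus (b ord0 j) <= vnorm (x - b).
  apply: le_trans (modulus_geB _ _) _.
  by have := modulus_le_vnorm (x - b) j; rewrite !mxE.
have xj j : j != i -> modulus (x ord0 j) <= r.
  by move=> /bj; have := xbj j; lra.
have xi : modulus (x ord0 i) < 1 by have := xbj i; rewrite bi -wi; lra.
have u1 c : modulus c < 1 -> polydisk 1 (upd x i c).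
  by move=> c1 j; rewrite mxE; case: eqP => // /eqP /xj; lra.
rewrite -(upd_id x i).
apply: (@identity_disk R (fun c => J (upd x i c)) (w ord0 i)) => //; last 1 first.
  move=> t t0; have [|v [v1 vn1 vt]] := @rotation (Num.min t (d / 2)).
    by rewrite lt_min t0 divr_gt0.
  have vw : modulus (w ord0 i * v - w ord0 i) < Num.min t (d / 2).
    rewrite -{2}[w ord0 i]mulr1 -mulrBr modulusM -wi; apply: le_lt_trans vt.
    by rewrite ler_piMl ?modulus_ge0// ltW.
  move: vw; rewrite lt_min => /andP[vw1 vw2].
  exists (w ord0 i * v); split => //.
    have w0 : w ord0 i != 0 by rewrite -modulus_gt0 -wi.
    by apply: contra_neq vn1 => h; apply: (mulfI w0); rewrite h mulr1.
  apply: hz.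
    apply/eqP; rewrite eq_le; apply/andP; split.
      apply: vnorm_le => [|j]; first exact: ltW.
      by rewrite mxE; case: eqP => [_|/eqP/xj//]; rewrite modulusM -wi v1 mulr1.
    have := modulus_le_vnorm (upd x i (w ord0 i * v)) i.
    by rewrite mxE eqxx modulusM -wi v1 mulr1.
  apply: vnorm_lt => // j; rewrite !mxE; case: eqP => [->|_]; first lra.
  have := modulus_le_vnorm (x - w) j; rewrite !mxE; have := vnorm_tri x w b; lra.
- by move=> c /u1/hJ[L hL]; eexists; exact: cd_upd hL.
- by rewrite -wi.
Qed.

(* If F(w') = F(u) with the Jacobian nonzero at w', then the local inverse of [F]
   at w' composed with [F] near u takes its values in the closed polydisk of
   radius [r], by injectivity, and sends u to its boundary; the maximum principle
   then makes one component constant, so the Jacobian vanishes near u. *)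
Theorem boundary_not_covered (F : V -> V) w r d : 0 < r -> r < 1 ->
  vhol (polydisk 1) F ->
  (forall x y, r < vnorm x < 1 -> r < vnorm y < 1 -> F x = F y -> x = y) ->
  vnorm w = r -> 0 < d ->
  (forall x, vnorm (x - w) < d -> exists u, r < vnorm u < 1 /\ F u = F x) -> False.
Proof.
move=> r0 r1 hF Finj wr d0 cover.
have /choice[DF hDF] : forall x, exists A, polydisk 1 x -> vsd F x A.
  move=> x; have [/hF[A hA]|nx] := pselect (polydisk 1 x); first by exists A.
  by exists 0.
pose J x := \det (DF x).
have hJ : hol (polydisk 1) J by apply: (hol_jacobian (F := F)) => //; exact: opens_polydisk.
pose D : set V := [set x | r < vnorm x < 1].
have DP x : D x -> polydisk 1 x by move=> /andP[_ ?]; apply/polydiskP.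
have Dop : opens D.
  move=> x /andP[x1 x2]; exists (Num.min (vnorm x - r) (1 - vnorm x)).
    by rewrite lt_min; lra.
  move=> y; rewrite /bal /= lt_min => /andP[y1 y2].
  have := vnorm_tri x 0 y; have := vnorm_tri y 0 x; rewrite !subr0 (vnorm_subC x y).
  by rewrite /D /=; lra.
have [|u0 [Du0 _]] := cover w; first by rewrite subrr vnorm0.
have hFD : vhol D F by move=> x /DP/hF.
have [a [A [Da hA Au]]] := injective_regular Dop hFD Du0 Finj.
have Ja : J a != 0.
  by rewrite /J (vsd_uniq (hDF a (DP a Da)) hA) -unitfE -unitmxE.
have [w' [w'r w'd Jw']] : exists x, [/\ vnorm x = r, vnorm (x - w) < d & J x != 0].
  apply: contrapT => nex; move/eqP: Ja; apply.
  apply: (vanish_near_sphere hJ r0 r1 wr d0) (DP a Da) => x xr xd.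
  by apply/eqP; apply: contrapT => /negP Jx; apply: nex; exists x.
have [u [Du Fu]] := cover w' w'd.
have w'P x : bal w' (1 - r) x -> polydisk 1 x.
  rewrite /bal /= => h; apply/polydiskP => //.
  by have := vnorm_tri x 0 w'; rewrite !subr0; lra.
have w'1 : polydisk 1 w' by apply/polydiskP => //; rewrite w'r.
have Uw' : DF w' \in unitmx by rewrite unitmxE unitfE.
have r1' : 0 < 1 - r by lra.
(* Half this distance bounds both the ball of the local inverse around [w'] and the neighborhood of
   [u], so that the two are disjoint. *)
pose q := vnorm (u - w').
have q0 : 0 < q.
  apply: vnorm_gt0; rewrite subr_eq0; apply/eqP => uw'.
  by move: Du; rewrite /D /= uw' w'r ltxx.
have q20 : 0 < q / 2 by lra.
have hFw' : vhol (bal w' (1 - r)) F by move=> x /w'P/hF.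
have [s [t [H [[/andP[s0 sq] sr] t0 inj _ HP]]]] := inverse_function r1' hFw' (hDF w' w'1) Uw'
  q20.
have [c c0 cD] := Dop u Du.
have [c1 c10 hc1] := vsd_continuous (hDF u (DP u Du)) t0.
pose m := Num.min (Num.min c c1) (q / 2).
have m0 : 0 < m by rewrite !lt_min c0 c10.
have mP x : bal u m x -> [/\ D x, bal (F w') t (F x) & vnorm (x - u) < q / 2].
  rewrite /bal /= !lt_min => /andP[/andP[x1 x2] x3]; split => //; first exact: cD.
  by rewrite -Fu; exact: hc1.
pose h x := H (F x).
(* If [h x] lay in the shell, injectivity would give [h x = x], a point both near [w'] and near
   [u]. *)
have hP x : bal u m x -> vnorm (h x) <= r.
  move=> /mP[Dx Fx xq]; have [hs Fh _] := HP _ Fx.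
  rewrite leNgt; apply/negP => hr.
  have h1 : vnorm (h x) < 1.
    by have := vnorm_tri (h x) 0 w'; rewrite !subr0; move: hs; rewrite /bal /= -/(h x); lra.
  have hx : h x = x by apply: Finj => //; apply/andP.
  have := vnorm_tri u w' x; rewrite (vnorm_subC u x) -{2}hx -/q.
  by move: hs; rewrite /bal /= -/(h x); lra.
have hu : h u = w'.
  have [hs Fh _] := HP _ (let: And3 _ p _ := mP u (bal_center u m0) in p).
  by apply: inj => //; [exact: bal_center|rewrite Fh].
have hdiff x : bal u m x -> exists B, vsd h x B.
  move=> /mP[Dx Fx _]; have [_ _ [B hB]] := HP _ Fx.
  by eexists; exact: vsd_comp (hDF x (DP x Dx)) hB.
have [i wi] := vnorm_attained w'; rewrite w'r in wi.
(* Coordinate [i] of [h] is bounded by [r] and attains this modulus at [u]; [strong_max] is applied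
   on the complex line through [u] and [x], at parameter 1. *)
have hconst x : bal u (m / 8) x -> h x ord0 i = w' ord0 i.
  rewrite /bal /= => xu; have [->|xnu] := eqVneq x u; first by rewrite hu.
  have v0 : 0 < vnorm (x - u) by apply: vnorm_gt0; rewrite subr_eq0.
  have hh : hol (bal u m) (fun x => h x ord0 i).
    by move=> y /hdiff[B hB]; exists (col i B).
  have sl : hold (m / vnorm (x - u)) (fun l => h (u + l *: (x - u)) ord0 i).
    by apply: hold_slice hh _; rewrite divfK//; apply/eqP; lra.
  have := strong_max (M := r) (z := 1) sl; rewrite scale1r scale0r addr0 hu [u + _]addrC subrK.
  apply => //.
  - move=> l lm; apply: le_trans (modulus_le_vnorm _ i) _; apply: hP.
    by rewrite /bal /= addrAC subrr add0r vnormZ -ltr_pdivlMr.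
  - by rewrite modulus1 mulrAC ltr_pdivlMr// mul1r.
have Jzero x : bal u (m / 8) x -> J x = 0.
  move=> xu; have xm : bal u m x by move: xu; rewrite /bal /=; lra.
  have [Dx Fx _] := mP x xm; have [hs Fh _] := HP _ Fx.
  have [B hB] := hdiff x xm.
  have xu0 : 0 < m / 8 - vnorm (x - u) by move: xu; rewrite /bal /=; lra.
  have inner y : vnorm (y - x) < m / 8 - vnorm (x - u) -> bal u (m / 8) y.
    by rewrite /bal /= => yx; have := vnorm_tri y u x; lra.
  have Bi : col i B = 0.
    apply: sd_uniq (hB i) _.
    by apply: sd_eq xu0 _ (sd_cst (w' ord0 i) x) => y /inner /hconst.
  have hx1 : polydisk 1 (h x).
    by apply: w'P; move: hs; rewrite /bal /=; lra.
  (* Near [x] the map [F] equals [F] after [h]; the zero column of [B] makes the product of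
     differentials singular. *)
  have chain : DF x = B *m DF (h x).
    apply: vsd_uniq (hDF x (DP x Dx)) _ => j.
    apply: sd_eq xu0 _ (vsd_comp hB (hDF _ hx1) j) => y /inner yu /=.
    have ym : bal u m y by move: yu; rewrite /bal /=; lra.
    by have [_ Fy _] := mP y ym; have [_ -> _] := HP _ Fy.
  apply/eqP; apply: contraT; rewrite -unitfE -unitmxE chain unitmx_mul => /andP[Bu _].
  have : delta_mx i ord0 = invmx B *m col i B :> 'cV_n.+1 by rewrite colE mulKmx.
  rewrite Bi mulmx0 => /colP/(_ i); rewrite !mxE !eqxx => /eqP.
  by rewrite oner_eq0.
have m8 : 0 < m / 8 by rewrite divr_gt0.
by move/eqP: Jw'; apply; apply: identity_polydisk hJ (DP u Du) m8 Jzero _ w'1.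
Qed.

End BoundaryNotCovered.

(** * Hartogs extension across the inner polydisk *)

Section Hartogs.
Variable R : realType.
Local Notation C := R[i].

(** A trapezoid sum is finite, so holomorphic dependence on a parameter passes to it by the sum
    rule; the limit over [m] is left to [weierstrass]. *)
Lemma sd_av n (g : 'rV[C]_n -> C -> C) a m p d :
  (forall s : R, 0 <= s <= 1 -> exists L, sd (fun x => g x (p + s%:C%C * d)) a L) ->
  exists L, sd (fun x => av m (g x) p d) a L.
Proof.
elim: m p d => [|m IH] p d hg.
  have [|L hL] := hg 0; first lra.
  have [|M hM] := hg 1; first lra.
  move: hL hM; rewrite mul0r mul1r addr0 => hL hM; exists (2^-1 *: (L + M)).
  have := sdZ 2^-1 (sdD hL hM); congr (sd _ a _); apply/funext => x /=.
  by rewrite mulrC.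
have e (s : R) : (s / 2)%:C%C = s%:C%C / 2 :> C by rewrite rmorphM fmorphV rmorph_nat.
have e1 (s : R) : ((s + 1) / 2)%:C%C = s%:C%C / 2 + 2^-1 :> C.
  by rewrite e rmorphD rmorph1 mulrDl mul1r.
have [s s01|L hL] := IH p (d / 2).
  have -> : p + s%:C%C * (d / 2) = p + (s / 2)%:C%C * d by rewrite e; ring.
  by apply: hg; lra.
have [s s01|M hM] := IH (p + d / 2) (d / 2).
  have -> : p + d / 2 + s%:C%C * (d / 2) = p + ((s + 1) / 2)%:C%C * d by rewrite e1; ring.
  by apply: hg; lra.
exists (2^-1 *: (L + M)); have := sdZ 2^-1 (sdD hL hM).
by congr (sd _ a _); apply/funext => x /=; rewrite mulrC.
Qed.

Lemma vsd_upd n (a : 'rV[C]_n) i c : exists A, vsd (fun x => upd x i c) a A.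
Proof.
apply: vsd_of_coord => j.
rewrite (_ : (fun w => (upd w i c) ord0 j) = fun w : 'rV[C]_n => if j == i then c else w ord0
  j); last first.
  by apply/funext => w; rewrite mxE.
by case: (j == i); [exists 0; exact: sd_cst|eexists; exact: sd_coord].
Qed.

Variable n : nat.
Local Notation V := 'rV[C]_n.+2.
Implicit Types (f : V -> C) (x y : V).

(* The extension across the inner polydisk is the Cauchy integral in the first
   variable; the second variable is used to move the discs off that polydisk. *)
Theorem hartogs (f : V -> C) (r M : R) : 0 < r -> r < 1 ->
  hol [set x | r < vnorm x < 1] f -> (forall x, r < vnorm x < 1 -> modulus (f x) <= M) ->
  exists2 F, hol (polydisk 1) F & forall x, r < vnorm x < 1 -> F x = f x.
Proof.
move=> r0 r1 hf fM; pose t := (1 + r) / 2.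
have rt : r < t by rewrite /t; lra.
have t1 : t < 1 by rewrite /t; lra.
have t0 : 0 < t by lra.
have et : expR (ln t) = t by rewrite lnK.
clearbody t; set x0 := ln t in et.
pose i0 : 'I_n.+2 := ord0; pose i1 : 'I_n.+2 := lift ord0 ord0.
have i10 : i1 != i0 by [].
(* For points of [U] the first coordinate is inside the circle of radius [t], and this circle lies
   in the shell whatever the other coordinates are, since r < t < 1. *)
pose U x := vnorm x < 1 /\ modulus (x ord0 i0) < t.
have inD x i c : vnorm x < 1 -> r < modulus c < 1 -> r < vnorm (upd x i c) < 1.
  move=> x1 /andP[rc c1]; rewrite upd_lt// andbT.
  by apply: lt_le_trans (modulus_le_vnorm _ i); rewrite mxE eqxx.
have nz x (w : C) : U x -> modulus w = t -> w != x ord0 i0.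
  by move=> [_ xt] wt; apply/eqP => wx; move: xt; rewrite -wx wt ltxx.
have slice x i c : vnorm x < 1 -> modulus c < 1 -> r < vnorm (upd x i c) ->
    exists b, cd (fun w => f (upd x i w)) c b.
  move=> x1 c1 rc; have [|L hL] := hf (upd x i c); last by eexists; exact: cd_upd hL.
  by rewrite /= rc upd_lt.
pose K x w := f (upd x i0 w) * (w / (w - x ord0 i0)).
have /choice[Fh hFh] : forall x, exists l, U x -> cmean (K x) x0 l.
  move=> x; have [Ux|nUx] := pselect (U x); last by exists 0.
  have [w wt|l hl] := @cmean_exists R (K x) x0; last by exists l.
  rewrite et in wt; have [b hb] := cd_geometric (nz x w Ux wt).
  have [|||c hc] := slice x i0 w; [exact: Ux.1|by rewrite wt| |].
    have /andP[//] : r < vnorm (upd x i0 w) < 1.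
    by apply: inD; [exact: Ux.1|rewrite wt rt].
  exact: cd_ctn (cdM hc hb).
have M0 : 0 <= M.
  have := fM (upd 0 i0 t%:C%C); have := inD 0 i0 t%:C%C;
    rewrite vnorm0 modulus_real ger0_norm ?(ltW t0)//.
  by rewrite rt t1 => /(_ ltr01 isT) h /(_ h); apply: le_trans; exact: modulus_ge0.
have ballU x : U x -> exists2 s, 0 < s & forall y, bal x s y -> U y /\ modulus (y ord0 i0) < t
  - s.
  move=> [x1 xt]; pose s := Num.min (1 - vnorm x) (t - modulus (x ord0 i0)) / 2.
  have s0 : 0 < Num.min (1 - vnorm x) (t - modulus (x ord0 i0)) by rewrite lt_min; lra.
  have s1 : Num.min (1 - vnorm x) (t - modulus (x ord0 i0)) <= 1 - vnorm x by rewrite ge_min lexx.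
  have s2 : Num.min (1 - vnorm x) (t - modulus (x ord0 i0)) <= t - modulus (x ord0 i0).
    by rewrite ge_min lexx orbT.
  exists s; rewrite ?divr_gt0// => y; rewrite /bal /= /s => yx.
  have := vnorm_tri y 0 x; rewrite !subr0 => y1.
  have := modulus_le_vnorm (y - x) i0; rewrite !mxE => y2.
  have := modulus_geB (y ord0 i0) (x ord0 i0) => y3.
  by split; [split|]; lra.
have Fh_hol x : U x -> exists L, sd Fh x L.
  move=> Ux; have [s s0 sU] := ballU x Ux.
  apply: (weierstrass (G := fun m y => circ m (K y) x0) (s := s) (M := M * (t / s))) => //.
  - move=> m y /sU[Uy _]; apply: sd_av => l l01 /=.
    set w := cexp _; have wt : modulus w = t by rewrite modulus_cexp; simpc; rewrite /= et.
    have [A hA] := vsd_upd y i0 w.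
    have [|L hL] := hf (upd y i0 w); first by apply: inD; [exact: Uy.1|rewrite wt rt].
    have h1 := sd_comp hA hL.
    have [c hc] := @cdV R (fun v => w - v) (y ord0 i0) _
      (ltac:(by rewrite subr_eq0; apply: nz)) (cdB (cd_cst w _) (cd_id _)).
    have h2 := sd_comp1 (sd_coord i0 y) hc.
    by eexists; exact: sdM h1 (sdZ w h2).
  - move=> m y /sU[Uy yt]; apply: circ_le => w; rewrite et => wt.
    rewrite modulusM; apply: ler_pM; rewrite ?modulus_ge0//.
      by apply: fM; apply: inD; [exact: Uy.1|rewrite wt rt].
    rewrite modulusM modulusV wt ler_pM2l// lef_pV2 ?posrE//;
      have := modulus_geB w (y ord0 i0); lra.
  - by move=> y /sU[Uy _]; exact: hFh.
(* Another coordinate beyond [r] keeps the whole disc of the first coordinate in the shell, so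
   Cauchy's formula returns [f x]. *)
have caseA x j : U x -> j != i0 -> r < modulus (x ord0 j) -> Fh x = f x.
  move=> Ux ji rj; have xt : modulus (x ord0 i0) < expR x0 by rewrite et; exact: Ux.2.
  have t1' : expR x0 < 1 by rewrite et.
  have := cauchy_formula (f := fun w => f (upd x i0 w)) t1' xt; rewrite upd_id => h.
  apply: tends_uniq (hFh x Ux) (h _) => w w1; apply: slice => //; first exact: Ux.1.
  by apply: lt_le_trans (modulus_le_vnorm _ j); rewrite mxE (negbTE ji).
(* If the first coordinate exceeds [r] and the second does not, the whole disc in the second
   coordinate lies in the shell; on its circle of radius [t] the two functions agree by [caseA],
   hence inside by the maximum principle. *)
have agree x : U x -> r < vnorm x < 1 -> Fh x = f x.
  move=> Ux /andP[rx x1]; have [j xj] := vnorm_attained x; rewrite xj in rx.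
  have [ji|ji] := eqVneq j i0; last exact: (caseA x j).
  rewrite {}ji in xj rx.
  have [r1x|xr] := ltP r (modulus (x ord0 i1)); first exact: (caseA x i1).
  pose g w := Fh (upd x i1 w) - f (upd x i1 w).
  have ui0 w : (upd x i1 w) ord0 i0 = x ord0 i0 by rewrite mxE.
  have Uu w : modulus w < 1 -> U (upd x i1 w).
    by move=> w1; split; [exact: upd_lt|rewrite ui0; exact: Ux.2].
  have hg : hold 1 g.
    move=> w w1; have [L hL] := Fh_hol _ (Uu w w1).
    have [|||c hc] := slice x i1 w => //.
      by apply: lt_le_trans (modulus_le_vnorm _ i0); rewrite ui0.
    by eexists; exact: cdB (cd_upd hL) hc.
  have : modulus (g (x ord0 i1)) <= 0.
    apply: (max_principle (f := g) t1 _ hg) => [|w wt]; first lra.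
    rewrite /g (caseA _ i1) ?subrr ?modulus0//; first by apply: Uu; rewrite wt.
    by rewrite mxE eqxx wt.
  rewrite /g upd_id => h; apply/eqP; rewrite -subr_eq0 -modulus_eq0 eq_le h.
  exact: modulus_ge0.
(* [Fh] is controlled on [U] only, but [U] contains the closed inner polydisk, and the rest of the
   polydisk is shell. *)
pose F x := if r < vnorm x < 1 then f x else Fh x.
exists F; last by move=> x xD; rewrite /F xD.
move=> x /polydiskP x1; have {}x1 := x1 ltr01.
have [xD|xD] := boolP (r < vnorm x < 1).
  have [L hL] := hf x xD; exists L.
  have d0 : 0 < Num.min (vnorm x - r) (1 - vnorm x) by rewrite lt_min; lra.
  apply: sd_eq d0 _ hL => y; rewrite lt_min => /andP[y1 y2].
  have := vnorm_tri x 0 y; have := vnorm_tri y 0 x; rewrite !subr0 (vnorm_subC x y) => k1 k2.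
  rewrite /F ifT//; lra.
have xr : vnorm x <= r by rewrite x1 andbT -leNgt in xD.
have Ux : U x by split => //; have := modulus_le_vnorm x i0; lra.
have [s s0 sU] := ballU x Ux; have [L hL] := Fh_hol x Ux; exists L.
apply: sd_eq s0 _ hL => y /sU[Uy _]; rewrite /F; case: ifP => // yD.
exact: agree.
Qed.

End Hartogs.

(** * Schwarz's lemma with a bound on the shell *)

Section SchwarzPolydisk.
Variable R : realType.
Local Notation C := R[i].
Variable n : nat.
Local Notation V := 'rV[C]_n.+1.

(** The disc through [z] may enter the inner polydisk, where no bound on [F] is given; near its rim
    it runs in the shell, and Schwarz asks for a bound on circles only. Radii tending to 1 give the
    bound [s]. *)
Lemma schwarz_polydisk (F : V -> C) (z v : V) (r s : R) : 0 < r -> r < 1 ->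
  hol (polydisk 1) F -> (forall x, r < vnorm x < 1 -> modulus (F x) <= 1) ->
  polydisk 1 z -> F z = 0 -> vnorm v = 1 -> 0 <= s < 1 ->
  modulus (F (pmoebius z (s%:C%C *: v))) <= s.
Proof.
move=> r0 r1 hF FM z1 Fz v1 /andP[s0 s1].
pose phi w := F (pmoebius z (w *: v)).
have wv w : modulus w < 1 -> polydisk 1 (w *: v).
  by move=> w1; apply/polydiskP => //; rewrite vnormZ v1 mulr1.
have hphi : hold 1 phi by exact: hold_disk.
have phi0 : phi 0 = 0 by rewrite /phi scale0r pmoebius0.
have [i vi] := vnorm_attained v; rewrite v1 in vi.
have a0 := modulus_ge0 (z ord0 i); have a1 := z1 i; set a := modulus (z ord0 i) in a0 a1 *.
(* By [moebius_lower], coordinate [i] of the disc exceeds [r] in modulus once (t - a) / (1 - a t) >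
   r, that is, once t > t1. *)
pose t1 := (r + a) / (1 + r * a).
have ra : 0 <= r * a by rewrite mulr_ge0// ltW.
have t11 : t1 < 1 by rewrite ltr_pdivrMr; nra.
have t10 : 0 < t1 by rewrite divr_gt0; nra.
have bnd t w : t1 < t -> t < 1 -> modulus w = t -> modulus (phi w) <= 1.
  move=> tt t1' wt; have w1 : modulus w < 1 by rewrite wt.
  apply: FM; apply/andP; split; last first.
    by apply/polydiskP => //; apply: pmoebius_polydisk => //; exact: wv.
  apply: lt_le_trans (modulus_le_vnorm _ i); rewrite mxE.
  have := @moebius_lower R (z ord0 i) ((w *: v) ord0 i) a1 (wv w w1 i).
  rewrite mxE modulusM -vi mulr1 wt -/a => h.
  have h2 := le_trans (ler_norm (t - a)) (eq_ind _ (fun y => y <= _) h _ (distrC _ _)).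
  have at1 : 0 < 1 - a * t by nra.
  have : r * (1 - a * t) < t - a.
    by move: tt; rewrite /t1 ltr_pdivrMr; nra.
  move=> h3; have := lt_le_trans h3 h2; rewrite ltr_pM2r//.
rewrite -/(phi _) leNgt; apply/negP => sphi; set p := modulus (phi _) in sphi.
have p0 : 0 < p by lra.
(* A circle of radius t > s / p contradicts the Schwarz bound p <= s / t. *)
pose u := Num.max (Num.max t1 s) (s / p).
have u1 : u < 1 by rewrite !gt_max t11 s1 ltr_pdivrMr// mul1r.
have ut : t1 <= u by rewrite !le_max lexx.
have us : s <= u by rewrite !le_max lexx orbT.
have up : s / p <= u by rewrite le_max lexx orbT.
clearbody u; pose t := (u + 1) / 2.
have tu : u < t by rewrite /t; lra.
have t1' : t < 1 by rewrite /t; lra.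
have ms : modulus s%:C%C = s by rewrite modulus_real ger0_norm.
have st : modulus s%:C%C < t by rewrite ms; lra.
have := @schwarz R phi 1 t s%:C%C 1 t1' st hphi phi0 (fun w wt => bnd t w (le_lt_trans ut tu)
  t1' wt).
rewrite mul1r -/p ms ler_pdivlMr; last lra.
move: up; rewrite ler_pdivrMr//; nra.
Qed.

End SchwarzPolydisk.

Lemma entry_le_mx_norm (K : numFieldType) m n (x : 'M[K]_(m, n)) i j :
  `|x i j| <= mx_norm x.
Proof. by rewrite mx_normE -[leLHS]nngE num_le; exact: (le_bigmax _ _ (i, j)). Qed.

(** * Comparison with the library's norm, closure and differentiability *)

Section LibraryNorm.
Variable R : realType.
Local Notation C := R[i].

Lemma normr_modulus (w : C) : `|w| = (modulus w)%:C%C.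
Proof. by []. Qed.

Lemma pos_complex (e : C) : 0 < e -> exists2 t : R, 0 < t & e = t%:C%C.
Proof.
case: e => a b; rewrite ltcE /= => /andP[/eqP -> a0]; by exists a.
Qed.

Lemma normr_vnorm n (x : 'rV[C]_n) : `|x| = (vnorm x)%:C%C.
Proof.
have up i : `|x ord0 i| <= mx_norm x by exact: entry_le_mx_norm.
rewrite [LHS]/Num.norm /=.
have [x0|x0] := eqVneq (mx_norm x) 0.
  by rewrite x0 (mx_norm_eq0 x0) vnorm0.
have [[i j] /= xij] := mx_norm_neq0 x0; rewrite (ord1 i) in xij.
apply/eqP; rewrite eq_le; apply/andP; split.
  by rewrite [leLHS]xij normr_modulus lecR modulus_le_vnorm.
have : vnorm x <= modulus (x ord0 j).
  apply: vnorm_le => [|k]; first exact: modulus_ge0.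
  by rewrite -lecR -!normr_modulus -xij; exact: up.
by rewrite -lecR -normr_modulus -xij.
Qed.

Lemma nbhs_bal n (x : 'rV[C]_n) (B : set 'rV[C]_n) :
  nbhs x B <-> exists2 t : R, 0 < t & bal x t `<=` B.
Proof.
rewrite -nbhs_nbhs_norm; split => [[e /pos_complex[t t0 ->] tB]|[t t0 tB]].
  exists t => // y; rewrite /bal /= => yx; apply: tB.
  by rewrite /= distrC normr_vnorm ltcR.
exists t%:C%C; first by rewrite /= ltcR.
by move=> y; rewrite /= distrC normr_vnorm ltcR => yx; exact: tB.
Qed.

Lemma closure_polydisk n (r : R) (x : 'rV[C]_n) : 0 < r ->
  closure (polydisk r) x <-> vnorm x <= r.
Proof.
move=> r0; split => [cx|xr].
  rewrite leNgt; apply/negP => rx.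
  have [|y [/polydiskP yr]] := cx (bal x (vnorm x - r)).
    by apply/nbhs_bal; exists (vnorm x - r) => //; lra.
  rewrite /bal /= => yx; have := yr r0; have := vnorm_tri x 0 y;
    rewrite !subr0 (vnorm_subC x); lra.
move=> B /nbhs_bal[t t0 tB].
have v0 := vnorm_ge0 x.
(* Scaling [x] by 1 - k brings it into the open polydisk and moves it by less than [t]. *)
pose k := Num.min (1 / 2) (t / 2 / (r + 1)).
have k0 : 0 < k by rewrite lt_min !divr_gt0//; lra.
have k1 : k <= 1 / 2 by rewrite ge_min lexx.
have kt : k * (r + 1) <= t / 2.
  by rewrite -ler_pdivlMr; [rewrite ge_min lexx orbT|lra].
clearbody k; exists ((1 - k)%:C%C *: x); split.
  apply/polydiskP => //; rewrite vnormZ modulus_real ger0_norm; last lra.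
  have [x0|x0] := eqVneq (vnorm x) 0; first by rewrite x0 mulr0.
  have : 0 < vnorm x by rewrite lt_def x0.
  nra.
apply: tB; rewrite /bal /= -{2}[x]scale1r -scalerBl vnormZ.
rewrite -(rmorph1 (real_complex R)) -rmorphB modulus_real.
rewrite (_ : 1 - k - 1 = - k); last by ring.
by rewrite normrN gtr0_norm//; nra.
Qed.

Lemma differentiable_vsd n m (f : 'rV[C]_n -> 'rV[C]_m) x :
  differentiable f x -> exists A, vsd f x A.
Proof.
move=> /diff_locallyP [_ /eqaddoP fo]; exists (lin1_mx ('d f x)) => j e e0.
have [|t t0 ht] := (nbhs_bal _ _).1 (fo e%:C%C _); first by rewrite ltcR.
exists t => // w wt; have := ht (w - x).
rewrite /bal /= subr0 => /(_ wt).
rewrite !fctE /= subrK normr_vnorm normr_vnorm -rmorphM lecR => h.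
apply: le_trans h; rewrite mulmx_col_entry mul_rV_lin1.
have := modulus_le_vnorm (f w - (f x + 'd f x (w - x))) j.
by rewrite !mxE opprD addrA.
Qed.

Lemma vsd_differentiable n m (f : 'rV[C]_n -> 'rV[C]_m) x A :
  vsd f x A -> differentiable f x.
Proof.
move=> fA; pose df : {linear 'rV[C]_n -> 'rV[C]_m} := mulmxr A.
have dfc : continuous df.
  move=> y B /nbhs_bal[t t0 tB]; have [c c0 hc] := vnorm_mulmx A.
  apply/nbhs_bal; exists (t / c); first exact: divr_gt0.
  move=> z; rewrite /bal /= ltr_pdivlMr// => zy; apply: tB.
  rewrite /bal /= -mulmxBl; apply: le_lt_trans (hc _) _.
  by rewrite mulrC.
have est (e : C) : 0 < e -> nbhs (0 : 'rV[C]_n) (fun h => `|f (h + x) - (f x + h *m A)| <= e *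
  `|h|).
  move=> /pos_complex[{}e e0 ->]; have [t t0 ht] := vsd_bound fA e0.
  apply/nbhs_bal; exists t => // h; rewrite /bal /= subr0 => ht'.
  have := ht (h + x); rewrite addrK => /(_ ht').
  by rewrite !normr_vnorm -rmorphM lecR opprD addrA.
have dfx : 'd f x = df :> ('rV[C]_n -> 'rV[C]_m).
  by apply: diff_unique dfc _; apply/eqaddoP => e /est.
apply/diff_locallyP; rewrite dfx; split => //.
by apply/eqaddoP => e /est.
Qed.

End LibraryNorm.

(** * The squeezing function of the shell *)

Section Squeezing.
Variable R : realType.
Local Notation C := R[i].

(** For [a] in [0, 1) this is the pseudo-hyperbolic distance in the unit disc from a point of
    modulus [a] to the closed disc of radius [r]; it is 0 when [a <= r]. *)
Definition gap (r a : R) : R := (Num.max a r - r) / (1 - r * a).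

Lemma gap_ge0 (r a : R) : 0 < r < 1 -> 0 <= a < 1 -> 0 <= gap r a.
Proof.
move=> r01 a01; rewrite divr_ge0 ?subr_ge0 ?le_max ?lexx ?orbT//; nra.
Qed.

Lemma gap_lt1 (r a : R) : 0 < r < 1 -> 0 <= a < 1 -> gap r a < 1.
Proof.
move=> r01 a01; rewrite ltr_pdivrMr; last by nra.
by rewrite mul1r ltrBlDr gt_max; apply/andP; split; nra.
Qed.

Lemma gap_gt0 (r a : R) : 0 < r < 1 -> r < a < 1 -> 0 < gap r a.
Proof.
move=> r01 a01; rewrite divr_gt0 ?subr_gt0 ?lt_max ?(andP a01).1//; nra.
Qed.

(** [u] is the nearest point of the closed disc as seen from [a] placed at the center: [a] itself if
    |a| <= r, otherwise the point of modulus [r] on the same ray. *)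
Lemma gap_nearest (r : R) (a : C) : 0 < r < 1 -> modulus a < 1 ->
  exists u, [/\ modulus u = gap r (modulus a), modulus u < 1, modulus (moebius a u) <= r &
    r < modulus a -> modulus (moebius a u) = r].
Proof.
move=> r01 a1; have a0 := modulus_ge0 a.
have na1 : modulus (- a) < 1 by rewrite modulusN.
have [ar|ra] := leP (modulus a) r.
  exists 0; rewrite moebius0 modulus0 /gap (max_idPr ar) subrr mul0r; split => //.
have ap : 0 < modulus a by lra.
pose c := r / modulus a; have cr : modulus a * c = r by rewrite /c mulrC divfK//; apply/eqP; lra.
have c0 : 0 < c by rewrite divr_gt0//; lra.
have c1 : c < 1 by rewrite ltr_pdivrMr// mul1r.
clearbody c.
have wr : modulus (a * c%:C%C) = r by rewrite modulusM modulus_real ger0_norm// ltW.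
have w1 : modulus (a * c%:C%C) < 1 by lra.
exists (moebius (- a) (a * c%:C%C)).
have back : moebius a (moebius (- a) (a * c%:C%C)) = a * c%:C%C.
  by rewrite -{1}(opprK a) moebiusK.
rewrite back wr; split => //; last exact: moebius_lt1.
rewrite /gap (max_idPl (ltW ra)) /moebius rmorphN /=.
have -> : a * c%:C%C - a = a * (c - 1)%:C%C by rewrite rmorphB rmorph1; ring.
have -> : 1 + - (a^*)%C * (a * c%:C%C) = (1 - modulus a * r)%:C%C.
  rewrite mulNr mulrA [(a^*)%C * a]mulrC conj_mul_modulus -rmorphM -cr.
  by rewrite rmorphB rmorph1 expr2 mulrA.
rewrite modulusM modulusV modulusM !modulus_real.
rewrite [`|c - 1|]ltr0_norm ?[`|1 - _|]gtr0_norm; [|nra|lra].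
rewrite [modulus a * r]mulrC -{2}cr; congr (_ / _); ring.
Qed.

Variable n : nat.
Local Notation V := 'rV[C]_n.+2.
Implicit Types (z x : V) (r s : R).

Lemma punctured_polydiskE r : 0 < r ->
  polydisk 1 `\` closure (polydisk r) = [set x : V | r < vnorm x < 1].
Proof.
move=> r0; apply/seteqP; split => x /=.
  move=> [/polydiskP x1 nx]; apply/andP; split; last exact: x1.
  by rewrite ltNge; apply/negP => xr; apply: nx; apply/closure_polydisk.
by move=> /andP[rx x1]; split; [exact/polydiskP|move=> /closure_polydisk -/(_ r0);
  rewrite leNgt rx].
Qed.

Definition gap_max r z : R := \big[Num.max/0]_i gap r (modulus (z ord0 i)).

Lemma gap_max_attained r z : 0 < r < 1 -> polydisk 1 z ->
  exists2 i, gap_max r z = gap r (modulus (z ord0 i)) &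
    forall j, gap r (modulus (z ord0 j)) <= gap r (modulus (z ord0 i)).
Proof.
move=> r01 z1.
have [i _ hi] := @arg_maxP _ _ _ ord0 xpredT (fun i => gap r (modulus (z ord0 i))) isT.
exists i; last by move=> j; exact: hi.
apply/eqP; rewrite eq_le; apply/andP; split.
  rewrite /gap_max; elim/big_ind : _ => [|a b ha hb|j _]; [|by rewrite ge_max ha|exact: hi].
  by apply: gap_ge0 => //; rewrite modulus_ge0 z1.
by rewrite /gap_max (bigD1 i)//= le_max lexx.
Qed.

Lemma gap_max_bounds r z : 0 < r < 1 -> r < vnorm z < 1 -> 0 < gap_max r z < 1.
Proof.
move=> r01 /andP[rz zn]; have z1 : polydisk 1 z by apply/polydiskP.
have [i -> hi] := gap_max_attained r01 z1; apply/andP; split; last first.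
  by apply: gap_lt1 => //; rewrite modulus_ge0 z1.
have [j zj] := vnorm_attained z; apply: lt_le_trans (hi j).
by apply: gap_gt0 => //; rewrite -zj rz.
Qed.

(** The nearest points of all coordinates, seen from [z], form a vector of norm [gap_max r z], and
    [v] is its normalization. The image has norm exactly [r] because the coordinate with the largest
    gap has modulus above [r]. *)
Lemma extremal_disc r z : 0 < r < 1 -> r < vnorm z < 1 -> exists v : V,
  vnorm v = 1 /\ vnorm (pmoebius z ((gap_max r z)%:C%C *: v)) = r.
Proof.
move=> r01 zD; have /andP[rz zn] := zD; have z1 : polydisk 1 z by apply/polydiskP.
have /andP[g0 g1] := gap_max_bounds r01 zD.
have [i gi hi] := gap_max_attained r01 z1.
have /choice[u hu] : forall j, exists u, [/\ modulus u = gap r (modulus (z ord0 j)), modulus u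
  < 1,
    modulus (moebius (z ord0 j) u) <= r &
    r < modulus (z ord0 j) -> modulus (moebius (z ord0 j) u) = r].
  by move=> j; apply: gap_nearest.
pose uv : V := \row_j u j.
have nu : vnorm uv = gap_max r z.
  apply/eqP; rewrite eq_le gi; apply/andP; split.
    by apply: vnorm_le => [|j]; [rewrite -gi ltW|rewrite mxE; have [-> _ _ _] := hu j].
  by have := modulus_le_vnorm uv i; rewrite mxE; have [-> _ _ _] := hu i.
have gz : (gap_max r z)%:C%C != 0 :> C by rewrite -modulus_gt0 modulus_real gtr0_norm.
exists (((gap_max r z)%:C%C)^-1 *: uv); split.
  by rewrite vnormZ modulusV modulus_real gtr0_norm// nu mulVf//; apply/eqP; lra.
rewrite scalerA divff// scale1r; apply/eqP; rewrite eq_le; apply/andP; split.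
  by apply: vnorm_le => [|j]; [lra|rewrite !mxE; have [_ _ -> _] := hu j].
have ri : r < modulus (z ord0 i).
  rewrite ltNge; apply/negP => zr; move: g0.
  by rewrite gi /gap (max_idPr zr) subrr mul0r ltxx.
have := modulus_le_vnorm (pmoebius z uv) i; rewrite !mxE.
by have [_ _ _ ->] := hu i.
Qed.

Lemma squeezing_radii_le r z s : 0 < r < 1 -> r < vnorm z < 1 ->
  squeezing_radii [set x : V | r < vnorm x < 1] z s -> s <= gap_max r z.
Proof.
move=> r01 zD [s0 [f [fhol finj f1 fz fs]]].
have /andP[r0 r1] := r01; have /andP[g0 g1] := gap_max_bounds r01 zD.
have z1 : polydisk 1 z by case/andP: zD => _ ?; apply/polydiskP.
rewrite leNgt; apply/negP => gs.
have fcoord j : hol [set x : V | r < vnorm x < 1] (fun x => f x ord0 j).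
  by move=> x /fhol/differentiable_vsd[A hA]; exists (col j A).
have fle j x : r < vnorm x < 1 -> modulus (f x ord0 j) <= 1.
  by move=> xD; apply/ltW; have : polydisk 1 (f x) by apply: f1; exists x.
(* Hartogs, one component at a time, with bound 1 since [f] maps into the unit polydisk. *)
have /choice[F hF] : forall j, exists F, hol (polydisk 1) F /\
    forall x, r < vnorm x < 1 -> F x = f x ord0 j.
  by move=> j; have [F ? ?] := hartogs r0 r1 (fcoord j) (fle j); exists F.
pose FF x : V := \row_j F j x.
have FFE x : r < vnorm x < 1 -> FF x = f x.
  by move=> xD; apply/rowP => j; rewrite mxE (hF j).2.
have FFhol : vhol (polydisk 1) FF.
  move=> x x1; apply: vsd_of_coord => j; have [L hL] := (hF j).1 x x1; exists L.
  by move: hL; congr (sd _ x _); apply/funext => y; rewrite mxE.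
have [v [v1 wr]] := extremal_disc r01 zD.
set w := pmoebius _ _ in wr.
have w1 : polydisk 1 w by apply/polydiskP => //; rewrite wr.
have Fw : vnorm (FF w) <= gap_max r z.
  apply: vnorm_le => [|j]; first exact: ltW.
  rewrite mxE; apply: schwarz_polydisk r0 r1 (hF j).1 _ z1 _ v1 _.
  - by move=> x xD; rewrite (hF j).2// fle.
  - by rewrite (hF j).2// fz mxE.
  - by rewrite ltW.
have [A hA] := FFhol w w1.
(* The margin [s - gap_max r z] keeps the values of [FF] near [w] in the polydisk of radius [s],
   which [f] covers. *)
have d0 : 0 < Num.min (s - gap_max r z) (1 - r) by rewrite lt_min; lra.
have [d dpos hd] := vsd_continuous hA d0.
have m0 : 0 < Num.min d (1 - r) by rewrite lt_min dpos; lra.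
apply: (boundary_not_covered r0 r1 FFhol _ wr m0).
  by move=> x y xD yD; rewrite !FFE// => fxy; apply: finj => //; rewrite inE.
move=> x; rewrite lt_min => /andP[/hd]; rewrite lt_min => /andP[xs _] _.
have : polydisk s (FF x).
  by apply/polydiskP => //; have := vnorm_tri (FF x) 0 (FF w); rewrite !subr0; lra.
by move=> /fs[u uD fu]; exists u; split => //; rewrite FFE.
Qed.

Lemma gap_max_squeezing_radius r z : 0 < r < 1 -> r < vnorm z < 1 ->
  squeezing_radii [set x : V | r < vnorm x < 1] z (gap_max r z).
Proof.
move=> r01 zD; have /andP[g0 g1] := gap_max_bounds r01 zD.
have z1 : polydisk 1 z by case/andP: zD => _ ?; apply/polydiskP.
have nz1 := polydiskN z1.
have D1 x : r < vnorm x < 1 -> polydisk 1 x by case/andP => _ ?; apply/polydiskP.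
split => //; exists (pmoebius (- z)); split.
- move=> x /D1 x1.
  suff [A hA] : exists A, vsd (pmoebius (- z)) x A by exact: vsd_differentiable hA.
  apply: vsd_of_coord => j; have [c hc] := cd_moebius (nz1 j) (x1 j).
  exists (c *: delta_mx j ord0); have := sd_comp1 (sd_coord j x) hc.
  by congr (sd _ x _); apply/funext => y; rewrite [RHS]mxE.
- move=> x y; rewrite !inE => /D1 x1 /D1 y1 /(congr1 (pmoebius z)).
  by rewrite -{1 3}(opprK z) !pmoebiusK.
- by move=> _ [x /D1 x1 <-]; exact: pmoebius_polydisk.
- by apply/rowP => j; rewrite !mxE /moebius subrr mul0r.
- move=> y yg; have y1 : polydisk 1 y by move=> j; apply: lt_trans (yg j) g1.
  exists (pmoebius z y); last by rewrite pmoebiusK.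
  have p1 := pmoebius_polydisk z1 y1.
  rewrite /=; apply/andP; split; last exact/polydiskP.
  (* One coordinate beyond [r] suffices, and the one with the largest gap is taken: with a = |z_i| >
     r and b = |y_i|, b < (a - r) / (1 - r a) rearranges to (a - b) / (1 - a b) > r, and
     [moebius_lower] applies. *)
  have [i gi _] := gap_max_attained r01 z1.
  apply: lt_le_trans (modulus_le_vnorm _ i); rewrite mxE.
  have := yg i; rewrite gi; have := moebius_lower (z1 i) (y1 i).
  have a0 := modulus_ge0 (z ord0 i); have b0 := modulus_ge0 (y ord0 i).
  have := z1 i; have := y1 i; rewrite /gap.
  set a := modulus (z ord0 i) in a0 *; set b := modulus (y ord0 i) in b0 *.
  move=> b1 a1 low; have ra0 : 0 < 1 - r * a by nra.
  have [ar|ra] := leP a r; first by rewrite subrr mul0r; lra.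
  rewrite ltr_pdivlMr// => h; have ab0 : 0 < 1 - a * b by nra.
  have := le_trans (ler_norm (a - b)) low => low'.
  rewrite -(ltr_pM2r ab0); apply: lt_le_trans low'; nra.
Qed.

End Squeezing.

(* Every term of the maximum is nonnegative when [z] lies in the unit polydisk,
   so the default value 0 does not affect it. *)
Theorem corollary3p1 (R : realType) (n : nat) (hn : (2 <= n)%N) (r : R)
    (hr0 : 0 < r) (hr1 : r < 1) (z : 'rV[R[i]]_n)
    (hz : (polydisk 1 `\` closure (polydisk r)) z) :
  squeezing (polydisk 1 `\` closure (polydisk r)) z =
  \big[Num.max/0]_(i < n)
    ((Num.max (modulus (z ord0 i)) r - r) / (1 - r * modulus (z ord0 i))).
Proof.
case: n hn z hz => [|[|n]] // _ z; rewrite punctured_polydiskE// => zD.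
have r01 : 0 < r < 1 by rewrite hr0.
have ub := fun s => @squeezing_radii_le R n r z s r01 zD.
have rad := gap_max_squeezing_radius r01 zD.
apply/eqP; rewrite eq_le; apply/andP; split.
  by apply: ge_sup => //; exists (gap_max r z).
by apply: ub_le_sup => //; exists (gap_max r z).
Qed.
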